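(* Under the setup in the context, there is an isomorphism of $K$-algebras $\mathfrak R_{\mathrm{rk}}\cong\mathcal M_K$. Moreover, if the involution of $K$ is positive definite, then $\mathfrak R_{\mathrm{rk}}$, with the involution extending that of $\mathfrak R_\infty$, is a $*$-regular ring, $\Phi(\mathcal A)$ is a $*$-subalgebra of it (i.e. $\Phi$ is a $*$-homomorphism), and $\mathfrak R_{\mathrm{rk}}\cong\mathcal M_K$ as $*$-algebras over $K$.
   Context: Let $X$ be an infinite, totally disconnected, compact metrizable space, $T\colon X\to X$ a homeomorphism, $K$ a field with involution $\lambda\mapsto\bar\lambda$ (possibly the identity), $C_K(X)$ the $*$-algebra of locally constant functions $X\to K$, and $\mathcal A=C_K(X)\rtimes_T\mathbb Z$ the algebraic crossed product (finite sums $\sum f_it^i$, $tf=(f\circ T^{-1})t$, $(ft^i)^*=t^{-i}f^*$). Let $\mu$ be a full, ergodic, $T$-invariant Borel probability measure on $X$. Construction. Fix $y\in X$, a decreasing sequence of clopen sets $E_n$ with $\bigcap_nE_n=\{y\}$, and partitions $\mathcal P_n$ of $X\setminus E_n$ into finitely many nonempty pairwise disjoint clopen sets such that each member of $\mathcal P_{n+1}\cup\{E_{n+1}\}$ lies in a member of $\mathcal P_n\cup\{E_n\}$ and $\bigcup_n(\mathcal P_n\cup\{E_n\})$ generates the topology. $\mathcal A_n$ = unital $*$-subalgebra generated by $\{\chi_Zt:Z\in\mathcal P_n\}$; $\mathcal A_\infty=\bigcup_n\mathcal A_n$. $\mathcal V_n$ = set of nonempty $W=E_n\cap T^{-1}(Z_1)\cap\cdots\cap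 T^{-k+1}(Z_{k-1})\cap T^{-k}(E_n)$ ($Z_i\in\mathcal P_n$), $|W|=k$; $s_n=\chi_{X\setminus E_n}t$, $e_{ij}(W)=s_n^i\chi_W(s_n^* )^j$, $h_W=\sum_{l<|W|}\chi_{T^l(W)}$, $h_W\mathcal A_n\cong M_{|W|}(K)$ via $e_{ij}(W)\mapsto e_{ij}$. $\mathfrak R_n=\prod_{W\in\mathcal V_n}M_{|W|}(K)$ (conjugate-transpose involution in each factor), $\pi_n(a)=(h_Wa)_W$; $J(W,W')=\{j'\in\{0,\dots,|W'|-1\}:T^{j'}(W')\subseteq W\}$ and $j_n((a_W)_W)=(\sum_W\sum_{j'\in J(W,W')}\sum_{i,j}(a_W)_{ij}e_{i+j',j+j'})_{W'}$ (block-diagonal injective $*$-homomorphisms with $j_n\pi_n=\pi_{n+1}|_{\mathcal A_n}$). $\mathfrak R_\infty=\varinjlim(\mathfrak R_n,j_n)$ with embedding $\pi_\infty$ of $\mathcal A_\infty$; $\mathrm{rk}_{\mathfrak R_n}((x_W))=\sum_W\mu(W)\mathrm{Rk}(x_W)$ induce a rank function $\mathrm{rk}_{\mathfrak R_\infty}$, and $\mathfrak R_{\mathrm{rk}}$ is the completion of $\mathfrak R_\infty$ for the metric $\mathrm{rk}_{\mathfrak R_\infty}(x-y)$. $\Phi\colon\mathcal A\to\mathfrak R_{\mathrm{rk}}$ is the injective homomorphism extending $\pi_\infty$ with $\Phi(t)=\lim_n\pi_\infty(\chi_{X\setminus E_n}t)$. $\mathcal M_K$ (the von Neumann continuous factor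 over $K$) is the completion of $\varinjlim_nM_{2^n}(K)$ (connecting maps $x\mapsto\mathrm{diag}(x,x)$) with respect to the metric induced by its unique rank function (the limit of the normalized ranks $\mathrm{Rk}/2^n$), with the involution induced by the conjugate-transpose involutions. An involution on $K$ is positive definite if $\sum_{i=1}^n\bar x_ix_i=0$ implies all $x_i=0$. A $*$-regular ring is a von Neumann regular ring with an involution such that $x^*x=0$ implies $x=0$. *)

(* Defs.v *)
From HB Require Import structures.
From mathcomp Require Import all_boot all_order all_algebra.
From mathcomp Require Import all_classical all_reals all_analysis.
Set Implicit Arguments. Unset Strict Implicit. Unset Printing Implicit Defensive.
Import Order.TTheory GRing.Theory Num.Theory.
Local Open Scope classical_set_scope.
Local Open Scope ring_scope.

Definition field_involution (K : fieldType) (c : K -> K) : Prop :=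
  [/\ forall x y, c (x + y) = c x + c y,
      forall x y, c (x * y) = c x * c y
    & forall x, c (c x) = x].

Definition positive_definite (K : fieldType) (c : K -> K) : Prop :=
  forall (n : nat) (x : 'I_n -> K),
    \sum_(i < n) c (x i) * x i = 0 -> forall i, x i = 0.

Definition mxsq (K : fieldType) (k : nat) (f : nat -> nat -> K) : 'M[K]_k :=
  \matrix_(i < k, j < k) f i j.

(* An element of the direct limit is a pair (n, x) with x at level n;  *)
(* an element of the completion is (the class of) a Cauchy sequence of *)
(* such pairs, two Cauchy sequences being identified when their        *)
(* distance tends to 0.  Algebra operations are defined termwise.      *)
Section DirectedSystems.
Variables (K : fieldType) (R : realType).

Record dsys := DSys {
  del : Type;                          (* carrier for elements of all levels *)
  dlift : nat -> del -> del;           (* connecting map level n -> n+1 *)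
  dadd : del -> del -> del;
  dopp : del -> del;
  dscale : K -> del -> del;
  dmul : nat -> del -> del -> del;
  done : nat -> del;
  dstar : nat -> del -> del;
  drk : nat -> del -> \bar R
}.
Arguments del : clear implicits.
Arguments dlift : clear implicits.
Arguments dadd : clear implicits.
Arguments dopp : clear implicits.
Arguments dscale : clear implicits.
Arguments dmul : clear implicits.
Arguments done : clear implicits.
Arguments dstar : clear implicits.
Arguments drk : clear implicits.

Variable S : dsys.

Fixpoint dup (n k : nat) (x : del S) : del S :=
  if k is k'.+1 then dlift S (n + k') (dup n k' x) else x.

Definition dat (M : nat) (p : nat * del S) : del S := dup p.1 (M - p.1) p.2.

Definition ddist (p q : nat * del S) : \bar R :=
  let M := maxn p.1 q.1 in drk S M (dadd S (dat M p) (dopp S (dat M q))).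

Definition cseq := nat -> nat * del S.

Definition cauchy (s : cseq) : Prop :=
  forall e : R, 0 < e -> exists N, forall k l, (N <= k)%N -> (N <= l)%N ->
    (ddist (s k) (s l) < e%:E)%E.

Definition cequiv (s t : cseq) : Prop :=
  forall e : R, 0 < e -> exists N, forall k, (N <= k)%N ->
    (ddist (s k) (t k) < e%:E)%E.

Definition cadd (s t : cseq) : cseq := fun k =>
  let M := maxn (s k).1 (t k).1 in (M, dadd S (dat M (s k)) (dat M (t k))).
Definition cmul (s t : cseq) : cseq := fun k =>
  let M := maxn (s k).1 (t k).1 in (M, dmul S M (dat M (s k)) (dat M (t k))).
Definition cone : cseq := fun _ => (0%N, done S 0).
Definition czero : cseq := fun _ => (0%N, dscale S 0 (done S 0)).
Definition cscale (a : K) (s : cseq) : cseq := fun k => ((s k).1, dscale S a (s k).2).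
Definition cstar (s : cseq) : cseq := fun k => ((s k).1, dstar S (s k).1 (s k).2).

Definition star_regular (c : K -> K) : Prop :=
  (forall s, cauchy s -> exists2 u, cauchy u & cequiv (cmul (cmul s u) s) s) /\
  (forall s, cauchy s -> cauchy (cstar s)) /\
  (forall s t, cauchy s -> cauchy t -> cequiv s t -> cequiv (cstar s) (cstar t)) /\
  (forall s, cauchy s -> cequiv (cstar (cstar s)) s) /\
  (forall s t, cauchy s -> cauchy t -> cequiv (cstar (cadd s t)) (cadd (cstar s) (cstar t))) /\
  (forall s t, cauchy s -> cauchy t -> cequiv (cstar (cmul s t)) (cmul (cstar t) (cstar s))) /\
  (forall a s, cauchy s -> cequiv (cstar (cscale a s)) (cscale (c a) (cstar s))) /\
  (forall s, cauchy s -> cequiv (cmul (cstar s) s) czero -> cequiv s czero).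

End DirectedSystems.


Arguments cequiv {K R S}.
Arguments cauchy {K R S}.

Definition alg_iso (K : fieldType) (R : realType) (S1 S2 : dsys K R)
    (f : cseq S1 -> cseq S2) : Prop :=
  (forall s, cauchy s -> cauchy (f s)) /\
  (forall s t, cauchy s -> cauchy t -> (cequiv s t <-> cequiv (f s) (f t))) /\
  (forall u, cauchy u -> exists2 s, cauchy s & cequiv (f s) u) /\
  (forall s t, cauchy s -> cauchy t -> cequiv (f (cadd s t)) (cadd (f s) (f t))) /\
  (forall s t, cauchy s -> cauchy t -> cequiv (f (cmul s t)) (cmul (f s) (f t))) /\
  cequiv (f (cone S1)) (cone S2) /\
  (forall a s, cauchy s -> cequiv (f (cscale a s)) (cscale a (f s))).

Definition star_alg_iso (K : fieldType) (R : realType) (S1 S2 : dsys K R)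
    (f : cseq S1 -> cseq S2) : Prop :=
  alg_iso f /\ (forall s, cauchy s -> cequiv (f (cstar s)) (cstar (f s))).

(* The von Neumann continuous factor M_K: lim M_{2^n}(K), x |-> diag(x,x) *)
(* Matrices of size 2^n are functions nat -> nat -> K (entries i,j<2^n). *)
Section MK.
Variables (K : fieldType) (R : realType) (c : K -> K).
Definition mel := nat -> nat -> K.
Definition mlift (n : nat) (x : mel) : mel := fun a b =>
  if (a < 2 ^ n)%N && (b < 2 ^ n)%N then x a b
  else if [&& (2 ^ n <= a)%N, (a < 2 ^ n.+1)%N, (2 ^ n <= b)%N & (b < 2 ^ n.+1)%N]
  then x (a - 2 ^ n)%N (b - 2 ^ n)%N else 0.
Definition MK_sys : dsys K R :=
  @DSys K R mel mlift
    (fun x y a b => x a b + y a b)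
    (fun x a b => - x a b)
    (fun k x a b => k * x a b)
    (fun n x y a b => \sum_(l < 2 ^ n) x a l * y l b)
    (fun _ a b => (a == b)%:R)
    (fun _ x a b => c (x b a))
    (fun n x => (((\rank (mxsq (2 ^ n) x))%:R / (2 ^ n)%:R : R)%:E)).
End MK.

Section Dyn.
Variables (R : realType) (X : pseudoPMetricType R) (K : fieldType) (c : K -> K).
Variables (T Ti : X -> X).

Definition locally_constant (f : X -> K) : Prop :=
  forall x, exists U : set X, [/\ open U, U x & forall z, U z -> f z = f x].

Definition chi (S : set X) : X -> K := fun x => if `[< S x >] then 1 else 0.

(* T^z for z : int (Ti is the inverse of T) *)
Definition Tz (z : int) : X -> X :=
  match z with Posz n => iter n T | Negz n => iter n.+1 Ti end.

(* The algebraic crossed product C_K(X) x_T Z: an element is a formal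
   finite sum  sum_p (p.2) t^(p.1); two lists are equal elements iff they
   have the same coefficient functions. *)
Definition Aelt := seq (int * (X -> K)).
Definition coefA (a : Aelt) (k : int) (x : X) : K :=
  \sum_(p <- a | p.1 == k) p.2 x.
Definition Aeq (a b : Aelt) : Prop := forall k x, coefA a k x = coefA b k x.
Definition Avalid (a : Aelt) : Prop := forall i, (i < size a)%N -> locally_constant (nth (0%Z, fun _ => 0) a i).2.
Definition Aadd (a b : Aelt) : Aelt := a ++ b.
Definition Aone : Aelt := [:: (0%Z, fun _ => 1)].
Definition Ascale (k : K) (a : Aelt) : Aelt := [seq (p.1, fun x => k * p.2 x) | p <- a].
(* (f t^i)(g t^j) = f (g o T^{-i}) t^{i+j} *)
Definition Amul (a b : Aelt) : Aelt :=
  [seq (p.1 + q.1, fun x => p.2 x * q.2 (Tz (- p.1) x)) | p <- a, q <- b].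
(* (f t^i)^* = t^{-i} f^* = (f^* o T^i) t^{-i} *)
Definition Astar (a : Aelt) : Aelt := [seq (- p.1, fun x => c (p.2 (Tz p.1 x))) | p <- a].
Definition Apow (a : Aelt) (n : nat) : Aelt := iter n (Amul a) Aone.
Definition At : Aelt := [:: (1%Z, fun _ => 1)].
Definition Achi (S : set X) : Aelt := [:: (0%Z, chi S)].

Variables (E : nat -> set X) (P : nat -> seq (set X)).

Definition memPE (n : nat) (B : set X) : Prop :=
  B = E n \/ exists2 i, (i < size (P n))%N & B = nth set0 (P n) i.

(* W(w) for a word w = (Z_1,...,Z_{k-1}) of (indices of) members of P_n;
   |W| = k = size w + 1 *)
Definition Wset (n : nat) (w : seq nat) : set X :=
  [set x | E n x /\
     (forall i, (i < size w)%N -> nth set0 (P n) (nth 0%N w i) (iter i.+1 T x)) /\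
     E n (iter (size w).+1 T x)].

Definition inV (n : nat) (w : seq nat) : Prop :=
  all (fun i => i < size (P n))%N w /\ Wset n w !=set0.

Definition sn (n : nat) : Aelt := Amul (Achi (~` E n)) At.
Definition eij (n : nat) (w : seq nat) (i j : nat) : Aelt :=
  Amul (Amul (Apow (sn n) i) (Achi (Wset n w))) (Apow (Astar (sn n)) j).
Definition hW (n : nat) (w : seq nat) : Aelt :=
  flatten [seq Achi [set iter l T x | x in Wset n w] | l <- iota 0 (size w).+1].

Inductive inA (n : nat) : Aelt -> Prop :=
| inA_gen i : (i < size (P n))%N -> inA n (Amul (Achi (nth set0 (P n) i)) At)
| inA_one : inA n Aone
| inA_add a b : inA n a -> inA n b -> inA n (Aadd a b)
| inA_mul a b : inA n a -> inA n b -> inA n (Amul a b)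
| inA_scale k a : inA n a -> inA n (Ascale k a)
| inA_star a : inA n a -> inA n (Astar a)
| inA_eq a b : Aeq a b -> inA n a -> inA n b.

(* Elements of R_n = prod_{W in V_n} M_{|W|}(K): a block for each word w
   (only blocks with inV n w and entries < size w + 1 are meaningful). *)
Definition blk := seq nat -> nat -> nat -> K.

(* the unique W in V_n with T^j(W') contained in W, if any *)
Definition parentW (n : nat) (w' : seq nat) (j : nat) : option (seq nat) :=
  match pselect (exists w, inV n w /\
                   [set iter j T x | x in Wset n.+1 w'] `<=` Wset n w) with
  | left H => Some (proj1_sig (cid H))
  | right _ => None
  end.

Definition jblk (n : nat) (x : blk) : blk := fun w' a b =>
  \sum_(j < (size w').+1)
     match parentW n w' j with
     | Some w => if [&& (j <= a)%N, (a < j + (size w).+1)%N, (j <= b)%N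
                      & (b < j + (size w).+1)%N]
                 then x w (a - j)%N (b - j)%N else 0
     | None => 0
     end.

Variable mu : {measure set (g_sigma_algebraType (@open X)) -> \bar R}.

Definition rkR (n : nat) (x : blk) : \bar R :=
  \esum_(w in [set w | inV n w])
     (mu (Wset n w) * ((\rank (mxsq (size w).+1 (x w)))%:R : R)%:E)%E.

Definition R_sys : dsys K R :=
  @DSys K R blk jblk
    (fun x y w a b => x w a b + y w a b)
    (fun x w a b => - x w a b)
    (fun k x w a b => k * x w a b)
    (fun n x y w a b => \sum_(l < (size w).+1) x w a l * y w l b)
    (fun _ w a b => (a == b)%:R)
    (fun _ x w a b => c (x w b a))
    rkR.

(* x represents pi_n(a): h_W a = sum_{i,j<|W|} x_W(i,j) e_ij(W) for W in V_n *)
Definition represents (n : nat) (a : Aelt) (x : blk) : Prop :=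
  forall w, inV n w ->
    Aeq (Amul (hW n w) a)
        (flatten [seq Ascale (x w i j) (eij n w i j) |
                    i <- iota 0 (size w).+1, j <- iota 0 (size w).+1]).

(* Phi : A -> R_rk is the homomorphism of K-algebras extending pi_infty
   with Phi(t) = lim_n pi_infty(chi_{X \ E_n} t). *)
Definition Phi_spec (Phi : Aelt -> cseq R_sys) : Prop :=
  (forall a, Avalid a -> cauchy (Phi a)) /\
  (forall a b, Avalid a -> Avalid b -> Aeq a b -> cequiv (Phi a) (Phi b)) /\
  (forall a b, Avalid a -> Avalid b -> cequiv (Phi (Aadd a b)) (cadd (Phi a) (Phi b))) /\
  (forall a b, Avalid a -> Avalid b -> cequiv (Phi (Amul a b)) (cmul (Phi a) (Phi b))) /\
  cequiv (Phi Aone) (cone R_sys) /\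
  (forall k a, Avalid a -> cequiv (Phi (Ascale k a)) (cscale k (Phi a))) /\
  (forall n a x, inA n a -> represents n a x -> cequiv (Phi a) (fun _ => (n, x))) /\
  (forall xs : nat -> blk, (forall n, represents n (sn n) (xs n)) ->
     cequiv (Phi At) (fun n => (n, xs n))).

End Dyn.

(* Main.v *)
Require Import Defs.
From HB Require Import structures.
From mathcomp Require Import all_boot all_order all_algebra.
From mathcomp Require Import all_classical all_reals all_analysis.
From mathcomp Require Import zify ring lra.
Import Defs.
Set Implicit Arguments. Unset Strict Implicit. Unset Printing Implicit Defensive.
Import Order.TTheory GRing.Theory Num.Theory.
Local Open Scope classical_set_scope.
Local Open Scope ring_scope.

(** An approximate intertwining of the two directed systems, in the style of Elliott.
    All the maps place matrix blocks along the diagonal, so they are star-homomorphisms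
    which do not increase the rank. From [R_n] to [M_{2^m}], put [floor (2^m mu(W))]
    copies of the block [W] on the diagonal; from [M_{2^m}] to [R_n'], put
    [floor (|W'| / 2^m)] copies into the block [W']. Two placements are conjugate by a
    permutation of the coordinates, up to the blocks whose multiplicities differ. The
    multiplicities agree well enough with those of the connecting maps because, by
    ergodicity, the proportion of [W] inside [W'] tends in mean to [mu(W)].

    The latter is a maximal inequality for towers: towers of different levels are nested
    or disjoint, so the union of the towers in which [W] has density at least
    [r > mu(W)] has measure at most [mu(W) / r < 1]. The set of points lying in such
    towers for infinitely many levels is invariant up to the orbit of [y], hence null.

    For regularity, quasi-inverses can be chosen so that they depend on the matrix in a
    Lipschitz way for the rank distance, and [x^* x] has the rank of [x] when the
    involution is positive definite. Finally [Phi(t)] is a limit of truncated shifts,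
    whose products with their adjoints have corank [1] in each block, so [Phi(t)] is
    unitary, and [Phi(f)] for [f] locally constant comes from diagonal matrices. *)

(** * Block-diagonal matrices *)

(** Maps that agree only up to conjugation do not pass to a limit unless the conjugations are
    controlled. They are absorbed during the construction: each map is chosen after its predecessor
    and already composed with the permutation that aligns the composite with the connecting map, so
    both triangles commute up to small rank. [V_n] can be infinite, while a matrix of size [2^m]
    holds finitely many blocks; finitely many words carrying almost all the mass are placed, and the
    rest of the diagonal is zero. The maps are therefore not unital in general, but they are
    multiplicative and rank contracting, and the unit is recovered in the limit. Rounding
    multiplicities down makes the comparison one-sided: the total sizes agree, so it is enough to
    bound the unmatched copies on one side, and on the way from [R_n] back to [R_n'] these occur
    only in blocks [W'] that contain too few copies of [W]. Matrices are functions on pairs of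
    naturals, meaningless outside the block, so algebraic laws are stated as vanishing rank
    distances. *)

Section FunctionMatrices.
Variable K : fieldType.
Implicit Types (f g : mel K) (D k l : nat).

Definition meq D f g := forall a b, (a < D)%N -> (b < D)%N -> f a b = g a b.
Definition rkf D f := \rank (mxsq D f).
Definition madd f g : mel K := fun a b => f a b + g a b.
Definition mopp f : mel K := fun a b => - f a b.
Definition msub f g : mel K := madd f (mopp g).
Definition mscale (x : K) f : mel K := fun a b => x * f a b.
Definition mmul D f g : mel K := fun a b => \sum_(l < D) f a l * g l b.
Definition mone : mel K := fun a b => (a == b)%:R.
Definition mstar (c : K -> K) f : mel K := fun a b => c (f b a).
Definition mzero : mel K := fun _ _ => 0.

Lemma mxsqE D f g : mxsq D f = mxsq D g <-> meq D f g.
Proof.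
split=> [/matrixP h a b aD bD|h].
  by have := h (Ordinal aD) (Ordinal bD); rewrite !mxE.
by apply/matrixP => i j; rewrite !mxE h.
Qed.

Lemma mxsqD D f g : mxsq D (madd f g) = mxsq D f + mxsq D g.
Proof. by apply/matrixP => i j; rewrite !mxE. Qed.

Lemma mxsqN D f : mxsq D (mopp f) = - mxsq D f.
Proof. by apply/matrixP => i j; rewrite !mxE. Qed.

Lemma mxsqB D f g : mxsq D (msub f g) = mxsq D f - mxsq D g.
Proof. by rewrite mxsqD mxsqN. Qed.

Lemma mxsqZ D x f : mxsq D (mscale x f) = x *: mxsq D f.
Proof. by apply/matrixP => i j; rewrite !mxE. Qed.

Lemma mxsqM D f g : mxsq D (mmul D f g) = mxsq D f *m mxsq D g.
Proof.
by apply/matrixP => i j; rewrite !mxE; apply: eq_bigr => l _; rewrite !mxE.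
Qed.

Lemma mxsq1 D : mxsq D mone = 1%:M.
Proof. by apply/matrixP => i j; rewrite !mxE. Qed.

Lemma mxsq0 D : mxsq D mzero = 0.
Proof. by apply/matrixP => i j; rewrite !mxE. Qed.

Lemma rkf_eq D f g : meq D f g -> rkf D f = rkf D g.
Proof. by rewrite /rkf => /mxsqE ->. Qed.

Lemma rkf_le D f : (rkf D f <= D)%N. Proof. exact: rank_leq_row. Qed.

Lemma rkfN D f : rkf D (mopp f) = rkf D f.
Proof. by rewrite /rkf mxsqN mxrank_opp. Qed.

Lemma rkf0 D f : meq D f mzero -> rkf D f = 0%N.
Proof. by rewrite /rkf => /mxsqE ->; rewrite mxsq0 mxrank0. Qed.

(** Since [c] is additive and multiplicative, it can be applied to a rank factorization of
    [mxsq D f], which bounds the rank of the adjoint; applying the bound twice gives equality. *)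
Lemma rkf_star (c : K -> K) D f : field_involution c ->
  rkf D (mstar c f) = rkf D f.
Proof.
move=> [cD cM cK].
have c0 : c 0 = 0 by apply: (addrI (c 0)); rewrite -cD !addr0.
have le g : (rkf D (mstar c g) <= rkf D g)%N.
  rewrite /rkf; set A := mxsq D g.
  have -> : mxsq D (mstar c g) = (map_mx c A)^T.
    by apply/matrixP => i j; rewrite !mxE.
  rewrite mxrank_tr -{1}(mulmx_base A).
  have -> : map_mx c (col_base A *m row_base A) =
            map_mx c (col_base A) *m map_mx c (row_base A).
    apply/matrixP => i j; rewrite !mxE (big_morph c cD c0).
    by apply: eq_bigr => l _; rewrite cM !mxE.
  by rewrite (leq_trans (mxrankM_maxl _ _)) // rank_leq_col.
apply: anti_leq; rewrite le /=.
have {1}-> : f = mstar c (mstar c f).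
  by apply/funext => a; apply/funext => b; rewrite /mstar cK.
exact: le.
Qed.

Definition bl k f g : mel K := fun a b =>
  if (a < k)%N && (b < k)%N then f a b
  else if (k <= a)%N && (k <= b)%N then g (a - k)%N (b - k)%N else 0.

Lemma blE k f g a b : (bl k f g a b =
  match (a < k)%N, (b < k)%N with
  | true, true => f a b
  | false, false => g (a - k)%N (b - k)%N
  | _, _ => 0 end).
Proof. by rewrite /bl; do 2 case: ltnP. Qed.

Lemma meq_bl D k f f' g g' : (k <= D)%N ->
  meq k f f' -> meq (D - k) g g' -> meq D (bl k f g) (bl k f' g').
Proof.
move=> kD ff gg a b aD bD; rewrite !blE.
case: ltnP => ak; case: ltnP => bk //; first exact: ff.
by apply: gg; lia.
Qed.

Lemma bl_bl k l f g h : bl k f (bl l g h) = bl (k + l) (bl k f g) h.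
Proof.
apply/funext => a; apply/funext => b; rewrite !blE.
case: (ltnP a k) => ak; case: (ltnP b k) => bk.
- have -> : (a < k + l)%N by lia.
  by have -> : (b < k + l)%N by lia.
- have -> : (a < k + l)%N by lia.
  by case: ltnP.
- have -> : (b < k + l)%N by lia.
  by case: ltnP.
- rewrite !ltn_subLR // !subnDA.
  by do 2 case: ltnP.
Qed.

Lemma mxsq_bl k l f g :
  mxsq (k + l) (bl k f g) = block_mx (mxsq k f) 0 0 (mxsq l g).
Proof.
apply/matrixP => i j; rewrite mxE blE.
case: (split_ordP i) => i' ->; case: (split_ordP j) => j' ->;
  rewrite ?(block_mxEul, block_mxEur, block_mxEdl, block_mxEdr) ?mxE /= ?ltn_ord.
1-3: by [].
by rewrite !addKn.
Qed.

Lemma rkf_bl k l f g : rkf (k + l) (bl k f g) = (rkf k f + rkf l g)%N.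
Proof. by rewrite /rkf mxsq_bl rank_diag_block_mx. Qed.

(** Permutations of [[0, D)] are plain functions on naturals, so that they can be composed and
    extended by further blocks without transporting ordinals. *)
Definition pbij D (s : nat -> nat) := exists t : nat -> nat,
  forall a, (a < D)%N -> [/\ (s a < D)%N, (t a < D)%N, s (t a) = a & t (s a) = a].

Definition conjf (s : nat -> nat) f : mel K := fun a b => f (s a) (s b).

Lemma pbij_id D : pbij D id.
Proof. by exists id. Qed.

Lemma pbij_lt D s a : pbij D s -> (a < D)%N -> (s a < D)%N.
Proof. by move=> [t h] /h []. Qed.

Lemma pbij_comp D s1 s2 : pbij D s1 -> pbij D s2 -> pbij D (s1 \o s2).
Proof.
move=> [t1 h1] [t2 h2]; exists (t2 \o t1) => a aD /=.
have [s2a t2a e2 f2] := h2 a aD; have [s1a t1a e1 f1] := h1 a aD.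
have [p1 p2 p3 p4] := h2 _ t1a; have [q1 q2 q3 q4] := h1 _ s2a.
by split => //; rewrite ?p3 ?q4.
Qed.

Lemma pbij_inv D s : pbij D s ->
  exists2 t, pbij D t & forall a, (a < D)%N -> s (t a) = a /\ t (s a) = a.
Proof.
move=> [t h]; exists t; last by move=> a /h [].
by exists s => a /h [].
Qed.

Lemma pbij_sum (A : nmodType) D s (F : nat -> A) : pbij D s ->
  \sum_(l < D) F (s l) = \sum_(l < D) F l.
Proof.
move=> sP; have [t tP st] := pbij_inv sP.
pose s' (i : 'I_D) := Ordinal (pbij_lt sP (ltn_ord i)).
pose t' (i : 'I_D) := Ordinal (pbij_lt tP (ltn_ord i)).
rewrite [RHS](reindex s'); first exact: eq_bigr.
exists t' => i _; apply: val_inj => /=.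
  by have [] := st i (ltn_ord i).
by have [] := st i (ltn_ord i).
Qed.

Lemma rkf_conj D s f : pbij D s -> (rkf D (conjf s f) <= rkf D f)%N.
Proof.
move=> sP; rewrite /rkf.
pose Q : 'M[K]_D := \matrix_(i, j) (s i == j)%:R.
suff -> : mxsq D (conjf s f) = Q *m mxsq D f *m Q^T.
  by rewrite (leq_trans (mxrankM_maxl _ _)) // mxrankM_maxr.
apply/matrixP => i j; rewrite !mxE.
have sl (k : 'I_D) (F : 'I_D -> K) :
    \sum_(l < D) (s k == l)%:R * F l = F (Ordinal (pbij_lt sP (ltn_ord k))).
  rewrite (bigD1 (Ordinal (pbij_lt sP (ltn_ord k)))) //= eqxx mul1r.
  rewrite big1 ?addr0 // => l /eqP lk.
  by case: eqP => [e|_]; [case: lk; apply: val_inj|rewrite mul0r].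
under eq_bigr => l _ do rewrite !mxE mulrC.
by rewrite sl; under eq_bigr => l _ do rewrite !mxE; rewrite sl.
Qed.

Lemma conjf_mul D s f g : pbij D s ->
  mmul D (conjf s f) (conjf s g) = conjf s (mmul D f g).
Proof.
move=> sP; apply/funext => a; apply/funext => b.
exact: (pbij_sum (fun l => f (s a) l * g l (s b)) sP).
Qed.

Lemma pbij_bl k l s1 s2 : pbij k s1 -> pbij l s2 ->
  pbij (k + l) (fun a => if (a < k)%N then s1 a else (k + s2 (a - k))%N).
Proof.
move=> [t1 h1] [t2 h2].
exists (fun a => if (a < k)%N then t1 a else (k + t2 (a - k))%N) => a al.
case: (ltnP a k) => ak.
  have [p1 p2 p3 p4] := h1 _ ak.
  by rewrite p1 p2; split => //; lia.
have /h2 [p1 p2 p3 p4] : (a - k < l)%N by lia.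
rewrite !ifF ?addKn; try lia.
by split; lia.
Qed.

Lemma conjf_bl k l s1 s2 f g : pbij k s1 ->
  meq (k + l) (bl k (conjf s1 f) (conjf s2 g))
    (conjf (fun a => if (a < k)%N then s1 a else (k + s2 (a - k))%N) (bl k f g)).
Proof.
move=> s1P a b aD bD; rewrite /conjf !blE.
case: (ltnP a k) => ak; case: (ltnP b k) => bk; rewrite ?(pbij_lt s1P) //.
- by rewrite ifF //; lia.
- by rewrite ifF //; lia.
- by rewrite !ifF ?addKn //; lia.
Qed.

(** The permutation depends on the two sizes and not on the matrices; hence one permutation serves
    all arguments [x] in [dg_perm]. *)
Lemma bl_swap k l : exists2 s, pbij (k + l) s &
  forall f g h m, meq (k + l + m) (bl k f (bl l g h))
    (conjf (fun a => if (a < k + l)%N then s a else a) (bl l g (bl k f h))).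
Proof.
exists (fun a => if (a < k)%N then (l + a)%N else (a - k)%N).
  exists (fun a => if (a < l)%N then (k + a)%N else (a - l)%N) => a al.
  split.
  - by case: (ltnP a k) => h; lia.
  - by case: (ltnP a l) => h; lia.
  - case: (ltnP a l) => h; first by rewrite ltnNge leq_addr addKn.
    by rewrite ifT; lia.
  - case: (ltnP a k) => h; first by rewrite ltnNge leq_addr addKn.
    by rewrite ifT; lia.
move=> f g h m a b aD bD; rewrite /conjf !blE.
have pos c : [\/ (c < k)%N, (k <= c < k + l)%N | (k + l <= c)%N].
  by case: (ltnP c k); [constructor 1|case: (ltnP c (k + l)); [constructor 2; lia|constructor 3]].
have tT c e : (c < e)%N -> (c < e)%N = true by [].
have tF c e : (e <= c)%N -> (c < e)%N = false by move=> ?; apply/negP; lia.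
case: (pos a) => ha; case: (pos b) => hb;
  repeat (match goal with |- context [(?x < ?y)%N] =>
    first [rewrite (@tT x y); last lia | rewrite (@tF x y); last lia] end; simpl);
  rewrite ?addKn //; f_equal; lia.
Qed.

End FunctionMatrices.

Lemma In_mem (B : eqType) (v : B) L : List.In v L -> v \in L.
Proof.
elim: L => //= u L IH [->|/IH vL]; first exact: mem_head.
by rewrite inE vL orbT.
Qed.

(** * Diagonals of blocks along a list of labels *)

Section DiagonalLists.
Variables (K : fieldType) (B : Type) (d : B -> nat).
Implicit Types (x y : B -> mel K) (L : seq B).

Fixpoint dg x L : mel K :=
  if L is v :: L' then bl (d v) (x v) (dg x L') else @mzero K.

Definition dsz L := (\sum_(v <- L) d v)%N.

Lemma dsz_cons v L : dsz (v :: L) = (d v + dsz L)%N.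
Proof. exact: big_cons. Qed.

Lemma dsz_cat L1 L2 : dsz (L1 ++ L2) = (dsz L1 + dsz L2)%N.
Proof. exact: big_cat. Qed.

Lemma dsz_nseq k v : dsz (nseq k v) = (k * d v)%N.
Proof. by elim: k => [|k IH]; [exact: big_nil|rewrite /= dsz_cons IH]. Qed.

Lemma dg_cat x L1 L2 : dg x (L1 ++ L2) = bl (dsz L1) (dg x L1) (dg x L2).
Proof.
elim: L1 => [|v L1 IH] /=.
  rewrite /dsz big_nil; apply/funext => a; apply/funext => b.
  by rewrite blE /= !subn0.
by rewrite IH bl_bl dsz_cons.
Qed.

Lemma rkf_dg x L : rkf (dsz L) (dg x L) = (\sum_(v <- L) rkf (d v) (x v))%N.
Proof.
elim: L => [|v L IH] /=; first by rewrite big_nil /dsz big_nil rkf0.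
by rewrite dsz_cons rkf_bl IH big_cons.
Qed.

Lemma dgD x y L : dg (fun v => madd (x v) (y v)) L = madd (dg x L) (dg y L).
Proof.
elim: L => [|v L IH] /=; apply/funext => a; apply/funext => b.
  by rewrite /madd /mzero addr0.
by rewrite IH /madd !blE; case: (ltnP a _); case: (ltnP b _); rewrite ?addr0.
Qed.

Lemma dgZ k x L : dg (fun v => mscale k (x v)) L = mscale k (dg x L).
Proof.
elim: L => [|v L IH] /=; apply/funext => a; apply/funext => b.
  by rewrite /mscale /mzero mulr0.
by rewrite IH /mscale !blE; case: (ltnP a _); case: (ltnP b _); rewrite ?mulr0.
Qed.

Lemma dgN x L : dg (fun v => mopp (x v)) L = mopp (dg x L).
Proof.
elim: L => [|v L IH] /=; apply/funext => a; apply/funext => b.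
  by rewrite /mopp /mzero oppr0.
by rewrite IH /mopp !blE; case: (ltnP a _); case: (ltnP b _); rewrite ?oppr0.
Qed.

Lemma dg_star (c : K -> K) x L : c 0 = 0 ->
  dg (fun v => mstar c (x v)) L = mstar c (dg x L).
Proof.
move=> c0; elim: L => [|v L IH] /=; apply/funext => a; apply/funext => b.
  by rewrite /mstar /mzero c0.
by rewrite IH /mstar !blE; case: (ltnP a _); case: (ltnP b _); rewrite ?c0.
Qed.

Lemma dgM x y L :
  meq (dsz L) (dg (fun v => mmul (d v) (x v) (y v)) L)
    (mmul (dsz L) (dg x L) (dg y L)).
Proof.
elim: L => [|v L IH] /=; first by move=> a b; rewrite /dsz big_nil.
rewrite dsz_cons; apply/mxsqE; rewrite mxsqM !mxsq_bl mulmx_block.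
rewrite !mulmx0 !mul0mx !addr0 add0r mxsqM.
by move/mxsqE: IH; rewrite mxsqM => ->.
Qed.

End DiagonalLists.

(** [catCA_perm_ind] reduces a permutation of the list to exchanges of consecutive segments, and
    each exchange is a conjugation by [bl_swap]. *)
Lemma dg_perm (K : fieldType) (B : eqType) (d : B -> nat) (L L' : seq B) :
  perm_eq L L' -> exists2 s, pbij (dsz d L) s &
    forall x : B -> mel K, meq (dsz d L) (dg d x L) (conjf s (dg d x L')).
Proof.
move=> /catCA_perm_ind H.
pose P (M : seq B) := dsz d M = dsz d L /\ exists2 s, pbij (dsz d L) s &
    forall x : B -> mel K, meq (dsz d L) (dg d x L) (conjf s (dg d x M)).
suff [] : P L' by [].
apply: H; last by split=> //; exists id; [exact: pbij_id|].
move=> s1 s2 s3 [e [s sP hs]]; split.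
  by rewrite -e !dsz_cat; lia.
have [u uP hu] := bl_swap K (dsz d s1) (dsz d s2).
have eL : dsz d L = (dsz d s1 + dsz d s2 + dsz d s3)%N by rewrite -e !dsz_cat addnA.
have vP : pbij (dsz d L)
    (fun a => if (a < dsz d s1 + dsz d s2)%N then u a else a).
  have := pbij_bl uP (pbij_id (dsz d s3)); rewrite -eL.
  congr pbij; apply/funext => a; case: (ltnP a _) => // ?; lia.
exists ((fun a => if (a < dsz d s1 + dsz d s2)%N then u a else a) \o s).
  exact: pbij_comp.
move=> x a b aD bD; rewrite hs // /conjf /=.
have := hu (dg d x s1) (dg d x s2) (dg d x s3) (dsz d s3).
rewrite -eL !dg_cat => -> //; exact: pbij_lt.
Qed.

(** * Placements of blocks up to a permutation of the coordinates *)

Section BlockHomomorphisms.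
Variables (K : fieldType) (B : Type) (d : B -> nat).
Implicit Types (x y : B -> mel K) (L : seq B) (h : (B -> mel K) -> mel K).

(** The normal form of a placement, with one permutation for all [x]. Additivity, multiplicativity,
    compatibility with adjoints and rank bounds of the intertwining maps are all read off from
    it. *)
Definition hform D L h := dsz d L = D /\ exists2 s, pbij D s &
  forall x, meq D (h x) (conjf s (dg d x L)).

Lemma hform_dg L : hform (dsz d L) L (fun x => dg d x L).
Proof. by split=> //; exists id; [exact: pbij_id|]. Qed.

Lemma hform_conj D L h s : pbij D s -> hform D L h ->
  hform D L (fun x => conjf s (h x)).
Proof.
move=> sP [e [u uP hu]]; split=> //; exists (u \o s); first exact: pbij_comp.
by move=> x a b aD bD; rewrite /conjf hu //; exact: pbij_lt sP _.
Qed.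

Lemma hform_meq D L h h' : (forall x, meq D (h' x) (h x)) ->
  hform D L h -> hform D L h'.
Proof.
move=> hh [e [u uP hu]]; split=> //; exists u => // x a b aD bD.
by rewrite hh // hu.
Qed.

Lemma hform_sub D L h x y : hform D L h ->
  (rkf D (msub (h x) (h y)) <= \sum_(v <- L) rkf (d v) (msub (x v) (y v)))%N.
Proof.
move=> [e [s sP hs]]; rewrite -rkf_dg e -(rkf_eq (f := conjf s (msub (dg d x L) (dg d y L)))).
  rewrite (leq_trans (rkf_conj _ sP)) //.
  by rewrite /msub -dgN -dgD.
by move=> a b aD bD; rewrite /conjf /msub /madd /mopp !hs.
Qed.

Lemma hformD D L h x y : hform D L h ->
  meq D (h (fun v => madd (x v) (y v))) (madd (h x) (h y)).
Proof.
move=> [e [s sP hs]] a b aD bD; rewrite hs // /conjf dgD /madd.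
by rewrite !hs.
Qed.

Lemma hformZ D L h k x : hform D L h ->
  meq D (h (fun v => mscale k (x v))) (mscale k (h x)).
Proof.
move=> [e [s sP hs]] a b aD bD; rewrite hs // /conjf dgZ /mscale.
by rewrite hs.
Qed.

Lemma hform_star (c : K -> K) D L h x : c 0 = 0 -> hform D L h ->
  meq D (h (fun v => mstar c (x v))) (mstar c (h x)).
Proof.
move=> c0 [e [s sP hs]] a b aD bD; rewrite hs // /conjf dg_star // /mstar.
by rewrite hs.
Qed.

Lemma hformM D L h x y : hform D L h ->
  meq D (h (fun v => mmul (d v) (x v) (y v))) (mmul D (h x) (h y)).
Proof.
move=> [e [s sP hs]] a b aD bD; rewrite hs // /conjf dgM ?e ?(pbij_lt sP) //.
rewrite -[LHS]/(conjf s (mmul D (dg d x L) (dg d y L)) a b) -conjf_mul //.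
by apply: eq_bigr => l _; rewrite !hs.
Qed.

End BlockHomomorphisms.

(** Composition of placements: a diagonal of diagonals is a diagonal along the concatenated list. *)
Lemma hform_flatten (K : fieldType) (B B' : Type) (d : B -> nat) (d' : B' -> nat)
    (M : seq B') (Lb : B' -> seq B) (h : (B -> mel K) -> B' -> mel K) :
  (forall b, List.In b M -> hform d (d' b) (Lb b) (fun x => h x b)) ->
  hform d (dsz d' M) (flatten (map Lb M)) (fun x => dg d' (h x) M).
Proof.
elim: M => [|b M IH] /= H.
  rewrite /dsz big_nil; split; first by rewrite /dsz big_nil.
  by exists id; [exact: pbij_id|].
have [e [s sP hs]] := H b (or_introl erefl).
have [e' [s' sP' hs']] := IH (fun v vM => H v (or_intror vM)).
rewrite dsz_cons; split; first by rewrite dsz_cat e e'.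
exists (fun a => if (a < d' b)%N then s a else (d' b + s' (a - d' b))%N).
  exact: pbij_bl.
move=> x; rewrite dg_cat e => a b' aD bD.
rewrite -(conjf_bl (l := dsz d' M) s' _ _ sP) //.
by apply: (@meq_bl _ (d' b + dsz d' M)); rewrite ?leq_addr ?addKn.
Qed.

(** Once both diagonals are permuted so that the common part [C] comes first, they coincide there
    and differ only in the remaining corner, whose size is that of [D1], and also of [D2] because
    both lists fill [D]. *)
Lemma hform_match (K : fieldType) (B : eqType) (d : B -> nat) D (L1 L2 C D1 D2 : seq B)
    (h1 h2 : (B -> mel K) -> mel K) :
  hform d D L1 h1 -> hform d D L2 h2 ->
  perm_eq L1 (C ++ D1) -> perm_eq L2 (C ++ D2) ->
  exists2 s, pbij D s &
    forall x, (rkf D (msub (conjf s (h1 x)) (h2 x)) <= dsz d D1)%N.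
Proof.
move=> [e1 [s1 s1P hs1]] [e2 [s2 s2P hs2]] p1 p2.
have [u1] := dg_perm K d p1; have [u2] := dg_perm K d p2.
rewrite e1 e2 => u2P hu2 u1P hu1.
(* [t] undoes the permutations that sort the first placement; those of the second are then
   applied. *)
have [t tP ht] := pbij_inv (pbij_comp u1P s1P).
exists (t \o (u2 \o s2)); first by apply: pbij_comp => //; exact: pbij_comp.
move=> x.
pose f := msub (dg d x (C ++ D1)) (dg d x (C ++ D2)).
have eD1 : D = (dsz d C + dsz d D1)%N by rewrite -e1 -dsz_cat /dsz (perm_big _ p1).
have eD2 : dsz d D1 = dsz d D2.
  apply: (@addnI (dsz d C)); rewrite -eD1 -e2 -dsz_cat /dsz; exact: perm_big p2.
rewrite (rkf_eq (g := conjf (u2 \o s2) f)); last first.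
  move=> a b aD bD; rewrite /f /msub /madd /conjf /mopp /=.
  have [s2a s2b] := (pbij_lt s2P aD, pbij_lt s2P bD).
  have [usa usb] := (pbij_lt u2P s2a, pbij_lt u2P s2b).
  have [ta tb] := (pbij_lt tP usa, pbij_lt tP usb).
  rewrite hs1 // hs2 // /conjf hu1 ?(pbij_lt s1P) // hu2 // /conjf.
  have /= [-> _] := ht _ usa; have /= [-> _] := ht _ usb.
  by [].
rewrite (leq_trans (rkf_conj _ (pbij_comp u2P s2P))) //.
have -> : f = bl (dsz d C) (@mzero K) (msub (dg d x D1) (dg d x D2)).
  apply/funext => a; apply/funext => b.
  rewrite /f !dg_cat /msub /madd /mopp !blE.
  by case: (ltnP a _); case: (ltnP b _); rewrite ?subrr // /mzero.
by rewrite eD1 rkf_bl rkf0 // rkf_le.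
Qed.

Lemma common_sublist (B : eqType) (L1 L2 : seq B) : exists C D1 D2,
  [/\ perm_eq L1 (C ++ D1), perm_eq L2 (C ++ D2)
    & forall v, count_mem v C = minn (count_mem v L1) (count_mem v L2)].
Proof.
elim: L1 L2 => [|v L1 IH] L2.
  by exists [::], [::], L2; split=> // v; rewrite min0n.
have [vL2|vL2] := boolP (v \in L2).
  have [C [D1 [D2 [p1 p2 hc]]]] := IH (rem v L2).
  exists (v :: C), D1, D2; split; first by rewrite /= perm_cons.
    by rewrite (permPl (perm_to_rem vL2)) /= perm_cons.
  move=> u /=; rewrite hc (permP (perm_to_rem vL2) (pred1 u)) /=; lia.
have [C [D1 [D2 [p1 p2 hc]]]] := IH L2.
exists C, (v :: D1), D2; split=> //.
  by rewrite perm_sym -(cat1s v D1) perm_catCA /= perm_cons perm_sym.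
move=> u /=; rewrite hc; case: eqP => [<-|_]; last by rewrite add0n.
by have /count_memPn -> := vL2; lia.
Qed.

(** * Completions of directed systems *)

Arguments dlift {K R}.
Arguments dadd {K R}.
Arguments dopp {K R}.
Arguments dscale {K R}.
Arguments dmul {K R}.
Arguments done {K R}.
Arguments dstar {K R}.
Arguments drk {K R}.

(** * Null sequences *)

Section Small.
Variable R : realType.
Implicit Types u v : nat -> R.

(** Only the upper bound is recorded; for distances and error bounds, which are nonnegative, it
    means convergence to 0. *)
Definition small u := forall e : R, 0 < e ->
  exists N, forall k, (N <= k)%N -> u k < e.

Lemma small_le u v : (forall k, u k <= v k) -> small v -> small u.
Proof.
by move=> uv sv e /sv [N h]; exists N => k /h; apply: le_lt_trans.
Qed.

Lemma small_add u v : small u -> small v -> small (fun k => u k + v k).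
Proof.
move=> su sv e e0; have e2 : 0 < e / 2 by rewrite divr_gt0.
have [N hN] := su _ e2; have [M hM] := sv _ e2.
exists (maxn N M) => k; rewrite geq_max => /andP[/hN a /hM b].
by rewrite (splitr e) ltrD.
Qed.

Lemma small0 : small (fun _ => 0 : R).
Proof. by move=> e e0; exists 0%N. Qed.

Lemma small_mull (a : R) u : 0 <= a -> small u -> small (fun k => a * u k).
Proof.
move=> a0 su e e0; have a1 : 0 < a + 1 by rewrite ltr_wpDl.
have [N hN] := su (e / (a + 1)) (divr_gt0 e0 a1); exists N => k /hN.
rewrite ltr_pdivlMr // => h.
have [u0|u0] := lerP (u k) 0; first by rewrite (le_lt_trans _ e0) // mulr_ge0_le0.
by apply: le_lt_trans h; rewrite mulrC ler_pM2l // lerDl.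
Qed.

Lemma small_exp (a : R) : small (fun k => a / 2 ^+ k).
Proof.
move=> e e0.
exists (Num.bound (a / e)) => k hk.
rewrite ltr_pdivrMr ?exprn_gt0 // mulrC -ltr_pdivrMr //.
apply: (le_lt_trans (ler_norm _)).
apply: lt_le_trans (archi_boundP (normr_ge0 _)) _.
have -> : Num.bound (`|a / e|) = Num.bound (a / e) by rewrite /Num.bound normr_id.
rewrite -natrX ler_nat; apply: leq_trans hk (ltnW (ltn_expl _ _)) => //.
Qed.

End Small.

(** * Directed systems with a real-valued rank distance *)

Section RankSystems.
Variables (K : fieldType) (R : realType) (c : K -> K).

Definition dD (S : dsys K R) (r : nat -> del S -> R) n x y :=
  r n (dadd S x (dopp S y)).

(** Ring laws and compatibility with the connecting maps hold up to distance 0, since entries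
    outside the blocks are arbitrary. The bounds [rs_D] and [rs_M] express that the rank of a sum or
    a product is controlled by its terms; [rs_lift] makes the distance independent of the level. *)
Record rank_system (S : dsys K R) (r : nat -> del S -> R) : Prop := RankSystem {
  rs_fin : forall n x, drk S n x = (r n x)%:E;
  rs_refl : forall n x, dD r n x x = 0;
  rs_sym : forall n x y, dD r n x y = dD r n y x;
  rs_tri : forall n x y z, dD r n x z <= dD r n x y + dD r n y z;
  rs_lift : forall n x y, dD r n.+1 (dlift S n x) (dlift S n y) = dD r n x y;
  rs_D : forall n x y x' y',
    dD r n (dadd S x x') (dadd S y y') <= dD r n x y + dD r n x' y';
  rs_M : forall n x y x' y',
    dD r n (dmul S n x x') (dmul S n y y') <= dD r n x y + dD r n x' y';
  rs_Z : forall n a x y, dD r n (dscale S a x) (dscale S a y) <= dD r n x y;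
  rs_star : forall n x y, dD r n (dstar S n x) (dstar S n y) <= dD r n x y;
  rs_liftD : forall n x y,
    dD r n.+1 (dlift S n (dadd S x y)) (dadd S (dlift S n x) (dlift S n y)) = 0;
  rs_liftM : forall n x y,
    dD r n.+1 (dlift S n (dmul S n x y)) (dmul S n.+1 (dlift S n x) (dlift S n y)) = 0;
  rs_liftZ : forall n a x,
    dD r n.+1 (dlift S n (dscale S a x)) (dscale S a (dlift S n x)) = 0;
  rs_lift_star : forall n x,
    dD r n.+1 (dlift S n (dstar S n x)) (dstar S n.+1 (dlift S n x)) = 0;
  rs_lift1 : forall n, dD r n.+1 (dlift S n (done S n)) (done S n.+1) = 0;
  rs_mulA : forall n x y z,
    dD r n (dmul S n x (dmul S n y z)) (dmul S n (dmul S n x y) z) = 0;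
  rs_mul1 : forall n x, dD r n (dmul S n (done S n) x) x = 0;
  rs_mulx1 : forall n x, dD r n (dmul S n x (done S n)) x = 0;
  rs_starK : forall n x, dD r n (dstar S n (dstar S n x)) x = 0;
  rs_starD : forall n x y,
    dD r n (dstar S n (dadd S x y)) (dadd S (dstar S n x) (dstar S n y)) = 0;
  rs_starM : forall n x y,
    dD r n (dstar S n (dmul S n x y)) (dmul S n (dstar S n y) (dstar S n x)) = 0;
  rs_starZ : forall n a x,
    dD r n (dstar S n (dscale S a x)) (dscale S (c a) (dstar S n x)) = 0;
  rs_star1 : forall n, dD r n (dstar S n (done S n)) (done S n) = 0
}.

Section Theory.
Variables (S : dsys K R) (r : nat -> del S -> R) (H : rank_system r).
Local Notation D := (dD r).
Implicit Types (p q : nat * del S) (s t : cseq S) (n M : nat).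

(** The triangle inequality from [x] to [y] and back bounds 0 by twice the distance. *)
Lemma dD_ge0 n x y : 0 <= D n x y.
Proof.
have := rs_tri H n x y x; rewrite (rs_refl H) (rs_sym H n y x) -mulr2n.
by rewrite pmulrn_lge0.
Qed.

Lemma dD0_trans n x y z : D n x y = 0 -> D n y z = 0 -> D n x z = 0.
Proof.
move=> h1 h2; apply/eqP; rewrite eq_le dD_ge0 andbT.
by apply: le_trans (rs_tri H _ _ y _) _; rewrite h1 h2 addr0.
Qed.

Lemma dD0l n x x' y : D n x x' = 0 -> D n x y = D n x' y.
Proof.
move=> h; apply/eqP; rewrite eq_le.
by apply/andP; split; [have := rs_tri H n x x' y|have := rs_tri H n x' x y];
  rewrite 1?(rs_sym H n x' x) h add0r.
Qed.

Lemma dD0r n x x' y : D n x x' = 0 -> D n y x = D n y x'.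
Proof. by move=> h; rewrite !(rs_sym H n y); exact: dD0l. Qed.

Lemma dD0_sym n x y : D n x y = 0 -> D n y x = 0.
Proof. by rewrite (rs_sym H). Qed.

Lemma dD0_le n x y (e : R) : D n x y <= e -> e = 0 -> D n x y = 0.
Proof. by move=> h e0; apply/eqP; rewrite eq_le dD_ge0 andbT -e0. Qed.

Lemma dat_self p : dat p.1 p = p.2.
Proof. by rewrite /dat subnn. Qed.

Lemma datS M p : (p.1 <= M)%N -> dat M.+1 p = dlift S M (dat M p).
Proof. by move=> h; rewrite /dat subSn //= subnKC. Qed.

Lemma level_ind (P : nat -> Prop) n : P n -> (forall M, (n <= M)%N -> P M -> P M.+1) ->
  forall M, (n <= M)%N -> P M.
Proof.
move=> Pn PS M /subnKC <-; elim: (M - n)%N => [|k IH]; first by rewrite addn0.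
by rewrite addnS; apply: PS => //; rewrite leq_addr.
Qed.

Definition dst p q := D (maxn p.1 q.1) (dat (maxn p.1 q.1) p) (dat (maxn p.1 q.1) q).

Lemma ddistE p q : ddist p q = (dst p q)%:E.
Proof. by rewrite /ddist (rs_fin H). Qed.

(** The connecting maps are isometric, so any level above both arguments can be used. *)
Lemma dstE M p q : (p.1 <= M)%N -> (q.1 <= M)%N -> dst p q = D M (dat M p) (dat M q).
Proof.
move=> pM qM; have : (maxn p.1 q.1 <= M)%N by rewrite geq_max pM.
clear pM qM; elim/level_ind: M / => // M; rewrite geq_max => /andP[pM' qM'] ->.
by rewrite !datS // (rs_lift H).
Qed.

Lemma dst_refl p : dst p p = 0. Proof. exact: rs_refl. Qed.

Lemma dst_sym p q : dst p q = dst q p.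
Proof. by rewrite /dst (rs_sym H) maxnC. Qed.

Lemma dst_tri q p p' : dst p p' <= dst p q + dst q p'.
Proof.
pose M := maxn p.1 (maxn p'.1 q.1).
by rewrite !(@dstE M) /M ?leq_max ?leqnn ?orbT //; exact: rs_tri.
Qed.

Lemma dst_dat M p : (p.1 <= M)%N -> dst (M, dat M p) p = 0.
Proof. by move=> h; rewrite (@dstE M) // (dat_self (M, dat M p)) (rs_refl H). Qed.

Lemma dstl p p' q : dst p p' = 0 -> dst p q = dst p' q.
Proof.
move=> h; apply/eqP; rewrite eq_le.
by apply/andP; split; [have := dst_tri p' p q|have := dst_tri p p' q];
  rewrite 1?(dst_sym p' p) h add0r.
Qed.

Lemma dstr p p' q : dst p p' = 0 -> dst q p = dst q p'.
Proof. by move=> h; rewrite !(dst_sym q); exact: dstl. Qed.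

(** With the four definitions that follow, the values at one index of [cadd], [cmul], [cscale],
    [cstar] and [cone]; statements about sequences thus reduce to pairs. *)
Definition padd p q := let M := maxn p.1 q.1 in (M, dadd S (dat M p) (dat M q)).
Definition pmul p q := let M := maxn p.1 q.1 in (M, dmul S M (dat M p) (dat M q)).
Definition pscale a p : nat * del S := (p.1, dscale S a p.2).
Definition pstar p : nat * del S := (p.1, dstar S p.1 p.2).
Definition pone : nat * del S := (0%N, done S 0).

Lemma dat_padd M p q : (p.1 <= M)%N -> (q.1 <= M)%N ->
  D M (dat M (padd p q)) (dadd S (dat M p) (dat M q)) = 0.
Proof.
move=> pM qM; have : (maxn p.1 q.1 <= M)%N by rewrite geq_max pM.
clear pM qM; elim/level_ind: M / => [|M]; first by rewrite -[X in dat X (padd _ _)]/((padd p q).1) dat_self (rs_refl H).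
move=> hM; move: (hM); rewrite geq_max => /andP[pM' qM'] IH; rewrite !datS //.
by apply: dD0_trans (rs_liftD H _ _ _); rewrite (rs_lift H).
Qed.

Lemma dat_pmul M p q : (p.1 <= M)%N -> (q.1 <= M)%N ->
  D M (dat M (pmul p q)) (dmul S M (dat M p) (dat M q)) = 0.
Proof.
move=> pM qM; have : (maxn p.1 q.1 <= M)%N by rewrite geq_max pM.
clear pM qM; elim/level_ind: M / => [|M]; first by rewrite -[X in dat X (pmul _ _)]/((pmul p q).1) dat_self (rs_refl H).
move=> hM; move: (hM); rewrite geq_max => /andP[pM' qM'] IH; rewrite !datS //.
by apply: dD0_trans (rs_liftM H _ _ _); rewrite (rs_lift H).
Qed.

Lemma dat_pscale M a p : (p.1 <= M)%N ->
  D M (dat M (pscale a p)) (dscale S a (dat M p)) = 0.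
Proof.
elim/level_ind: M / => [|M hM IH].
  by rewrite -[X in dat X (pscale _ _)]/((pscale a p).1) !dat_self (rs_refl H).
by rewrite !datS //; apply: dD0_trans (rs_liftZ H _ _ _); rewrite (rs_lift H).
Qed.

Lemma dat_pstar M p : (p.1 <= M)%N ->
  D M (dat M (pstar p)) (dstar S M (dat M p)) = 0.
Proof.
elim/level_ind: M / => [|M hM IH].
  by rewrite -[X in dat X (pstar _)]/((pstar p).1) !dat_self (rs_refl H).
by rewrite !datS //; apply: dD0_trans (rs_lift_star H _ _); rewrite (rs_lift H).
Qed.

Lemma dat_pone M : D M (dat M pone) (done S M) = 0.
Proof.
have : (0 <= M)%N by []; elim/level_ind: M / => [|M hM IH].
  exact: (rs_refl H 0%N (done S 0)).
by rewrite !datS //; apply: dD0_trans (rs_lift1 H _); rewrite (rs_lift H).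
Qed.

Lemma dst_padd p q p' q' : dst (padd p q) (padd p' q') <= dst p p' + dst q q'.
Proof.
pose M := maxn (maxn p.1 q.1) (maxn p'.1 q'.1).
have hM : [/\ (p.1 <= M)%N, (q.1 <= M)%N, (p'.1 <= M)%N & (q'.1 <= M)%N].
  by rewrite /M; split; lia.
case: hM => pM qM p'M q'M.
rewrite !(@dstE M) //; try by rewrite /= geq_max; apply/andP.
by rewrite (dD0l _ (dat_padd pM qM)) (dD0r _ (dat_padd p'M q'M)); exact: rs_D.
Qed.

Lemma dst_pmul p q p' q' : dst (pmul p q) (pmul p' q') <= dst p p' + dst q q'.
Proof.
pose M := maxn (maxn p.1 q.1) (maxn p'.1 q'.1).
have hM : [/\ (p.1 <= M)%N, (q.1 <= M)%N, (p'.1 <= M)%N & (q'.1 <= M)%N].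
  by rewrite /M; split; lia.
case: hM => pM qM p'M q'M.
rewrite !(@dstE M) //; try by rewrite /= geq_max; apply/andP.
by rewrite (dD0l _ (dat_pmul pM qM)) (dD0r _ (dat_pmul p'M q'M)); exact: rs_M.
Qed.

Lemma dst_pscale a p q : dst (pscale a p) (pscale a q) <= dst p q.
Proof.
pose M := maxn p.1 q.1.
have [pM qM] : (p.1 <= M)%N /\ (q.1 <= M)%N by rewrite /M; split; lia.
rewrite !(@dstE M) //.
by rewrite (dD0l _ (dat_pscale a pM)) (dD0r _ (dat_pscale a qM)); exact: rs_Z.
Qed.

Lemma dst_pstar p q : dst (pstar p) (pstar q) <= dst p q.
Proof.
pose M := maxn p.1 q.1.
have [pM qM] : (p.1 <= M)%N /\ (q.1 <= M)%N by rewrite /M; split; lia.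
rewrite !(@dstE M) //.
by rewrite (dD0l _ (dat_pstar pM)) (dD0r _ (dat_pstar qM)); exact: rs_star.
Qed.

Lemma pmulA p q p' : dst (pmul p (pmul q p')) (pmul (pmul p q) p') = 0.
Proof.
pose M := maxn p.1 (maxn q.1 p'.1).
have [pM qM p'M] : [/\ (p.1 <= M)%N, (q.1 <= M)%N & (p'.1 <= M)%N].
  by rewrite /M; split; lia.
have [qp pq] : (maxn q.1 p'.1 <= M)%N /\ (maxn p.1 q.1 <= M)%N by rewrite /M; split; lia.
rewrite (@dstE M) /=; try by rewrite geq_max; apply/andP.
rewrite (dD0l _ (dat_pmul pM _)) // (dD0r _ (dat_pmul _ p'M)) //.
rewrite -(rs_mulA H M (dat M p) (dat M q) (dat M p')).
apply/eqP; rewrite eq_le; apply/andP; split.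
  apply: le_trans (rs_tri H _ _ (dmul S M (dat M p) (dmul S M (dat M q) (dat M p'))) _) _.
  rewrite (dD0_le (rs_M H _ _ _ _ _)) ?add0r; last first.
    by rewrite (rs_refl H) dat_pmul // addr0.
  apply: le_trans (rs_tri H _ _ (dmul S M (dmul S M (dat M p) (dat M q)) (dat M p')) _) _.
  rewrite [X in _ + X](dD0_le (rs_M H _ _ _ _ _)) ?addr0 //.
  by rewrite (rs_refl H) (rs_sym H) dat_pmul // addr0.
by rewrite (rs_mulA H) dD_ge0.
Qed.

Lemma pmul1 p : dst (pmul pone p) p = 0.
Proof.
pose M := p.1; have pM : (p.1 <= M)%N by []; have oM : (pone.1 <= M)%N by [].
rewrite (@dstE M) /= ?max0n //.
rewrite (dD0l _ (dat_pmul oM pM)).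
apply: dD0_trans (rs_mul1 H _ _); apply: dD0_le (rs_M H _ _ _ _ _) _.
by rewrite (rs_refl H) dat_pone addr0.
Qed.

Lemma pmulx1 p : dst (pmul p pone) p = 0.
Proof.
pose M := p.1; have pM : (p.1 <= M)%N by []; have oM : (pone.1 <= M)%N by [].
rewrite (@dstE M) /= ?maxn0 //.
rewrite (dD0l _ (dat_pmul pM oM)).
apply: dD0_trans (rs_mulx1 H _ _); apply: dD0_le (rs_M H _ _ _ _ _) _.
by rewrite (rs_refl H) dat_pone addr0.
Qed.

Lemma pstarK p : dst (pstar (pstar p)) p = 0.
Proof.
rewrite (@dstE p.1) // (dat_self (pstar (pstar p))) dat_self.
exact: rs_starK.
Qed.

Lemma pstarZ a p : dst (pstar (pscale a p)) (pscale (c a) (pstar p)) = 0.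
Proof.
rewrite (@dstE p.1) // (dat_self (pstar (pscale a p))).
rewrite (dat_self (pscale (c a) (pstar p))); exact: rs_starZ.
Qed.

Lemma pstar1 : dst (pstar pone) pone = 0.
Proof. exact: rs_star1. Qed.

Lemma pstarD p q : dst (pstar (padd p q)) (padd (pstar p) (pstar q)) = 0.
Proof.
pose M := maxn p.1 q.1.
have [pM qM] : (p.1 <= M)%N /\ (q.1 <= M)%N by rewrite /M; split; lia.
rewrite (@dstE M) //; rewrite (dD0l _ (dat_pstar _)) // (dD0r _ (dat_padd _ _)) //.
rewrite [dat M (padd p q)]dat_self.
apply: dD0_trans (rs_starD H _ _ _) _.
apply: dD0_le (rs_D H _ _ _ _ _) _.
by rewrite !(rs_sym H M (dstar S M _)) !dat_pstar // addr0.
Qed.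

Lemma pstarM p q : dst (pstar (pmul p q)) (pmul (pstar q) (pstar p)) = 0.
Proof.
pose M := maxn p.1 q.1.
have [pM qM] : (p.1 <= M)%N /\ (q.1 <= M)%N by rewrite /M; split; lia.
rewrite (@dstE M) //; last by rewrite /= maxnC.
rewrite (dD0l _ (dat_pstar _)) // (dD0r _ (dat_pmul _ _)) //.
rewrite [dat M (pmul p q)]dat_self.
apply: dD0_trans (rs_starM H _ _ _) _.
apply: dD0_le (rs_M H _ _ _ _ _) _.
by rewrite !(rs_sym H M (dstar S M _)) !dat_pstar // addr0.
Qed.

Lemma cequivE s t : cequiv s t <-> small (fun k => dst (s k) (t k)).
Proof.
by split=> h e /h [N hN]; exists N => k /hN; rewrite ddistE lte_fin.
Qed.

Lemma cauchyE s : cauchy s <-> forall e, 0 < e ->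
  exists N, forall k l, (N <= k)%N -> (N <= l)%N -> dst (s k) (s l) < e.
Proof.
by split=> h e /h [N hN]; exists N => k l kN lN; have := hN k l kN lN;
  rewrite ddistE lte_fin.
Qed.

Lemma cequiv_dst0 s t : (forall k, dst (s k) (t k) = 0) -> cequiv s t.
Proof.
by move=> h; apply/cequivE; apply: small_le (@small0 R) => k; rewrite h.
Qed.

Lemma cequiv_refl s : cequiv s s.
Proof. by apply: cequiv_dst0 => k; rewrite dst_refl. Qed.

Lemma cequiv_sym s t : cequiv s t -> cequiv t s.
Proof. by move=> /cequivE h; apply/cequivE; apply: small_le h => k; rewrite dst_sym. Qed.

Lemma cequiv_trans t s u : cequiv s t -> cequiv t u -> cequiv s u.
Proof.
move=> /cequivE h1 /cequivE h2; apply/cequivE.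
by apply: small_le (small_add h1 h2) => k; exact: dst_tri.
Qed.

Lemma cadd_congr s t s' t' : cequiv s s' -> cequiv t t' ->
  cequiv (cadd s t) (cadd s' t').
Proof.
move=> /cequivE h1 /cequivE h2; apply/cequivE.
by apply: small_le (small_add h1 h2) => k; exact: dst_padd.
Qed.

Lemma cmul_congr s t s' t' : cequiv s s' -> cequiv t t' ->
  cequiv (cmul s t) (cmul s' t').
Proof.
move=> /cequivE h1 /cequivE h2; apply/cequivE.
by apply: small_le (small_add h1 h2) => k; exact: dst_pmul.
Qed.

Lemma cscale_congr a s s' : cequiv s s' -> cequiv (cscale a s) (cscale a s').
Proof.
by move=> /cequivE h1; apply/cequivE; apply: small_le h1 => k; exact: dst_pscale.
Qed.

Lemma cstar_congr s s' : cequiv s s' -> cequiv (cstar s) (cstar s').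
Proof.
by move=> /cequivE h1; apply/cequivE; apply: small_le h1 => k; exact: dst_pstar.
Qed.

Lemma cauchy_star s : cauchy s -> cauchy (cstar s).
Proof.
move=> /cauchyE h; apply/cauchyE => e /h [N hN]; exists N => k l kN lN.
exact: le_lt_trans (dst_pstar _ _) (hN _ _ kN lN).
Qed.

Lemma cmulA s t u : cequiv (cmul s (cmul t u)) (cmul (cmul s t) u).
Proof. by apply: cequiv_dst0 => k; exact: pmulA. Qed.

Lemma cmul1 s : cequiv (cmul (cone S) s) s.
Proof. by apply: cequiv_dst0 => k; exact: pmul1. Qed.

Lemma cmulx1 s : cequiv (cmul s (cone S)) s.
Proof. by apply: cequiv_dst0 => k; exact: pmulx1. Qed.

Lemma cstarK s : cequiv (cstar (cstar s)) s.
Proof. by apply: cequiv_dst0 => k; exact: pstarK. Qed.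

Lemma cstarD s t : cequiv (cstar (cadd s t)) (cadd (cstar s) (cstar t)).
Proof. by apply: cequiv_dst0 => k; exact: pstarD. Qed.

Lemma cstarM s t : cequiv (cstar (cmul s t)) (cmul (cstar t) (cstar s)).
Proof. by apply: cequiv_dst0 => k; exact: pstarM. Qed.

Lemma cstarZ a s : cequiv (cstar (cscale a s)) (cscale (c a) (cstar s)).
Proof. by apply: cequiv_dst0 => k; exact: pstarZ. Qed.

Lemma cstar1 : cequiv (cstar (cone S)) (cone S).
Proof. by apply: cequiv_dst0 => k; exact: pstar1. Qed.

End Theory.
End RankSystems.

(** * Approximate intertwinings give isomorphic completions *)

Section Intertwining.
Variables (K : fieldType) (R : realType) (c : K -> K).
Variables (S1 S2 : dsys K R) (r1 : nat -> del S1 -> R) (r2 : nat -> del S2 -> R).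
Hypotheses (H1 : rank_system c r1) (H2 : rank_system c r2).
Variables (n_ m_ : nat -> nat) (phi : nat -> del S1 -> del S2) (psi : nat -> del S2 -> del S1).
Variables (eps tail : nat -> R).
Hypotheses (n_ge : forall k, (k <= n_ k)%N) (m_ge : forall k, (k <= m_ k)%N).
Hypotheses (n_le : forall k, (n_ k <= n_ k.+1)%N) (m_le : forall k, (m_ k <= m_ k.+1)%N).
Hypothesis phi_le : forall k x y,
  dD r2 (m_ k) (phi k x) (phi k y) <= dD r1 (n_ k) x y.
Hypothesis psi_le : forall k x y,
  dD r1 (n_ k.+1) (psi k x) (psi k y) <= dD r2 (m_ k) x y.
Hypothesis psi_phi : forall k x,
  dD r1 (n_ k.+1) (psi k (phi k x)) (dat (n_ k.+1) (n_ k, x)) <= eps k.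
Hypothesis phi_psi : forall k x,
  dD r2 (m_ k.+1) (phi k.+1 (psi k x)) (dat (m_ k.+1) (m_ k, x)) <= eps k.
Hypothesis phiD : forall k x y,
  dD r2 (m_ k) (phi k (dadd S1 x y)) (dadd S2 (phi k x) (phi k y)) = 0.
Hypothesis phiM : forall k x y,
  dD r2 (m_ k) (phi k (dmul S1 (n_ k) x y)) (dmul S2 (m_ k) (phi k x) (phi k y)) = 0.
Hypothesis phiZ : forall k a x,
  dD r2 (m_ k) (phi k (dscale S1 a x)) (dscale S2 a (phi k x)) = 0.
Hypothesis phi_star : forall k x,
  dD r2 (m_ k) (phi k (dstar S1 (n_ k) x)) (dstar S2 (m_ k) (phi k x)) = 0.
Hypothesis tail_ge : forall k, 2 * eps k + tail k.+1 <= tail k.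
Hypothesis tail_ge0 : forall k, 0 <= tail k.
Hypothesis tail_small : small tail.

Local Notation dst1 := (dst r1).
Local Notation dst2 := (dst r2).

Let eps_ge0 k : 0 <= eps k.
Proof. exact: le_trans (dD_ge0 H1 _ _ _) (psi_phi k (done S1 0)). Qed.

Let n_mono k l : (k <= l)%N -> (n_ k <= n_ l)%N.
Proof. by elim/level_ind: l / => // l _ h; exact: leq_trans h (n_le l). Qed.

Let F k (p : nat * del S1) : nat * del S2 := (m_ k, phi k (dat (n_ k) p)).
Let G k (q : nat * del S2) : nat * del S1 := (n_ k.+1, psi k (dat (m_ k) q)).

Let dst2F k p q : (p.1 <= n_ k)%N -> (q.1 <= n_ k)%N -> dst2 (F k p) (F k q) <= dst1 p q.
Proof.
move=> pk qk; rewrite (dstE H2 (M := m_ k)) // (dstE H1 pk qk).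
by rewrite (dat_self (F k p)) (dat_self (F k q)); exact: phi_le.
Qed.

Let dst1G k p q : (p.1 <= m_ k)%N -> (q.1 <= m_ k)%N -> dst1 (G k p) (G k q) <= dst2 p q.
Proof.
move=> pk qk; rewrite (dstE H1 (M := n_ k.+1)) // (dstE H2 pk qk).
by rewrite (dat_self (G k p)) (dat_self (G k q)); exact: psi_le.
Qed.

Let dstGF k p : (p.1 <= n_ k)%N -> dst1 (G k (F k p)) p <= eps k.
Proof.
move=> pk; apply: le_trans (psi_phi k (dat (n_ k) p)).
rewrite (dstr H1 (p' := (n_ k, dat (n_ k) p))); last first.
  by rewrite (dst_sym H1); exact: (dst_dat H1).
rewrite (dstE H1 (M := n_ k.+1)) ?n_le //.
by rewrite (dat_self (G k (F k p))) /G /= (dat_self (F k p)).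
Qed.

Let dstFG k q : (q.1 <= m_ k)%N -> dst2 (F k.+1 (G k q)) q <= eps k.
Proof.
move=> qk; apply: le_trans (phi_psi k (dat (m_ k) q)).
rewrite (dstr H2 (p' := (m_ k, dat (m_ k) q))); last first.
  by rewrite (dst_sym H2); exact: (dst_dat H2).
rewrite (dstE H2 (M := m_ k.+1)) ?m_le //.
by rewrite (dat_self (F k.+1 (G k q))) /F /= (dat_self (G k q)).
Qed.

Let dst1F k p q : (p.1 <= n_ k)%N -> (q.1 <= n_ k)%N ->
  dst1 p q <= dst2 (F k p) (F k q) + 2 * eps k.
Proof.
move=> pk qk; apply: le_trans (dst_tri H1 (G k (F k p)) _ _) _.
rewrite (dst_sym H1); apply: le_trans (lerD (dstGF pk) (dst_tri H1 (G k (F k q)) _ _)) _.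
have := lerD (@dst1G k (F k p) (F k q) (leqnn _) (leqnn _)) (dstGF qk).
lra.
Qed.

(** Both sides are compared with [F k.+1 (G k (F k p))]: [G k] nearly inverts [F k] on one side, and
    [F k.+1] nearly inverts [G k] on the other. *)
Let FS k p : (p.1 <= n_ k)%N -> dst2 (F k.+1 p) (F k p) <= 2 * eps k.
Proof.
move=> pk; apply: le_trans (dst_tri H2 (F k.+1 (G k (F k p))) _ _) _.
have := @dstFG k (F k p) (leqnn _).
have := @dst2F k.+1 p (G k (F k p)) (leq_trans pk (n_le k)) (leqnn _).
have := dstGF pk; rewrite (dst_sym H1 _ p); lra.
Qed.

(** Telescoping of [FS]: for fixed [p] the images [F k p] form a Cauchy sequence. *)
Let Ftail k l p : (p.1 <= n_ k)%N -> (k <= l)%N -> dst2 (F k p) (F l p) <= tail k - tail l.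
Proof.
move=> pk; elim/level_ind: l / => [|l kl IH].
  by rewrite (dst_refl H2) subrr.
apply: le_trans (dst_tri H2 (F l p) _ _) _.
rewrite (dst_sym H2 (F l p)).
have := FS (leq_trans pk (n_mono kl)); have := tail_ge l; lra.
Qed.

(** The [k]-th term of a sequence may live above level [n_ k]; it is sent through a stage that is at
    least [k] and whose level reaches it. *)
Let kap (k : nat) (p : nat * del S1) := maxn k p.1.
Let kapP k p : (p.1 <= n_ (kap k p))%N.
Proof. by apply: leq_trans (n_ge _); rewrite leq_maxr. Qed.

Let f (s : cseq S1) : cseq S2 := fun k => F (kap k (s k)) (s k).

Let tail_mono k l : (k <= l)%N -> tail l <= tail k.
Proof.
elim/level_ind: l / => // l kl; have := tail_ge l; have := eps_ge0 l; lra.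
Qed.

Let eps_tail k : 2 * eps k <= tail k.
Proof. by have := tail_ge k; have := tail_ge0 k.+1; lra. Qed.

Let Fnear k l l' p : (p.1 <= n_ l)%N -> (p.1 <= n_ l')%N -> (k <= l)%N -> (k <= l')%N ->
  dst2 (F l p) (F l' p) <= tail k.
Proof.
move=> pl pl' kl kl'; have [ll|/ltnW ll] := leqP l l'.
  apply: le_trans (Ftail pl ll) _.
  by have := tail_mono kl; have := tail_ge0 l'; lra.
rewrite (dst_sym H2); apply: le_trans (Ftail pl' ll) _.
by have := tail_mono kl'; have := tail_ge0 l; lra.
Qed.

Let dst_f_le s t k l : dst2 (f s k) (f t l) <= dst1 (s k) (t l) + tail k + tail l.
Proof.
pose N := maxn (kap k (s k)) (kap l (t l)).
have sN : ((s k).1 <= n_ N)%N by apply: leq_trans (kapP k _) (n_mono (leq_maxl _ _)).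
have tN : ((t l).1 <= n_ N)%N by apply: leq_trans (kapP l _) (n_mono (leq_maxr _ _)).
apply: le_trans (dst_tri H2 (F N (s k)) _ _) _.
have h1 : dst2 (f s k) (F N (s k)) <= tail k.
  by apply: Fnear; rewrite ?kapP //; rewrite /N /kap; lia.
have h2 : dst2 (F N (t l)) (f t l) <= tail l.
  by apply: Fnear; rewrite ?kapP //; rewrite /N /kap; lia.
have := dst_tri H2 (F N (t l)) (F N (s k)) (f t l).
by have := dst2F sN tN; lra.
Qed.

Let dst_f_ge s t k l :
  dst1 (s k) (t l) <= dst2 (f s k) (f t l) + 2 * tail k + tail l.
Proof.
pose N := maxn (kap k (s k)) (kap l (t l)).
have sN : ((s k).1 <= n_ N)%N by apply: leq_trans (kapP k _) (n_mono (leq_maxl _ _)).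
have tN : ((t l).1 <= n_ N)%N by apply: leq_trans (kapP l _) (n_mono (leq_maxr _ _)).
apply: le_trans (dst1F sN tN) _.
have h1 : dst2 (F N (s k)) (f s k) <= tail k.
  by apply: Fnear; rewrite ?kapP //; rewrite /N /kap; lia.
have h2 : dst2 (f t l) (F N (t l)) <= tail l.
  by apply: Fnear; rewrite ?kapP //; rewrite /N /kap; lia.
have := dst_tri H2 (f s k) (F N (s k)) (F N (t l)).
have := dst_tri H2 (f t l) (f s k) (F N (t l)).
have kN : (k <= N)%N by rewrite /N /kap; lia.
by have := eps_tail N; have := tail_mono kN; lra.
Qed.

Let f_near s k N : ((s k).1 <= n_ N)%N -> (k <= N)%N -> dst2 (f s k) (F N (s k)) <= tail k.
Proof. by move=> h1 h2; apply: Fnear; rewrite ?kapP // /kap leq_maxl. Qed.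

Let sml (a : R) : 0 <= a -> small (fun k => a * tail k).
Proof. by move=> a0; exact: small_mull. Qed.

(** For each operation one passes to a common late stage [N], where [F N] respects it up to distance
    0; moving between stages costs a few [tail k]. Only the unit is treated differently. *)
Theorem intertwining : exists g, star_alg_iso (S1 := S1) (S2 := S2) g.
Proof.
exists f; split; [split; [|split; [|split; [|split; [|split; [|split]]]]]|].
- move=> s /(cauchyE H1) sC; apply/(cauchyE H2) => e e0.
  have e3 : 0 < e / 3 by rewrite divr_gt0.
  have [N hN] := sC _ e3; have [M hM] := tail_small e3.
  exists (maxn N M) => k l; rewrite !geq_max => /andP[kN kM] /andP[lN lM].
  apply: le_lt_trans (dst_f_le _ _ _ _) _.
  by have := hN _ _ kN lN; have := hM _ kM; have := hM _ lM; lra.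
- move=> s t _ _; split=> [/(cequivE H1) st|/(cequivE H2) st].
    apply/(cequivE H2).
    apply: small_le (small_add st (sml (ler0n _ 2))) => k.
    by apply: le_trans (dst_f_le _ _ _ _) _; lra.
  apply/(cequivE H1).
  apply: small_le (small_add st (sml (ler0n _ 3))) => k.
  by apply: le_trans (dst_f_ge _ _ _ _) _; lra.
- move=> u /(cauchyE H2) uC.
  pose kq k := maxn k (u k).1.
  have uk k : ((u k).1 <= m_ (kq k))%N by apply: leq_trans (m_ge _); rewrite leq_maxr.
  (* A preimage is found by pulling the terms of [u] back; [F (kq k).+1] returns [u k] up to
     [eps (kq k)]. *)
  pose s : cseq S1 := fun k => G (kq k) (u k).
  have fsu k : dst2 (f s k) (u k) <= 2 * tail k.
    apply: le_trans (dst_tri H2 (F (kq k).+1 (s k)) _ _) _.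
    have h1 : dst2 (f s k) (F (kq k).+1 (s k)) <= tail k.
      by apply: f_near => //; rewrite /kq; lia.
    have kk : (k <= kq k)%N by rewrite leq_maxl.
    have := dstFG (uk k); have := eps_tail (kq k); have := tail_mono kk.
    have := eps_ge0 (kq k); lra.
  exists s; last first.
    by apply/(cequivE H2); apply: small_le (sml (ler0n _ 2)) => k.
  apply/(cauchyE H1) => e e0.
  (* The estimate costs seven tails and one distance between terms of [u]. *)
  have e8 : 0 < e / 8 by rewrite divr_gt0.
  have [N hN] := uC _ e8; have [M hM] := tail_small e8.
  exists (maxn N M) => k l; rewrite !geq_max => /andP[kN kM] /andP[lN lM].
  apply: le_lt_trans (dst_f_ge _ _ _ _) _.
  have := dst_tri H2 (u k) (f s k) (f s l); have := dst_tri H2 (u l) (u k) (f s l).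
  rewrite (dst_sym H2 (u l) (f s l)).
  by have := fsu k; have := fsu l; have := hN _ _ kN lN; have := hM _ kM; have := hM _ lM; lra.
- move=> s t _ _; apply/(cequivE H2).
  apply: small_le (sml (ler0n _ 3)) => k.
  pose N := maxn (maxn k (s k).1) (t k).1.
  have [kN sN tN] : [/\ (k <= N)%N, ((s k).1 <= n_ N)%N & ((t k).1 <= n_ N)%N].
    by split; rewrite ?(leq_trans _ (n_ge N)) // /N; lia.
  have hN : ((cadd s t k).1 <= n_ N)%N by rewrite /= geq_max sN.
  apply: le_trans (dst_tri H2 (F N (cadd s t k)) _ _) _.
  have h1 := f_near hN kN.
  have h2 := dst_padd H2 (F N (s k)) (F N (t k)) (f s k) (f t k).
  have h3 := f_near sN kN; have h4 := f_near tN kN.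
  rewrite (dst_sym H2) in h3; rewrite (dst_sym H2) in h4.
  suff h5 : dst2 (F N (cadd s t k)) (padd (F N (s k)) (F N (t k))) = 0.
    have := dst_tri H2 (padd (F N (s k)) (F N (t k))) (F N (cadd s t k)) (padd (f s k) (f t k)).
    rewrite h5 add0r => h6.
    have : dst2 (F N (cadd s t k)) (cadd (f s) (f t) k) <= 2 * tail k by apply: le_trans h6 _; lra.
    lra.
  rewrite (dstE H2 (M := m_ N)) //; last by rewrite /= maxnn.
  rewrite (dD0r H2 _ (dat_padd H2 _ _)) // (dat_self (F N (cadd s t k))).
  rewrite (dat_self (F N (s k))) (dat_self (F N (t k))).
  apply: (dD0_trans H2) (phiD _ _ _); apply: (dD0_le H2) (phi_le _ _ _) _.
  exact: (dat_padd H1).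
- move=> s t _ _; apply/(cequivE H2).
  apply: small_le (sml (ler0n _ 3)) => k.
  pose N := maxn (maxn k (s k).1) (t k).1.
  have [kN sN tN] : [/\ (k <= N)%N, ((s k).1 <= n_ N)%N & ((t k).1 <= n_ N)%N].
    by split; rewrite ?(leq_trans _ (n_ge N)) // /N; lia.
  have hN : ((cmul s t k).1 <= n_ N)%N by rewrite /= geq_max sN.
  apply: le_trans (dst_tri H2 (F N (cmul s t k)) _ _) _.
  have h1 := f_near hN kN.
  have h2 := dst_pmul H2 (F N (s k)) (F N (t k)) (f s k) (f t k).
  have h3 := f_near sN kN; have h4 := f_near tN kN.
  rewrite (dst_sym H2) in h3; rewrite (dst_sym H2) in h4.
  suff h5 : dst2 (F N (cmul s t k)) (pmul (F N (s k)) (F N (t k))) = 0.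
    have := dst_tri H2 (pmul (F N (s k)) (F N (t k))) (F N (cmul s t k)) (pmul (f s k) (f t k)).
    rewrite h5 add0r => h6.
    have : dst2 (F N (cmul s t k)) (cmul (f s) (f t) k) <= 2 * tail k by apply: le_trans h6 _; lra.
    lra.
  rewrite (dstE H2 (M := m_ N)) //; last by rewrite /= maxnn.
  rewrite (dD0r H2 _ (dat_pmul H2 _ _)) // (dat_self (F N (cmul s t k))).
  rewrite (dat_self (F N (s k))) (dat_self (F N (t k))).
  apply: (dD0_trans H2) (phiM _ _ _); apply: (dD0_le H2) (phi_le _ _ _) _.
  exact: (dat_pmul H1).
- apply/(cequivE H2); apply: small_le (sml (ler0n _ 3)) => k.
  (* The maps are not assumed unital. The image [b] of the unit under a round trip is close to the
     unit, and [e b = b]; so [e] is close to [e b = b], hence to the unit. *)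
  pose e := phi k.+1 (done S1 (n_ k.+1)).
  pose b := phi k.+1 (psi k (done S2 (m_ k))).
  have b1 : dD r2 (m_ k.+1) b (done S2 (m_ k.+1)) <= eps k.
    rewrite -(dD0r H2 (x := dat (m_ k.+1) (m_ k, done S2 (m_ k)))) ?phi_psi //.
    elim/level_ind: {+}(m_ k.+1) / (m_le k) => [|M hM IH].
      by rewrite (dat_self (m_ k, done S2 (m_ k))) (rs_refl H2).
    by rewrite datS //; apply: (dD0_trans H2) (rs_lift1 H2 _); rewrite (rs_lift H2).
  have eb : dD r2 (m_ k.+1) (dmul S2 (m_ k.+1) e b) b = 0.
    apply: (dD0_trans H2 (dD0_sym H2 (phiM _ _ _))).
    by apply: (dD0_le H2) (phi_le _ _ _) _; exact: (rs_mul1 H1).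
  have e1 : dD r2 (m_ k.+1) e (done S2 (m_ k.+1)) <= 2 * eps k.
    have h1 := rs_M H2 (m_ k.+1) e e b (done S2 (m_ k.+1)).
    rewrite (rs_refl H2) add0r (dD0l H2 _ eb) (dD0r H2 _ (rs_mulx1 H2 _ _)) in h1.
    have := rs_tri H2 (m_ k.+1) e b (done S2 (m_ k.+1)).
    by rewrite (rs_sym H2 _ e b); lra.
  have h : dst2 (F k.+1 (pone S1)) (pone S2) <= 2 * eps k.
    rewrite (dstE H2 (M := m_ k.+1)) // (dD0r H2 _ (dat_pone H2 _)).
    rewrite (dat_self (F k.+1 (pone S1))); apply: le_trans e1.
    rewrite (dD0l H2 _ (x' := e)) //.
    by apply: (dD0_le H2) (phi_le _ _ _) _; exact: (dat_pone H1).
  have := dst_tri H2 (F k.+1 (pone S1)) (f (cone S1) k) (pone S2).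
  have h2 := @f_near (cone S1) k k.+1 (leq0n _) (leqnSn _).
  have := tail_ge0 k; have := eps_tail k; rewrite -[cone S2 k]/(pone S2).
  rewrite -[cone S1 k]/(pone S1) in h2; lra.
- move=> a s _; apply/(cequivE H2); apply: small_le (sml (ler0n _ 3)) => k.
  pose N := maxn k (s k).1.
  have [kN sN] : (k <= N)%N /\ ((s k).1 <= n_ N)%N.
    by split; rewrite ?(leq_trans _ (n_ge N)) // /N; lia.
  have hN : ((cscale a s k).1 <= n_ N)%N by [].
  have h1 := f_near hN kN; have h3 := f_near sN kN.
  have h2 := dst_pscale H2 a (F N (s k)) (f s k).
  rewrite (dst_sym H2) in h3.
  suff h5 : dst2 (F N (cscale a s k)) (pscale a (F N (s k))) = 0.
    have := dst_tri H2 (F N (cscale a s k)) (f (cscale a s) k) (cscale a (f s) k).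
    have := dst_tri H2 (pscale a (F N (s k))) (F N (cscale a s k)) (pscale a (f s k)).
    rewrite -[cscale a (f s) k]/(pscale a (f s k)).
    have := tail_ge0 k; lra.
  rewrite (dstE H2 (M := m_ N)) //.
  rewrite (dD0r H2 _ (dat_pscale H2 _ _)) // (dat_self (F N (cscale a s k))).
  rewrite (dat_self (F N (s k))).
  apply: (dD0_trans H2) (phiZ _ _ _); apply: (dD0_le H2) (phi_le _ _ _) _.
  exact: (dat_pscale H1).
- move=> s _; apply/(cequivE H2); apply: small_le (sml (ler0n _ 3)) => k.
  pose N := maxn k (s k).1.
  have [kN sN] : (k <= N)%N /\ ((s k).1 <= n_ N)%N.
    by split; rewrite ?(leq_trans _ (n_ge N)) // /N; lia.
  have hN : ((cstar s k).1 <= n_ N)%N by [].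
  have h1 := f_near hN kN; have h3 := f_near sN kN.
  have h2 := dst_pstar H2 (F N (s k)) (f s k).
  rewrite (dst_sym H2) in h3.
  suff h5 : dst2 (F N (cstar s k)) (pstar (F N (s k))) = 0.
    have := dst_tri H2 (F N (cstar s k)) (f (cstar s) k) (cstar (f s) k).
    have := dst_tri H2 (pstar (F N (s k))) (F N (cstar s k)) (pstar (f s k)).
    rewrite -[cstar (f s) k]/(pstar (f s k)).
    have := tail_ge0 k; lra.
  rewrite (dstE H2 (M := m_ N)) //.
  rewrite (dD0r H2 _ (dat_pstar H2 _)) // (dat_self (F N (cstar s k))).
  rewrite (dat_self (F N (s k))).
  apply: (dD0_trans H2) (phi_star _ _); apply: (dD0_le H2) (phi_le _ _ _) _.
  exact: (dat_pstar H1).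
Qed.

End Intertwining.

(** * Regularity of a completion *)

Section StarRegular.
Variables (K : fieldType) (R : realType) (c : K -> K) (S : dsys K R).
Variables (r : nat -> del S -> R) (H : rank_system c r).
Hypothesis qinv_ex : forall n x, exists u, dD r n (dmul S n (dmul S n x u) x) x = 0.
Hypothesis qinv_near : forall n x u y, dD r n (dmul S n (dmul S n x u) x) x = 0 ->
  exists2 v, dD r n (dmul S n (dmul S n y v) y) y = 0 & dD r n u v <= 3 * dD r n x y.
Hypothesis definite : forall n x,
  dD r n x (dscale S 0 (done S n)) <= dD r n (dmul S n (dstar S n x) x) (dscale S 0 (done S n)).

Local Notation dst := (dst r).
Implicit Types p q u : nat * del S.

Let quasi p u := dst (pmul (pmul p u) p) p = 0.

Let quasiE M p u : (p.1 <= M)%N -> (u.1 <= M)%N -> quasi p u <->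
  dD r M (dmul S M (dmul S M (dat M p) (dat M u)) (dat M p)) (dat M p) = 0.
Proof.
move=> pM uM; rewrite /quasi (dstE H (M := M)) //; last first.
  by rewrite /= !geq_max pM uM.
rewrite (dD0l H _ (dat_pmul H _ pM)); last by rewrite /= geq_max pM.
rewrite (dD0l H _ (x' := dmul S M (dmul S M (dat M p) (dat M u)) (dat M p))) //.
by apply: (dD0_le H) (rs_M H _ _ _ _ _) _; rewrite (rs_refl H) (dat_pmul H) // addr0.
Qed.

Let quasi_ex p : exists u, quasi p u.
Proof.
have [u hu] := qinv_ex p.1 p.2; exists (p.1, u).
by apply/(@quasiE p.1) => //; rewrite (dat_self p) (dat_self (p.1, u)).
Qed.

(** The premise stands under the existential so that [choice] can produce a total function. *)
Let quasi_near p u q : exists v, quasi p u -> quasi q v /\ dst u v <= 3 * dst p q.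
Proof.
pose M := maxn (maxn p.1 u.1) q.1.
have [pM uM qM] : [/\ (p.1 <= M)%N, (u.1 <= M)%N & (q.1 <= M)%N] by rewrite /M; split; lia.
have [h|h] := pselect (quasi p u); last by exists u.
have [v v1 v2] := qinv_near (dat M q) ((quasiE pM uM).1 h).
exists (M, v) => _; split.
  by apply/(quasiE (M := M)) => //; rewrite (dat_self (M, v)).
by rewrite (dstE H uM) // (dstE H pM qM) (dat_self (M, v)).
Qed.

(** Quasi-inverses are not unique, and arbitrary choices need not converge. Along a subsequence with
    geometrically decreasing distances they are chosen one after the other, each close to the
    previous one, and so form a Cauchy sequence. *)
Let regular (s : cseq S) : cauchy s ->
  exists2 u, cauchy u & cequiv (cmul (cmul s u) s) s.
Proof.
move=> /(cauchyE H) sC.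
(* The clause [i <= N] makes [t k = s (N k)] asymptotically equal to [s k], so quasi-inverses found
   for [t] serve [s]. *)
have /choice [N hN] : forall i : nat, exists N, (i <= N)%N /\
    forall k l, (N <= k)%N -> (N <= l)%N -> dst (s k) (s l) < 1 / 2 ^+ i.
  move=> i; have [N hN] := sC (1 / 2 ^+ i) (divr_gt0 ltr01 (exprn_gt0 _ (ltr0n _ 2))).
  exists (maxn i N); rewrite leq_maxl; split => // k l.
  by rewrite !geq_max => /andP[_ kN] /andP[_ lN]; exact: hN.
pose t i := s (N i).
have tS i : dst (t i) (t i.+1) <= 2 / 2 ^+ i.
  have [_ h1] := hN i; have [_ h2] := hN i.+1.
  pose k := maxn (N i) (N i.+1).
  apply: le_trans (dst_tri H (s k) _ _) _.
  have e : 2 / 2 ^+ i = 1 / 2 ^+ i + 1 / 2 ^+ i :> R by rewrite -mulrDl.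
  rewrite e lerD // ltW //; first by apply: h1 => //; rewrite leq_maxl.
  apply: lt_le_trans (h2 _ _ _ _) _; rewrite ?leq_maxr //.
  by rewrite ler_pM2l // lef_pV2 ?posrE ?exprn_gt0 // ler_eXn2l // ltr1n.
have /choice [nxt hnxt] : forall a : nat * (nat * del S), exists v,
    quasi (t a.1) a.2 -> quasi (t a.1.+1) v /\ dst a.2 v <= 3 * dst (t a.1) (t a.1.+1).
  by move=> [i u]; exact: quasi_near.
have [u0 hu0] := quasi_ex (t 0%N).
pose fix u i := if i is j.+1 then nxt (j, u j) else u0.
have uq i : quasi (t i) (u i) by elim: i => [//|i IH] /=; have [] := hnxt (i, u i) IH.
have uS i : dst (u i) (u i.+1) <= 6 / 2 ^+ i.
  have [_ h] := hnxt (i, u i) (uq i); apply: le_trans h _; have := tS i => /=.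
  have -> : 6 / 2 ^+ i = 3 * (2 / 2 ^+ i) :> R by rewrite mulrA; congr (_ / _); ring.
  by rewrite ler_pM2l.
(* [12 / 2 ^+ i] is the sum of the steps [6 / 2 ^+ j] over [j >= i]. *)
have uT i j : (i <= j)%N -> dst (u i) (u j) <= 12 / 2 ^+ i - 12 / 2 ^+ j.
  elim/level_ind: j / => [|j ij IH]; first by rewrite (dst_refl H) subrr.
  apply: le_trans (dst_tri H (u j) _ _) _; have := uS j.
  have -> : 12 / 2 ^+ j.+1 = 6 / 2 ^+ j :> R.
    by rewrite exprS invfM mulrA; congr (_ * _); field.
  have e12 : 12 / 2 ^+ j = 6 / 2 ^+ j + 6 / 2 ^+ j :> R.
    by rewrite -mulrDl; congr (_ / _); ring.
  by move: IH; rewrite e12; lra.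
exists u.
  apply/(cauchyE H) => e e0; have [M hM] := small_exp (12 : R) e0; exists M => k l kM lM.
  have pos i : 0 <= 12 / 2 ^+ i :> R by rewrite divr_ge0 // exprn_ge0.
  have [kl|/ltnW kl] := leqP k l.
    by have := uT _ _ kl; have := hM _ kM; have := pos l; lra.
  by rewrite (dst_sym H); have := uT _ _ kl; have := hM _ lM; have := pos k; lra.
apply/(cequivE H) => e e0; have e4 : 0 < e / 4 by rewrite divr_gt0.
have [M hM] := sC _ e4; exists M => k kM.
have [kN _] := hN k.
have stk : dst (s k) (t k) < e / 4 by apply: hM => //; exact: leq_trans kN.
have := dst_tri H (pmul (pmul (t k) (u k)) (t k)) (pmul (pmul (s k) (u k)) (s k)) (s k).
rewrite (dstl H _ (uq k)) (dst_sym H (t k)).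
have := dst_pmul H (pmul (s k) (u k)) (s k) (pmul (t k) (u k)) (t k).
have := dst_pmul H (s k) (u k) (t k) (u k); rewrite (dst_refl H).
rewrite -[cmul (cmul s u) s k]/(pmul (pmul (s k) (u k)) (s k)); lra.
Qed.

Lemma rank_system_star_regular : star_regular S c.
Proof.
split; [exact: regular|split; [exact: (cauchy_star H)|split]].
  by move=> s t _ _; exact: (cstar_congr H).
split; [by move=> s _; exact: (cstarK H)|split].
  by move=> s t _ _; exact: (cstarD H).
split; [by move=> s t _ _; exact: (cstarM H)|split].
  by move=> a s _; exact: (cstarZ H).
move=> s _ /(cequivE H) h; apply/(cequivE H); apply: small_le h => k.
set M := (s k).1.
have z : dD r M (dat M (czero S k)) (dscale S 0 (done S M)) = 0.
  apply: (dD0_trans H (dat_pscale H 0 (p := pone S) (leq0n _))).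
  by apply: (dD0_le H) (rs_Z H _ _ _ _) _; exact: (dat_pone H).
rewrite !(dstE H (M := M)) //; last by rewrite /= maxnn.
rewrite !(dD0r H _ z); apply: le_trans (definite _ _) _.
rewrite (dat_self (s k)) (dD0l H _ (dat_pmul H (p := pstar (s k)) _ _)) //.
by rewrite (dat_self (pstar (s k))) (dat_self (s k)).
Qed.

End StarRegular.

(** * Towers of return words *)

Definition wd (w : seq nat) := (size w).+1.

(* [pmap p (iota 0 D)] reads off the labels of a tiling of [0, D) whose tile
   labelled [v] has length [d v] and starts at the positions where [p] is [Some v]. *)
Lemma tiling_ind (B : Type) (d : B -> nat) (p : nat -> option B) D
    (Q : nat -> seq B -> Prop) :
  (0 < D)%N -> p 0%N <> None ->
  (forall k v, (k < D)%N -> p k = Some v ->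
     [/\ (0 < d v)%N, (k + d v <= D)%N, (forall i, (k < i < k + d v)%N -> p i = None)
       & (k + d v < D)%N -> p (k + d v)%N <> None]) ->
  Q D [::] ->
  (forall k v L, (k < D)%N -> p k = Some v -> (k + d v <= D)%N ->
     (forall i, (k < i < k + d v)%N -> p i = None) -> Q (k + d v)%N L -> Q k (v :: L)) ->
  Q 0%N (pmap p (iota 0 D)).
Proof.
move=> D0 p0 hp QD QS.
suff H n k : (k <= D)%N -> (D - k <= n)%N -> ((k < D)%N -> p k <> None) ->
    Q k (pmap p (iota k (D - k))).
  by have := H D 0%N; rewrite !subn0; apply.
elim: n k => [|n IH] k kD Dk pk.
  have -> : k = D by lia.
  by rewrite subnn.
have [->|kD'] := eqVneq k D; first by rewrite subnn.
have {}kD : (k < D)%N by lia.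
case pkv : (p k) => [v|]; last by have := pk kD; rewrite pkv.
have [dv kdv pN pS] := hp _ _ kD pkv.
have -> : iota k (D - k) = k :: iota k.+1 (d v).-1 ++ iota (k + d v)%N (D - (k + d v)).
  have -> : (D - k = (1 + (d v).-1) + (D - (k + d v)))%N by lia.
  rewrite !iotaD /=; congr (_ :: _ ++ iota _ _); first by rewrite addn1.
  by lia.
rewrite /= pkv /= pmap_cat.
have -> : pmap p (iota k.+1 (d v).-1) = [::].
  have : forall i, i \in iota k.+1 (d v).-1 -> p i = None.
    by move=> i; rewrite mem_iota => ki; apply: pN; lia.
  elim: (iota _ _) => //= i s IHs h.
  by rewrite h ?mem_head //= IHs // => j js; apply: h; rewrite inE js orbT.
by apply: (QS) => //; apply: IH => //; lia.
Qed.

Section Towers.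
Variables (R : realType) (X : pseudoPMetricType R) (T : X -> X).
Variables (E : nat -> set X) (P : nat -> seq (set X)).
Hypothesis E_dec : forall n, E n.+1 `<=` E n.
Hypothesis P_disj : forall n i j, (i < size (P n))%N -> (j < size (P n))%N -> i <> j ->
  nth set0 (P n) i `&` nth set0 (P n) j = set0.
Hypothesis P_cover : forall n x, ~ E n x <-> exists2 i, (i < size (P n))%N & nth set0 (P n) i x.
Hypothesis P_refine : forall n B, memPE E P n.+1 B -> exists2 B', memPE E P n B' & B `<=` B'.

Local Notation Ws := (Wset T E P).
Local Notation V := (inV T E P).
Implicit Types (n m i j k : nat) (w v : seq nat) (x z : X).

(* The index of the member of [P n] containing [x], or [size (P n)] on [E n]. *)
Definition cell n x := find (fun S : set X => `[< S x >]) (P n).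

Lemma cell_nth n x : (cell n x < size (P n))%N -> nth set0 (P n) (cell n x) x.
Proof.
move=> h; apply/asboolP; apply: (nth_find set0 (a := fun S : set X => `[< S x >])).
by rewrite has_find.
Qed.

Lemma cell_eq n x i : (i < size (P n))%N -> nth set0 (P n) i x -> cell n x = i.
Proof.
move=> iP xi.
have h : has (fun S : set X => `[< S x >]) (P n).
  by apply/hasP; exists (nth set0 (P n) i); [exact: mem_nth|exact/asboolP].
have cP : (cell n x < size (P n))%N by rewrite /cell -has_find.
apply: contrapT => ne.
by have := P_disj cP iP ne => /seteqP [/(_ x) + _]; apply; split=> //; exact: cell_nth.
Qed.

Lemma cell_le n x : (cell n x <= size (P n))%N.
Proof. exact: find_size. Qed.

Lemma E_cell n x : E n x <-> cell n x = size (P n).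
Proof.
split=> [Ex|cx].
  apply/eqP; rewrite eqn_leq cell_le leqNgt; apply/negP => h.
  by have : ~ E n x by apply/P_cover; exists (cell n x) => //; exact: cell_nth.
apply: contrapT => /P_cover [i iP /(cell_eq iP) e].
by move: iP; rewrite -e cx ltnn.
Qed.

Lemma nE_cell n x : ~ E n x <-> (cell n x < size (P n))%N.
Proof.
split=> [nE|c /E_cell e]; last by move: c; rewrite e ltnn.
by rewrite ltn_neqAle cell_le andbT; apply/eqP => /E_cell.
Qed.

(** Both points lie in one member of level [n.+1], which is contained in one member of level [n]. *)
Lemma cellS n x x' : cell n.+1 x = cell n.+1 x' -> cell n x = cell n x'.
Proof.
move=> e.
have [B [mB Bx Bx']] : exists B, [/\ memPE E P n.+1 B, B x & B x'].
  have [Ex|nEx] := pselect (E n.+1 x).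
    exists (E n.+1); split=> //; first by left.
    by apply/E_cell; rewrite -e; exact/E_cell.
  have cx := (nE_cell _ _).1 nEx.
  exists (nth set0 (P n.+1) (cell n.+1 x)); split; first by right; exists (cell n.+1 x).
    exact: cell_nth.
  by rewrite e; apply: cell_nth; rewrite -e.
have [B' [->|[i iP ->]] BB'] := P_refine mB.
  by have /E_cell -> := BB' _ Bx; have /E_cell -> := BB' _ Bx'.
by rewrite (cell_eq iP (BB' _ Bx)) (cell_eq iP (BB' _ Bx')).
Qed.

Lemma cell_coarser n m x x' : (n <= m)%N -> cell m x = cell m x' -> cell n x = cell n x'.
Proof. by elim/level_ind: m / => // m _ IH /cellS. Qed.

(** A letter out of range denotes the default [set0], so a point of [W] forces all letters to be
    genuine indices. *)
Lemma WsetE n w x : Ws n w x <-> [/\ E n x,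
  forall i, (i < size w)%N -> (nth 0 w i < size (P n))%N /\ cell n (iter i.+1 T x) = nth 0%N w i
  & E n (iter (wd w) T x)].
Proof.
split=> [[Ex [h Ex']]|[Ex h Ex']]; split=> //.
  move=> i iw; have := h i iw.
  have [iP /(cell_eq iP) -> //|iP] := ltnP (nth 0%N w i) (size (P n)).
  by rewrite nth_default.
split=> // i iw; have [iP e] := h i iw; rewrite -{1}e; apply: cell_nth.
by rewrite e.
Qed.

Lemma Wset_start n w x : Ws n w x -> E n x. Proof. by case. Qed.

Lemma Wset_end n w x : Ws n w x -> E n (iter (wd w) T x). Proof. by case=> _ []. Qed.

(** Members of [P n] avoid [E n]; thus [wd w] is the first return time to [E n]. *)
Lemma Wset_between n w x i : Ws n w x -> (0 < i < wd w)%N -> ~ E n (iter i T x).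
Proof.
move=> /WsetE [_ h _]; case: i => // i /=; rewrite ltnS => iw.
by have [a b] := h i iw; apply/nE_cell; rewrite b.
Qed.

Lemma Wset_inV n w x : Ws n w x -> V n w.
Proof.
move=> wx; split; last by exists x.
apply/(all_nthP 0%N) => i iw; have /WsetE [_ h _] := wx.
by have [] := h i iw.
Qed.

(** The first return time fixes the length of the word, and the cells visited fix its letters. *)
Lemma Wset_uniq n w w' x : Ws n w x -> Ws n w' x -> w = w'.
Proof.
move=> wx wx'.
have le u u' : Ws n u x -> Ws n u' x -> (size u <= size u')%N.
  move=> ux ux'; rewrite leqNgt; apply/negP => h.
  by apply: (Wset_between ux (i := wd u')); [rewrite /wd; lia|exact: Wset_end].
have e : size w = size w' by apply/eqP; rewrite eqn_leq !le.
apply: (@eq_from_nth _ 0%N) => // i iw.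
have /WsetE [_ h _] := wx; have /WsetE [_ h' _] := wx'.
by have [_ <-] := h i iw; have [|_ <-] := h' i; rewrite -?e.
Qed.

Lemma Wset_first_return n x k : E n x -> (0 < k)%N -> E n (iter k T x) ->
  exists w, Ws n w x /\ (wd w <= k)%N.
Proof.
move=> Ex k0 Ek.
have ex : exists i, (0 < i)%N && `[< E n (iter i T x) >].
  by exists k; rewrite k0; apply/asboolP.
case: (ex_minnP ex) => i /andP[i0 /asboolP Ei] imin.
exists (map (fun j => cell n (iter j.+1 T x)) (iota 0 i.-1)); split; last first.
  by rewrite /wd size_map size_iota prednK // imin // k0; apply/asboolP.
apply/WsetE; rewrite /wd size_map size_iota prednK //; split=> // j ji.
rewrite (nth_map 0%N) ?size_iota // nth_iota // add0n; split=> //.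
apply/nE_cell => h; have : (i <= j.+1)%N by apply: imin; exact/asboolP.
by move: ji; lia.
Qed.

Lemma Wset_cell m w x x' i : Ws m w x -> Ws m w x' -> (i <= wd w)%N ->
  cell m (iter i T x) = cell m (iter i T x').
Proof.
move=> wx wx' iw; case: i iw => [|i] iw /=.
  by rewrite ((E_cell _ _).1 (Wset_start wx)) ((E_cell _ _).1 (Wset_start wx')).
have [iw'|] := ltnP i (size w).
  have /WsetE [_ h _] := wx; have /WsetE [_ h' _] := wx'.
  by have [_ ->] := h i iw'; have [_ ->] := h' i iw'.
move=> wi; have -> : i = size w by move: iw; rewrite /wd; lia.
by rewrite ((E_cell _ _).1 (Wset_end wx)) ((E_cell _ _).1 (Wset_end wx')).
Qed.

(** Whether a given level [n] tower starts at height [k] of a level [m] tower is decided by the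
    level [m] word alone, since its letters determine the coarser cells. *)
Lemma Wset_shift n m w w' k z z' : (n <= m)%N -> Ws m w' z -> Ws m w' z' ->
  (k + wd w <= wd w')%N -> Ws n w (iter k T z) -> Ws n w (iter k T z').
Proof.
move=> nm wz wz' kw.
have ce i : (i <= wd w)%N -> cell n (iter i T (iter k T z)) = cell n (iter i T (iter k T z')).
  move=> iw; rewrite -!iterD; apply: cell_coarser nm _.
  by apply: Wset_cell wz wz' _; lia.
move=> /WsetE [h1 h2 h3]; apply/WsetE; split.
- by apply/E_cell; rewrite -(ce 0%N) //; exact/E_cell.
- by move=> i iw; rewrite -ce ?/wd; [exact: h2|lia].
- by apply/E_cell; rewrite -ce //; exact/E_cell.
Qed.

Lemma E_anti n m : (n <= m)%N -> E m `<=` E n.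
Proof.
elim/level_ind: m / => [|m _ h]; first exact: subset_refl.
exact: (subset_trans (@E_dec m) h).
Qed.

(** Leaving the top of a level [m] tower means visiting [E m], which lies in [E n]; so a level [n]
    tower started inside it also ends inside it. *)
Lemma tower_inside n m w' z k : (n <= m)%N -> Ws m w' z -> (k < wd w')%N ->
  E n (iter k T z) -> exists w, Ws n w (iter k T z) /\ (k + wd w <= wd w')%N.
Proof.
move=> nm wz kw Ek.
have [||w [ww wk]] := Wset_first_return Ek (k := wd w' - k); first by rewrite subn_gt0.
  by rewrite -iterD subnK 1?ltnW //; apply: E_anti nm _ _; exact: Wset_end wz.
by exists w; split=> //; lia.
Qed.

Lemma tower_bound n m w w' z k : (n <= m)%N -> Ws m w' z -> (k < wd w')%N ->
  Ws n w (iter k T z) -> (k + wd w <= wd w')%N.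
Proof.
move=> nm wz kw wk; have [w0 [w0k h]] := tower_inside nm wz kw (Wset_start wk).
by rewrite (Wset_uniq wk w0k).
Qed.

(** By [Wset_shift] the inclusion of [T^j(W')] in [W] can be tested on a single point. *)
Lemma parentP n w' z j w : Ws n.+1 w' z -> (j < wd w')%N ->
  parentW T E P n w' j = Some w <-> Ws n w (iter j T z).
Proof.
move=> wz jw.
have sound u : parentW T E P n w' j = Some u -> Ws n u (iter j T z).
  rewrite /parentW; case: pselect => // h [<-].
  by have [_] := proj2_sig (cid h); apply; exists z.
split; first exact: sound.
move=> wj; case e : (parentW T E P n w' j) => [u|].
  by congr Some; apply: Wset_uniq (sound _ e) wj.
move: e; rewrite /parentW; case: pselect => // h _; case: h; exists w.
split; first exact: Wset_inV wj.
move=> _ [x wx <-]; apply: (Wset_shift (leqnSn n) wz wx _ wj).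
exact: tower_bound (leqnSn n) wz jw wj.
Qed.

(** The level [n] towers stacked inside the tower of [w'], from bottom to top. *)
Definition parents n w' := pmap (parentW T E P n w') (iota 0 (wd w')).

Lemma parents_ind n w' z (Q : nat -> seq (seq nat) -> Prop) : Ws n.+1 w' z ->
  Q (wd w') [::] ->
  (forall k v L, (k + wd v <= wd w')%N -> Ws n v (iter k T z) ->
     parentW T E P n w' k = Some v ->
     (forall i, (k < i < k + wd v)%N -> parentW T E P n w' i = None) ->
     Q (k + wd v)%N L -> Q k (v :: L)) ->
  Q 0%N (parents n w').
Proof.
move=> wz Q0 QS.
have notN k : (k < wd w')%N -> E n (iter k T z) -> parentW T E P n w' k <> None.
  move=> kw Ek; have [w [wk _]] := tower_inside (leqnSn n) wz kw Ek.
  by rewrite ((parentP _ wz kw).2 wk).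
apply: (tiling_ind (d := wd)) => //.
- by apply: notN => //=; apply: E_dec; exact: Wset_start wz.
- move=> k v kw /(parentP _ wz kw) wk.
  have kv := tower_bound (leqnSn n) wz kw wk.
  split=> // [i /andP[ki ik]|kvw].
    case e : (parentW T E P n w' i) => [u|] //.
    have /(parentP _ wz _) /Wset_start : parentW T E P n w' i = Some u by [].
    have iw : (i < wd w')%N by lia.
    move=> /(_ iw) Ei; exfalso; apply: (Wset_between wk (i := i - k)); first by lia.
    by rewrite -iterD subnK // ltnW.
  by apply: notN => //; rewrite addnC iterD; exact: Wset_end wk.
- move=> k v L kw pk kv pN; apply: QS => //.
  exact: (parentP _ wz kw).1.
Qed.

Lemma parents_size n w' : V n.+1 w' -> dsz wd (parents n w') = wd w'.
Proof.
move=> [_ [z wz]]; rewrite -[RHS]subn0.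
apply: (parents_ind (Q := fun k L => dsz wd L = (wd w' - k)%N) wz).
  by rewrite /dsz big_nil subnn.
by move=> k v L kv _ _ _ IH; rewrite dsz_cons IH; lia.
Qed.

Lemma parents_inV n w' v : V n.+1 w' -> v \in parents n w' -> V n v.
Proof.
move=> [_ [z wz]].
apply: (parents_ind (Q := fun k L => v \in L -> V n v) wz) => //.
move=> k u L _ uk _ _ IH; rewrite inE => /orP[/eqP ->|//].
exact: Wset_inV uk.
Qed.

Lemma parents_sum n w' z (G : seq nat -> nat) (g : nat -> nat) : Ws n.+1 w' z ->
  (forall k v, (k + wd v <= wd w')%N -> Ws n v (iter k T z) ->
     G v = \sum_(k <= l < k + wd v) g l)%N ->
  (\sum_(v <- parents n w') G v = \sum_(0 <= l < wd w') g l)%N.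
Proof.
move=> wz hG.
apply: (parents_ind (Q := fun k L => \sum_(v <- L) G v = \sum_(k <= l < wd w') g l)%N wz).
  by rewrite big_nil big_geq.
move=> k v L kv vk _ _ IH; rewrite big_cons IH (hG _ _ kv vk) -big_cat_nat //.
by rewrite leq_addr.
Qed.

(** In the sum over heights only the bottoms of level [n] towers contribute, and their blocks occupy
    consecutive intervals; the connecting map is therefore a placement along [parents]. *)
Lemma jblkE (K : fieldType) n (x : blk K) w' a b : V n.+1 w' ->
  jblk T E P n x w' a b = dg wd x (parents n w') a b.
Proof.
move=> [_ [z wz]].
pose F j := match parentW T E P n w' j with
  | Some w => if [&& (j <= a)%N, (a < j + (size w).+1)%N, (j <= b)%N
                      & (b < j + (size w).+1)%N] then x w (a - j)%N (b - j)%N else 0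
  | None => 0 end.
rewrite /jblk -(big_mkord predT F).
(* Invariant of the tiling: the terms of height at least [k] form the diagonal of the remaining
   blocks, moved to start at [k]. *)
pose Q k L := \sum_(k <= j < wd w') F j =
  if (k <= a)%N && (k <= b)%N then dg wd x L (a - k)%N (b - k)%N else 0.
have : Q 0%N (parents n w'); last by rewrite /Q !subn0.
apply: (parents_ind wz).
  by rewrite /Q big_geq //; case: ifP.
move=> k v L kv vk pk pN; rewrite /Q => IH.
rewrite (@big_cat_nat _ _ _ (k + wd v)) ?leq_addr //= IH.
rewrite big_ltn ?ltnS ?leq_addr //; last by rewrite /wd; lia.
rewrite big_nat big1 ?addr0; last first.
  by move=> i ik; rewrite /F pN.
rewrite /F pk -/(wd v) blE.
have [ka|ak] := leqP k a; have [kb|bk] := leqP k b => /=; rewrite ?andbF ?add0r.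
- rewrite !ltn_subLR // !subnDA.
  have [h1|h1] := ltnP a (k + wd v); have [h2|h2] := ltnP b (k + wd v) => //=;
    by rewrite ?andbF ?addr0 ?add0r.
- by rewrite ifF //; lia.
- by rewrite ifF //; lia.
- by rewrite ifF //; lia.
Qed.

Fixpoint ancestors n k w : seq (seq nat) :=
  if k is k'.+1 then flatten (map (ancestors n k') (parents (n + k') w)) else [:: w].

Lemma ancestors_inV n k w v : V (n + k) w -> v \in ancestors n k w -> V n v.
Proof.
elim: k w => [|k IH] w /=; first by rewrite addn0 inE => ? /eqP ->.
rewrite addnS => wV /flatten_mapP [u uw]; apply: IH.
exact: parents_inV uw.
Qed.

Lemma ancestors_size n k w : V (n + k) w -> dsz wd (ancestors n k w) = wd w.
Proof.
elim: k w => [|k IH] w /=; first by rewrite dsz_cons [dsz _ _]big_nil !addn0.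
rewrite addnS => wV; rewrite -(parents_size wV) /dsz big_flatten big_map.
rewrite big_seq [RHS]big_seq; apply: eq_bigr => u uw.
by rewrite -(IH u) //; exact: parents_inV uw.
Qed.

(** Occurrences of [v] are visits of an orbit segment to [Ws n v]; this links multiplicities of
    blocks with measures of sets. *)
Lemma count_ancestors n k w v z : Ws (n + k) w z ->
  count_mem v (ancestors n k w) = (\sum_(0 <= l < wd w) `[< Ws n v (iter l T z) >])%N.
Proof.
elim: k w z => [|k IH] w z /=.
  rewrite addn0 => wz; rewrite big_ltn // big_nat big1 ?addn0 /=; last first.
    move=> i iw; case: asboolP => // wi; case: (Wset_between wz iw).
    exact: Wset_start wi.
  case: eqP => [<-|ne]; first by case: asboolP.
  by case: asboolP => // wz'; case: ne; exact: Wset_uniq wz wz'.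
rewrite addnS => wz; rewrite count_flatten sumnE !big_map.
apply: (parents_sum wz) => j u ju uj; rewrite (IH _ _ uj) -{2}[j]add0n big_addn addKn.
by apply: eq_bigr => l _; rewrite iterD.
Qed.

End Towers.

(** * Ergodicity *)

Section BorelDynamics.
Variables (R : realType) (X : pseudoPMetricType R).
Local Notation XB := (g_sigma_algebraType (@open X)).
Variable mu : {measure set XB -> \bar R}.
Hypothesis X_haus : hausdorff_space X.
Hypothesis mu1 : mu [set: X] = 1%E.
Implicit Types (A B U : set X).

Definition meas A := measurable (A : set XB).

Lemma measC A : meas A -> meas (~` A). Proof. exact: measurableC. Qed.

Lemma measI A B : meas A -> meas B -> meas (A `&` B). Proof. exact: measurableI. Qed.

Lemma measU A B : meas A -> meas B -> meas (A `|` B). Proof. exact: measurableU. Qed.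

Lemma meas_open A : open A -> meas A.
Proof. exact: sub_sigma_algebra. Qed.

Lemma meas_pre (f : X -> X) A : continuous f -> meas A -> meas (f @^-1` A).
Proof.
move=> cf mA; rewrite /meas -[X in measurable X]setTI.
suff mf : measurable_fun (setT : set XB) (f : XB -> XB) by exact: mf.
apply: (@measurability _ _ XB XB setT f (@open X)) => // _ [U oU <-]; rewrite setTI.
by apply: meas_open; move/continuousP: cf; exact.
Qed.

Lemma continuous_iter (f : X -> X) i : continuous f -> continuous (iter i f).
Proof.
move=> cf; elim: i => [|i IH] x /=; first exact: cvg_id.
exact: (continuous_comp (IH x) (cf _)).
Qed.

Lemma meas_set1 x : meas [set x].
Proof.
rewrite /meas -[X in measurable X]setCK; apply: measurableC; apply: meas_open.
by rewrite openC; exact/accessible_closed_set1/hausdorff_accessible.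
Qed.

Lemma meas_bigcup (F : nat -> set X) : (forall n, meas (F n)) -> meas (\bigcup_n F n).
Proof. by move=> h; apply: bigcup_measurable => n _; exact: h. Qed.

Lemma meas_bigcap (F : nat -> set X) : (forall n, meas (F n)) -> meas (\bigcap_n F n).
Proof. by move=> h; exact: bigcapT_measurable. Qed.

Lemma mu_mono A B : meas A -> meas B -> A `<=` B -> (mu A <= mu B)%E.
Proof. by move=> mA mB AB; apply: le_measure; rewrite ?inE. Qed.

Lemma mu_le1 A : meas A -> (mu A <= 1)%E.
Proof. by move=> mA; rewrite -mu1 mu_mono //; exact: measurableT. Qed.

Lemma mu_fin A : meas A -> mu A \is a fin_num.
Proof.
move=> mA; rewrite ge0_fin_numE; last exact: measure_ge0.
by rewrite (le_lt_trans (mu_le1 mA)) // ltry.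
Qed.

Lemma mu_setU A B : meas A -> meas B -> A `&` B = set0 ->
  mu (A `|` B) = (mu A + mu B)%E.
Proof. by move=> mA mB AB; apply: measureU. Qed.

Lemma mu_setI_full A B : meas A -> meas B -> mu B = 1%E -> mu (A `&` B) = mu A.
Proof.
move=> mA mB B1; have mBc : meas (~` B) by exact: measurableC.
have Bc0 : mu (~` B) = 0%E.
  have := mu_setU mB mBc (setICr B); rewrite setUCr mu1 B1 -(fineK (mu_fin mBc)).
  by rewrite -EFinD => -[e]; congr EFin; lra.
have mAB : meas (A `&` B) by exact: measurableI.
rewrite -{2}(setIT A) -(setUCr B) setIUr mu_setU //; last 2 first.
- exact: measurableI.
- by rewrite setIACA setICr setI0.
rewrite (_ : mu (A `&` ~` B) = 0%E) ?adde0 //.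
by apply: subset_measure0 Bc0 => //; first [exact: measurableI|exact: subIsetr].
Qed.

Lemma meas_bigcup_count (I : countType) (D : set I) (G : I -> set X) :
  (forall i, D i -> meas (G i)) -> meas (\bigcup_(i in D) G i).
Proof.
move=> mG.
pose G' n := [set x | exists i, [/\ pickle i = n, D i & G i x]].
have -> : \bigcup_(i in D) G i = \bigcup_n G' n.
  by apply/seteqP; split=> x [i]; [exists (pickle i) => //; exists i|move=> _ [j []]; exists j].
apply: meas_bigcup => n.
have [[i [iE Di]]|h] := pselect (exists i, pickle i = n /\ D i).
  suff -> : G' n = G i by exact: mG.
  apply/seteqP; split=> x; last by exists i.
  by move=> [j [jE _]]; rewrite (pcan_inj pickleK (etrans jE (esym iE))).
suff -> : G' n = set0 by exact: measurable0.
by apply/seteqP; split=> x // [i [iE Di _]]; case: h; exists i.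
Qed.

Lemma mu_bigcup_count (I : countType) (D : set I) (G : I -> set X) :
  (forall i, D i -> meas (G i)) -> trivIset D G ->
  mu (\bigcup_(i in D) G i) = (\esum_(i in D) mu (G i))%E.
Proof.
move=> mG tG.
pose G' (n : nat) := if unpickle n is Some i then G i else set0.
pose D' := [set n | exists2 i, D i & pickle i = n].
have G'E i : G' (pickle i) = G i by rewrite /G' pickleK.
have -> : \bigcup_(i in D) G i = \bigcup_(n in D') G' n.
  apply/seteqP; split=> x [i Di Gx].
    by exists (pickle i); [exists i|rewrite G'E].
  by case: Di => j Dj e; exists j => //; rewrite -G'E e.
rewrite measure_bigcup; last 2 first.
- by move=> n [i Di <-]; rewrite G'E; exact: mG.
- move=> n m [i Di <-] [j Dj <-]; rewrite !G'E => /(tG _ _ Di Dj) ->.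
  by [].
rewrite nneseries_esum; last by move=> n _; exact: measure_ge0.
rewrite (_ : [set x | x \in D'] = pickle @` D); last first.
  by apply/seteqP; split=> n /=; rewrite ?inE => -[i Di e]; rewrite ?inE; exists i.
rewrite esum_image; first by apply: eq_esum => i _; rewrite G'E.
by move=> i j _ _; exact: (pcan_inj pickleK).
Qed.

Lemma nondecreasing_mu_le (F : nat -> set X) (a : \bar R) :
  (forall n, meas (F n)) -> (forall n, F n `<=` F n.+1) ->
  (forall n, (mu (F n) <= a)%E) -> (mu (\bigcup_n F n) <= a)%E.
Proof.
move=> mF nF Fa.
have nd : nondecreasing_seq F.
  apply/nondecreasing_seqP => n; apply/subsetPset; exact: nF.
have cv := nondecreasing_cvg_mu (mu := mu) mF (meas_bigcup mF) nd.
rewrite -(cvg_lim _ cv) //; apply: lime_le; first by apply/cvg_ex; eexists; exact: cv.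
by apply: nearW => n; exact: Fa.
Qed.

Lemma nonincreasing_mu_small (F : nat -> set X) (e : R) :
  (forall n, meas (F n)) -> (forall n, F n.+1 `<=` F n) ->
  mu (\bigcap_n F n) = 0%E -> 0 < e -> exists N, forall n, (N <= n)%N -> (mu (F n) < e%:E)%E.
Proof.
move=> mF nF F0 e0.
have ni : nonincreasing_seq F.
  apply/nonincreasing_seqP => n; apply/subsetPset; exact: nF.
have cv := nonincreasing_cvg_mu (mu := mu) (le_lt_trans (mu_le1 (mF 0%N)) (ltry 1)) mF
  (meas_bigcap mF) ni.
rewrite F0 in cv; have /fine_cvgP [_ /cvgrPdist_lt /(_ e e0) [N _ hN]] := cv.
exists N => n /hN /=; rewrite sub0r normrN => h.
by rewrite -(fineK (mu_fin (mF n))) lte_fin; exact: le_lt_trans (ler_norm _) h.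
Qed.

Lemma meas_iter (f : X -> X) k A : continuous f -> meas A -> meas (iter k f @^-1` A).
Proof. by move=> cf; apply: meas_pre; exact: continuous_iter. Qed.

Lemma mu_iter (f : X -> X) k A : continuous f ->
  (forall B, meas B -> mu (f @^-1` B) = mu B) -> meas A ->
  mu (iter k f @^-1` A) = mu A.
Proof.
move=> cf finv mA; elim: k => [//|k IH].
rewrite -IH -[RHS]finv; last exact: meas_iter.
by congr (mu _); apply/seteqP; split=> x /=; rewrite -iterSr.
Qed.

Lemma nonincreasing_mu_cap (F : nat -> set X) : (forall n, meas (F n)) ->
  (forall n, F n.+1 `<=` F n) -> (forall n, mu (F n) = mu (F 0%N)) ->
  mu (\bigcap_n F n) = mu (F 0%N).
Proof.
move=> mF nF F0.
have ni : nonincreasing_seq F.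
  apply/nonincreasing_seqP => n; apply/subsetPset; exact: nF.
have cv := nonincreasing_cvg_mu (mu := mu) (le_lt_trans (mu_le1 (mF 0%N)) (ltry 1)) mF
  (meas_bigcap mF) ni.
rewrite -(cvg_lim _ cv) //; apply: (@lim_near_cst) => //.
by apply: nearW => n; exact: F0.
Qed.

(** The sets [G m] of points visiting [U] at some time at least [m] decrease, and
    [f^-1 (G m) = G m.+1], so they all have the same measure. Their intersection is invariant and of
    measure at least [mu U], hence of measure 1. *)
Lemma recurrence (f : X -> X) U : continuous f ->
  (forall B, meas B -> mu (f @^-1` B) = mu B) ->
  (forall B, meas B -> f @^-1` B = B -> mu B = 0%E \/ mu B = 1%E) ->
  open U -> (0 < mu U)%E ->
  mu [set x | exists k, U (iter k f x)] = 1%E.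
Proof.
move=> cf finv ferg oU U0.
pose G m := [set x | exists2 k, (m <= k)%N & U (iter k f x)].
have GS m : f @^-1` (G m) = G m.+1.
  apply/seteqP; split=> x /= [k mk Uk].
    by exists k.+1 => //; rewrite iterSr.
  by case: k mk Uk => // k mk Uk; exists k => //; rewrite -iterSr.
have mG m : meas (G m).
  have -> : G m = \bigcup_k (if (m <= k)%N then iter k f @^-1` U else set0).
    apply/seteqP; split=> x /= [k].
      by move=> mk Uk; exists k => //; rewrite mk.
    by move=> _; case: ifP => // mk Uk; exists k.
  apply: meas_bigcup => k; case: ifP => _; last exact: measurable0.
  by apply: meas_iter => //; exact: meas_open.
have G0 m : mu (G m) = mu (G 0%N).
  by elim: m => // m <-; rewrite -GS finv.
have GI := nonincreasing_mu_cap mG _ G0.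
have GD m : G m.+1 `<=` G m by move=> x [k mk Uk]; exists k => //; exact: ltnW.
have {GI} GI := GI GD.
have -> : [set x | exists k, U (iter k f x)] = G 0%N.
  by apply/seteqP; split=> x [k]; [move=> ?; exists k|move=> _ ?; exists k].
have Iinv : f @^-1` (\bigcap_n G n) = \bigcap_n G n.
  apply/seteqP; split=> x /= h n _.
    by apply: GD; rewrite -GS; exact: h.
  by have := h n.+1 I; rewrite -GS.
have [e0|<-] := ferg _ (meas_bigcap mG) Iinv; last by rewrite GI.
have : (mu U <= mu (G 0%N))%E.
  by apply: mu_mono => //; [exact: meas_open|move=> x Ux; exists 0%N].
by rewrite -GI e0 leNgt U0.
Qed.

(** The forward orbit [B 0] and its tail [B 1] have equal measure by invariance, so a nonperiodic
    point is null. A periodic orbit is finite and invariant; it cannot have full measure because its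
    complement is open and nonempty. *)
Lemma mu_point (f : X -> X) x : continuous f ->
  (forall B, meas B -> mu (f @^-1` B) = mu B) ->
  (forall B, meas B -> f @^-1` B = B -> mu B = 0%E \/ mu B = 1%E) ->
  (forall U, open U -> U !=set0 -> (0 < mu U)%E) -> injective f ->
  infinite_set [set: X] -> mu [set x] = 0%E.
Proof.
move=> cf finv ferg full fI Xinf.
pose B m := [set z | exists2 k, (m <= k)%N & iter k f x = z].
have mB m : meas (B m).
  have -> : B m = \bigcup_k (if (m <= k)%N then [set iter k f x] else set0).
    apply/seteqP; split=> z /= [k].
      by move=> mk <-; exists k => //; rewrite mk.
    by move=> _; case: ifP => // mk ->; exists k.
  apply: meas_bigcup => k; case: ifP => _; last exact: measurable0.
  exact: meas_set1.
have B01 : f @^-1` (B 1%N) = B 0%N.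
  apply/seteqP; split=> z /= [k].
    by case: k => // k _ /fI <-; exists k.
  by move=> _ <-; exists k.+1.
have mu01 : mu (B 0%N) = mu (B 1%N) by rewrite -B01 finv.
have B0E : B 0%N = [set x] `|` B 1%N.
  apply/seteqP; split=> z /=.
    by move=> [[|k] _ <-]; [left|right; exists k.+1].
  by move=> [->|[k _ <-]]; [exists 0%N|exists k].
have [[p p0 px]|nx] := pselect (B 1%N x); last first.
  have : mu (B 0%N) = (mu [set x] + mu (B 1%N))%E.
    rewrite B0E mu_setU //; first exact: meas_set1.
    by apply/seteqP; split=> z //= [-> ?].
  rewrite mu01 -(fineK (mu_fin (mB 1%N))) -(fineK (mu_fin (meas_set1 x))) -EFinD => -[e].
  by congr EFin; lra.
have B0 : f @^-1` (B 0%N) = B 0%N.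
  apply/seteqP; split=> z /= [k _].
    case: k => [|k] /= e; last by move/fI: e => <-; exists k.
    by case: p p0 px => // p _ /= px; exists p => //; apply: fI; rewrite px.
  by move=> <-; exists k.+1.
have finB : finite_set (B 0%N).
  apply: (sub_finite_set (B := (fun k => iter k f x) @` `I_p)); last first.
    by apply: finite_image; exact: finite_II.
  move=> z [k _ <-]; exists (k %% p)%N => /=; first by rewrite ltn_mod.
  rewrite {2}(divn_eq k p) addnC iterD; congr (iter _ f _).
  by elim: (k %/ p)%N => // q IH; rewrite mulSn iterD -IH.
have [e|e] := ferg _ (mB 0%N) B0.
  apply/eqP; rewrite -measure_le0 -e; apply: mu_mono => //; first exact: meas_set1.
  by move=> z ->; exists 0%N.
have cB : closed (B 0%N).
  by apply: compact_closed => //; exact: finite_compact.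
have oC : open (~` B 0%N) by rewrite openC.
have neC : ~` B 0%N !=set0.
  apply: contrapT => /set0P/negP; rewrite negbK => /eqP h.
  by apply: Xinf; rewrite -(setUCr (B 0%N)) h setU0.
have := full _ oC neC.
rewrite -(setIT (~` B 0%N)) -(mu_setI_full _ (mB 0%N) e) ?setIT; last first.
  exact: measC.
by rewrite setIC setICr measure0 ltxx.
Qed.

End BorelDynamics.

(** * Sums of nonnegative extended reals *)

Section WeightedSums.
Variables (R : realType).
Local Open Scope ereal_scope.

Lemma esum_swap (I J : choiceType) (D : set I) (F : set J) (a : I -> J -> \bar R) :
  (forall i j, 0 <= a i j) ->
  \esum_(i in D) \esum_(j in F) a i j = \esum_(j in F) \esum_(i in D) a i j.
Proof.
move=> a0; rewrite !esum_esum //.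
rewrite (@reindex_esum _ _ _ (F `*`` (fun=> D)) (D `*`` (fun=> F)) (fun p => (p.2, p.1))) //.
split.
- by move=> [j i] [/= Fj Di]; split.
- by move=> [j i] [j' i'] _ _ [-> ->].
- by move=> [i j] [/= Di Fj]; exists (j, i).
Qed.

(** One inequality holds on finite partial sums; applied to [a^-1] it yields the other. *)
Lemma esumZ (I : choiceType) (D : set I) (a : R) (f : I -> \bar R) :
  (0 <= a)%R -> (forall i, 0 <= f i) ->
  \esum_(i in D) (a%:E * f i) = a%:E * \esum_(i in D) f i.
Proof.
move=> a0 f0.
have le (b : R) (g : I -> \bar R) : (0 <= b)%R -> (forall i, 0 <= g i) ->
    \esum_(i in D) (b%:E * g i) <= b%:E * \esum_(i in D) g i.
  move=> b0 g0; apply: ub_ereal_sup => _ [A AD <-].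
  rewrite -ge0_mule_fsumr //; apply: lee_wpmul2l; first by rewrite lee_fin.
  by apply: esum_ge; exists A.
have [->|an0] := eqVneq a 0%R.
  by rewrite mul0e esum1 // => i _; rewrite mul0e.
apply/eqP; rewrite eq_le le //=.
have {1}-> : f = fun i => a^-1%:E * (a%:E * f i).
  by apply/funext => i; rewrite muleA -EFinM mulVf // mul1e.
apply: (@le_trans _ _ (a%:E * (a^-1%:E * \esum_(i in D) (a%:E * f i)))).
  apply: lee_wpmul2l; first by rewrite lee_fin.
  by apply: le; rewrite ?invr_ge0 // => i; rewrite mule_ge0 // lee_fin.
by rewrite muleA -EFinM divff // mul1e.
Qed.

Lemma esum_delta (I : choiceType) (D : set I) (u : I) (f : I -> \bar R) :
  D u -> 0 <= f u -> \esum_(v in D) (if v == u then f v else 0) = f u.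
Proof.
move=> Du fu; rewrite -[RHS]esum_set1 // [RHS]esum_mkcond [LHS]esum_mkcond.
apply: eq_esum => v _; rewrite in_set1.
case: eqVneq => [->|_]; first by rewrite mem_set.
by case: ifP.
Qed.

End WeightedSums.

(** * Measures of towers *)

Section TowerMeasure.
Variables (R : realType) (X : pseudoPMetricType R) (T Ti : X -> X).
Variable mu : {measure set (g_sigma_algebraType (@open X)) -> \bar R}.
Variables (y : X) (E : nat -> set X) (P : nat -> seq (set X)).
Hypothesis X_haus : hausdorff_space X.
Hypothesis X_inf : infinite_set [set: X].
Hypotheses (TK : cancel T Ti) (TiK : cancel Ti T).
Hypotheses (T_cont : continuous T) (Ti_cont : continuous Ti).
Hypothesis mu1 : mu [set: X] = 1%E.
Hypothesis mu_T : forall B : set (g_sigma_algebraType (@open X)),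
  measurable B -> mu (T @^-1` B) = mu B.
Hypothesis mu_erg : forall B : set (g_sigma_algebraType (@open X)),
  measurable B -> T @^-1` B = B -> mu B = 0%E \/ mu B = 1%E.
Hypothesis mu_full : forall U : set X, open U -> U !=set0 -> (0 < mu U)%E.
Hypothesis E_clopen : forall n, clopen (E n).
Hypothesis E_dec : forall n, E n.+1 `<=` E n.
Hypothesis E_cap : \bigcap_n E n = [set y].
Hypothesis P_clopen : forall n i, (i < size (P n))%N ->
  clopen (nth set0 (P n) i) /\ nth set0 (P n) i !=set0.
Hypothesis P_disj : forall n i j, (i < size (P n))%N -> (j < size (P n))%N -> i <> j ->
  nth set0 (P n) i `&` nth set0 (P n) j = set0.
Hypothesis P_cover : forall n x, ~ E n x <-> exists2 i, (i < size (P n))%N & nth set0 (P n) i x.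
Hypothesis P_refine : forall n B, memPE E P n.+1 B -> exists2 B', memPE E P n B' & B `<=` B'.

Local Notation Ws := (Wset T E P).
Local Notation V := (inV T E P).
Implicit Types (n m i j k l : nat) (w v : seq nat) (x z : X) (A : set X).

Let iterTK l x : iter l Ti (iter l T x) = x.
Proof. by elim: l x => // l IH x; rewrite iterSr iterS TK IH. Qed.

Let iterTiK l x : iter l T (iter l Ti x) = x.
Proof. by elim: l x => // l IH x; rewrite iterSr iterS TiK IH. Qed.

Let mu_Ti B : meas B -> mu (Ti @^-1` B) = mu B.
Proof.
move=> mB; rewrite -[LHS]mu_T; last exact: meas_pre.
by congr (mu _); apply/seteqP; split=> x /=; rewrite TK.
Qed.

Let mu_erg_Ti B : meas B -> Ti @^-1` B = B -> mu B = 0%E \/ mu B = 1%E.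
Proof.
move=> mB e; apply: mu_erg => //; rewrite -{1}e.
by apply/seteqP; split=> x /=; rewrite TK.
Qed.

Lemma E_meas n : meas (E n).
Proof. by apply: meas_open; case: (E_clopen n). Qed.

Lemma E_y n : E n y.
Proof. by have /seteqP [_ /(_ y erefl)] := E_cap; apply. Qed.

Lemma Wset_meas n w : meas (Ws n w).
Proof.
have -> : Ws n w = E n `&` (\bigcap_i (if (i < size w)%N
      then iter i.+1 T @^-1` nth set0 (P n) (nth 0%N w i) else setT))
    `&` iter (size w).+1 T @^-1` E n.
  apply/seteqP; split=> x.
    by move=> [Ex [h Ex']]; split=> //; split=> // i _; case: ifP => //; exact: h.
  move=> [[Ex h] Ex']; split=> //; split=> // i iw.
  by have := h i I; rewrite iw.
apply: measI; last by apply: meas_iter => //; exact: E_meas.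
apply: measI; first exact: E_meas.
apply: meas_bigcap => i; case: ifP => _; last exact: measurableT.
apply: meas_iter => //; have [iP|iP] := ltnP (nth 0%N w i) (size (P n)).
  by apply: meas_open; have [[]] := P_clopen iP.
by rewrite nth_default //; exact: measurable0.
Qed.

(** A sum weighted by the measures of the bases. For [f = wd] it is the total measure of the towers,
    so a bound proportional to [wd w] in each block gives a global bound. *)
Definition Sn n (f : seq nat -> R) : \bar R :=
  (\esum_(w in [set w | V n w]) (mu (Ws n w) * (f w)%:E))%E.

Let tower n w := [set x | exists2 l, (l < wd w)%N & Ws n w (iter l Ti x)].

Let tower_triv n : trivIset [set w | V n w] (tower n).
Proof.
move=> w w' _ _ [x [[l lw wx] [l' lw' wx']]].
have ne u u' k k' : Ws n u (iter k Ti x) -> Ws n u' (iter k' Ti x) -> (k' < wd u')%N ->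
    ~ (k < k')%N.
  move=> ux ux' kw kk; apply: (Wset_between P_disj P_cover ux' (i := k' - k)).
    by lia.
  have -> : iter (k' - k) T (iter k' Ti x) = iter k Ti x.
    by rewrite -{2}(subnK (ltnW kk)) iterD iterTiK.
  exact: Wset_start ux.
have e : l = l'.
  by have := ne _ _ _ _ wx wx' lw'; have := ne _ _ _ _ wx' wx lw; lia.
by rewrite -e in wx'; exact: (Wset_uniq P_disj P_cover wx wx').
Qed.

(** By recurrence for [T] and for [Ti], almost every point is in [E n] now or was there earlier, and
    returns to it strictly later; its latest visit up to now is the base point of its tower. *)
Let tower_cover n : mu (\bigcup_(w in [set w | V n w]) tower n w) = 1%E.
Proof.
have oE : open (E n) by case: (E_clopen n).
have E0 : (0 < mu (E n))%E by apply: mu_full => //; exists y; exact: E_y.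
pose A := [set x | exists k, E n (iter k T x)].
pose B := [set x | exists k, E n (iter k Ti x)].
have bigA (f : X -> X) : continuous f -> meas [set x | exists k, E n (iter k f x)].
  move=> cf; have -> : [set x | exists k, E n (iter k f x)] = \bigcup_k (iter k f @^-1` E n).
    by apply/seteqP; split=> x [k]; [exists k|move=> _ ?; exists k].
  by apply: meas_bigcup => k; apply: meas_iter => //; exact: E_meas.
have A1 : mu (T @^-1` A) = 1%E.
  by rewrite mu_T; [exact: (recurrence mu1 T_cont mu_T mu_erg oE E0)|exact: bigA].
have B1 : mu B = 1%E by exact: (recurrence mu1 Ti_cont mu_Ti mu_erg_Ti oE E0).
have mTA : meas (T @^-1` A) by apply: meas_pre => //; exact: bigA.
have mB : meas B by exact: bigA.
rewrite -(B1) -(mu_setI_full mu1 mB mTA A1); congr (mu _).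
apply/seteqP; split=> x.
  move=> [w _ [l lw wx]]; split; first by exists l; exact: Wset_start wx.
  exists (wd w - l.+1)%N; rewrite -iterSr -(iterTiK l x) -iterD.
  rewrite (_ : (wd w - l.+1).+1 + l = wd w)%N; last by lia.
  exact: Wset_end wx.
move=> [[l0 hl0] [k0 hk0]].
have exl : exists l, `[< E n (iter l Ti x) >] by exists l0; apply/asboolP.
case: (ex_minnP exl) => l /asboolP Exl lmin {l0 hl0}.
have hk : E n (iter (l + k0.+1) T (iter l Ti x)).
  by rewrite addnC iterD iterTiK iterSr.
have lk : (0 < l + k0.+1)%N by rewrite addnS.
have [w [wx wl]] := Wset_first_return P_disj P_cover Exl lk hk.
exists w; first exact: (Wset_inV P_disj wx).
exists l => //; rewrite ltnNge; apply/negP => wl'.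
have : E n (iter (l - wd w) Ti x).
  have -> : iter (l - wd w) Ti x = iter (wd w) T (iter l Ti x).
    by rewrite -{2}(subnKC wl') iterD iterTiK.
  exact: Wset_end wx.
by move/asboolP/lmin; have : (0 < wd w)%N by []; lia.
Qed.

(** Induction on the number [m] of floors: each floor has the measure of the base and lies either
    inside [A] or outside it. *)
Let mu_floors n w m A (a : nat -> bool) : meas A -> (m <= wd w)%N -> V n w ->
  (forall z l, Ws n w z -> (l < wd w)%N -> a l = `[< A (iter l T z) >]) ->
  mu (A `&` [set x | exists2 l, (l < m)%N & Ws n w (iter l Ti x)]) =
  (mu (Ws n w) * (\sum_(0 <= l < m) a l)%N%:R%:E)%E.
Proof.
move=> mA mw wV ha.
have mF k : meas (iter k Ti @^-1` Ws n w) by apply: meas_iter => //; exact: Wset_meas.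
have mFs k : meas [set x | exists2 l, (l < k)%N & Ws n w (iter l Ti x)].
  have -> : [set x | exists2 l, (l < k)%N & Ws n w (iter l Ti x)] =
      \bigcup_l (if (l < k)%N then iter l Ti @^-1` Ws n w else set0).
    apply/seteqP; split=> x /= [l]; first by move=> lk wl; exists l => //; rewrite lk.
    by move=> _; case: ifP => // lk wl; exists l.
  by apply: meas_bigcup => l; case: ifP => _ //; exact: measurable0.
elim: m mw => [|m IH] mw.
  rewrite big_geq // mule0 (_ : _ `&` _ = set0) ?measure0 //.
  by apply/seteqP; split=> x // [_ []].
rewrite big_nat_recr //= natrD EFinD ge0_muleDr ?lee_fin ?ler0n // -IH; last exact: ltnW.
have -> : A `&` [set x | exists2 l, (l < m.+1)%N & Ws n w (iter l Ti x)] =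
    (A `&` [set x | exists2 l, (l < m)%N & Ws n w (iter l Ti x)]) `|`
    (A `&` iter m Ti @^-1` Ws n w).
  rewrite -setIUr; congr (_ `&` _); apply/seteqP; split=> x /=.
    move=> [l]; rewrite ltnS leq_eqVlt => /orP[/eqP -> ?|lm wl]; first by right.
    by left; exists l.
  by move=> [[l lm wl]|wm]; [exists l => //; exact: ltnW|exists m].
rewrite mu_setU; last 3 first.
- exact: measI.
- exact: measI.
- apply/seteqP; split=> x // [[_ [l lm wl]] [_ wm]].
  apply: (Wset_between P_disj P_cover wm (i := m - l)); first by lia.
  have -> : iter (m - l) T (iter m Ti x) = iter l Ti x.
    by rewrite -{2}(subnK (ltnW lm)) iterD iterTiK.
  exact: Wset_start wl.
congr (_ + _)%E; case am : (a m) => /=.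
  rewrite mule1 -(mu_iter m Ti_cont mu_Ti (Wset_meas n w)); congr (mu _).
  apply/seteqP; split=> x; first by case.
  move=> wx; split=> //; have := ha _ _ wx mw; rewrite am iterTiK.
  by move=> e; apply/asboolP; rewrite -e.
rewrite mule0 (_ : _ `&` _ = set0) ?measure0 //.
apply/seteqP; split=> x // [Ax wx]; have := ha _ _ wx mw.
by rewrite am iterTiK; case: asboolP.
Qed.

(** A union of floors is measured by counting floors tower by tower, as the towers are disjoint and
    cover almost everything. [Sn_size], [Sn_one] and [mu_ancestors] are instances. *)
Lemma mu_saturated n A (F : seq nat -> nat) : meas A ->
  (forall w z z' l, Ws n w z -> Ws n w z' -> (l < wd w)%N ->
     A (iter l T z) -> A (iter l T z')) ->
  (forall w z, Ws n w z -> (\sum_(0 <= l < wd w) `[< A (iter l T z) >])%N = F w) ->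
  mu A = Sn n (fun w => (F w)%:R).
Proof.
move=> mA sat hF.
have mt w : meas (tower n w).
  have -> : tower n w = \bigcup_l (if (l < wd w)%N then iter l Ti @^-1` Ws n w else set0).
    apply/seteqP; split=> x /= [l]; first by move=> lk wl; exists l => //; rewrite lk.
    by move=> _; case: ifP => // lk wl; exists l.
  apply: meas_bigcup => l; case: ifP => _; last exact: measurable0.
  by apply: meas_iter => //; exact: Wset_meas.
have mbt : meas (\bigcup_(w in [set w | V n w]) tower n w).
  by apply: meas_bigcup_count => w _; exact: mt.
rewrite -(mu_setI_full mu1 mA mbt (tower_cover n)) setI_bigcupr.
rewrite mu_bigcup_count; last 2 first.
- by move=> w _; exact: measI mA (mt w).
- move=> w w' wV wV' [x [[_ xw] [_ xw']]].
  by apply: (tower_triv wV wV'); exists x.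
apply: eq_esum => w wV; have [_ [z wz]] := wV.
rewrite (mu_floors (a := fun l => `[< A (iter l T z) >])) //.
  by rewrite (hF _ _ wz).
by move=> z' l wz' lw; apply/asboolP/asboolP; first [exact: sat wz wz' lw | exact: sat wz' wz lw].
Qed.

Lemma Sn_size n : Sn n (fun w => (wd w)%:R) = 1%E.
Proof.
rewrite -mu1; apply/esym/mu_saturated => // [|w z _]; first exact: measurableT.
under eq_bigr do rewrite (asboolT I).
by rewrite sum_nat_const_nat muln1 subn0.
Qed.

Lemma Sn_one n : Sn n (fun w => 1) = mu (E n).
Proof.
apply/esym; rewrite (@mu_saturated n (E n) (fun=> 1%N)) //; first exact: E_meas.
  move=> w z z' l wz wz' lw /(E_cell P_disj P_cover) h; apply/(E_cell P_disj P_cover).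
  by rewrite -h; apply: (Wset_cell P_disj P_cover wz' wz (ltnW lw)).
move=> w z wz; rewrite big_ltn // big_nat big1 ?addn0.
  by rewrite asboolT //; exact: Wset_start wz.
by move=> i iw; rewrite asboolF //; exact: (Wset_between P_disj P_cover wz iw).
Qed.

(** The sets [E n] shrink to a point, and points are null. *)
Lemma mu_E_small (e : R) : 0 < e -> exists N, forall n, (N <= n)%N -> (mu (E n) < e%:E)%E.
Proof.
move=> e0; apply: (nonincreasing_mu_small mu1 E_meas E_dec) => //.
rewrite E_cap; apply: (mu_point X_haus mu1 y T_cont mu_T mu_erg mu_full) => //.
exact: can_inj TK.
Qed.

Lemma mu_ancestors n k v : 
  mu (Ws n v) = Sn (n + k) (fun w => (count_mem v (ancestors T E P n k w))%:R).
Proof.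
apply: (@mu_saturated (n + k)); first exact: Wset_meas.
  move=> w z z' l wz wz' lw wv.
  apply: (Wset_shift P_disj P_cover P_refine (leq_addr k n) wz wz' _ wv).
  exact: (tower_bound E_dec P_disj P_cover (leq_addr k n) wz lw wv).
by move=> w z wz; rewrite (count_ancestors E_dec P_disj P_cover P_refine v wz).
Qed.

Lemma Sn_le n f g : (forall w, V n w -> f w <= g w) -> (Sn n f <= Sn n g)%E.
Proof.
move=> fg; apply: le_esum => w wV.
by apply: lee_wpmul2l; [exact: measure_ge0|rewrite lee_fin fg].
Qed.

Lemma Sn_eq n f g : (forall w, V n w -> f w = g w) -> Sn n f = Sn n g.
Proof. by move=> fg; apply: eq_esum => w wV; rewrite fg. Qed.

Lemma Sn_ge0 n f : (forall w, 0 <= f w) -> (0 <= Sn n f)%E.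
Proof.
by move=> f0; apply: esum_ge0 => w _; rewrite mule_ge0 ?lee_fin //; exact: measure_ge0.
Qed.

Lemma SnD n f g : (forall w, 0 <= f w) -> (forall w, 0 <= g w) ->
  Sn n (fun w => f w + g w) = (Sn n f + Sn n g)%E.
Proof.
move=> f0 g0; rewrite /Sn -esumD.
- by apply: eq_esum => w _; rewrite EFinD ge0_muleDr ?lee_fin.
- by move=> w _; rewrite mule_ge0 ?lee_fin //; exact: measure_ge0.
- by move=> w _; rewrite mule_ge0 ?lee_fin //; exact: measure_ge0.
Qed.

Lemma SnZ n a f : 0 <= a -> (forall w, 0 <= f w) ->
  Sn n (fun w => a * f w) = (a%:E * Sn n f)%E.
Proof.
move=> a0 f0; rewrite /Sn -esumZ //; last first.
  by move=> w; rewrite mule_ge0 ?lee_fin //; exact: measure_ge0.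
by apply: eq_esum => w _; rewrite EFinM muleCA.
Qed.

(** Double counting: after the sums are exchanged, [mu_ancestors] turns the multiplicities of [v]
    into its mass. This makes the connecting maps isometric for the rank. *)
Lemma Sn_parents n (f : seq nat -> R) : (forall w, 0 <= f w) ->
  Sn n.+1 (fun w => \sum_(u <- parents T E P n w) f u) = Sn n f.
Proof.
move=> f0.
have mu0 m w : (0 <= mu (Ws m w))%E by exact: measure_ge0.
pose a w v := (mu (Ws n.+1 w) * (f v * (count_mem v (parents T E P n w))%:R)%:E)%E.
transitivity (\esum_(w in [set w | V n.+1 w]) \esum_(v in [set v | V n v]) a w v)%E.
  apply: eq_esum => w wV.
  transitivity (\esum_(v in [set v | V n v])
     \sum_(u <- parents T E P n w) (if v == u then mu (Ws n.+1 w) * (f v)%:E else 0))%E.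
    rewrite esum_sum; last by move=> v u _ _; case: ifP; rewrite ?mule_ge0 ?lee_fin.
    rewrite -sumEFin ge0_sume_distrr; last by move=> u _; rewrite lee_fin.
    rewrite big_seq [RHS]big_seq; apply: eq_bigr => u uw.
    rewrite (esum_delta (f := fun v => mu (Ws n.+1 w) * (f v)%:E)%E) ?mule_ge0 ?lee_fin //.
    exact: (parents_inV E_dec P_disj P_cover P_refine wV uw).
  apply: eq_esum => v _; rewrite /a; elim: (parents _ _ _ _ _) => [|u L IH].
    by rewrite big_nil /= mulr0 mule0.
  rewrite big_cons IH /= natrD mulrDr EFinD ge0_muleDr ?lee_fin ?mulr_ge0 ?ler0n //.
  congr (_ + _)%E; rewrite eq_sym; case: eqVneq => _; first by rewrite mulr1.
  by rewrite mulr0 mule0.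
rewrite esum_swap; last by move=> w v; rewrite mule_ge0 // lee_fin mulr_ge0.
apply: eq_esum => v _.
transitivity ((f v)%:E * \esum_(w in [set w | V n.+1 w])
    (mu (Ws n.+1 w) * (count_mem v (parents T E P n w))%:R%:E))%E.
  rewrite -esumZ //.
  by apply: eq_esum => w _; rewrite /a EFinM muleCA.
rewrite muleC; congr (_ * _)%E; rewrite (mu_ancestors n 1 v) addn1.
apply: Sn_eq => w _ /=; rewrite addn0; congr (_%:R).
by elim: (parents _ _ _ _ _) => //= u L ->.
Qed.

(** * The maximal inequality and convergence of frequencies in mean *)

Section Ergodicity.
Variables (n : nat) (v : seq nat).
Let muv : R := fine (mu (Ws n v)).
Let cnt k w := count_mem v (ancestors T E P n k w).

Let muvE : mu (Ws n v) = muv%:E.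
Proof. by rewrite fineK //; apply: (mu_fin mu1); exact: Wset_meas. Qed.

Let muv_ge0 : 0 <= muv.
Proof. by rewrite -lee_fin -muvE measure_ge0. Qed.

Let cnt_le k w : V (n + k) w -> (cnt k w <= wd w)%N.
Proof.
move=> [_ [z wz]]; rewrite /cnt (count_ancestors E_dec P_disj P_cover P_refine v wz).
rewrite (leq_trans (n := \sum_(0 <= l < wd w) 1)) //; first by apply: leq_sum => l _; exact: leq_b1.
by rewrite sum_nat_const_nat muln1 subn0.
Qed.

Variable r : R.
Hypothesis r_gt : muv < r.
Let r_gt0 : 0 < r. Proof. exact: le_lt_trans r_gt. Qed.

(** Towers in which the frequency of [v] is at least [r], a rate above its mean [muv]. *)
Let dense k w : bool := r * (wd w)%:R <= (cnt k w)%:R.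
Let U k := [set x | exists w, dense k w /\ exists2 l, (l < wd w)%N & Ws (n + k) w (iter l Ti x)].
Let A k := [set x | exists2 i, (i <= k)%N & U i x].

Let U_meas k : meas (U k).
Proof.
have -> : U k = \bigcup_(w in [set w | dense k w]) \bigcup_l
    (if (l < wd w)%N then iter l Ti @^-1` Ws (n + k) w else set0).
  apply/seteqP; split=> x /=.
    by move=> [w [dw [l lw wl]]]; exists w => //; exists l => //; rewrite lw.
  by move=> [w dw [l _]]; case: ifP => // lw wl; exists w; split=> //; exists l.
apply: meas_bigcup_count => w _; apply: meas_bigcup => l.
case: ifP => _; last exact: measurable0.
by apply: meas_iter => //; exact: Wset_meas.
Qed.

Let bigU_meas (Q : pred nat) : meas [set x | exists2 i, Q i & U i x].
Proof.
have -> : [set x | exists2 i, Q i & U i x] = \bigcup_i (if Q i then U i else set0).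
  apply/seteqP; split=> x /= [i]; first by move=> Qi Ux; exists i => //; rewrite Qi.
  by move=> _; case: ifP => // Qi Ux; exists i.
by apply: meas_bigcup => i; case: ifP => _; [exact: U_meas|exact: measurable0].
Qed.

(** A level [i] tower meeting a level [m] tower starts no lower than it, because the base of the
    latter lies in [E i]. *)
Let floor_base m i w w' z l l' : (i <= m)%N -> Ws m w z -> (l < wd w)%N -> (l' < wd w')%N ->
  Ws i w' (iter l' Ti (iter l T z)) ->
  [/\ (l' <= l)%N & forall x, iter l' Ti (iter l T x) = iter (l - l') T x].
Proof.
move=> im wz lw lw' wz'.
have ll : (l' <= l)%N.
  rewrite leqNgt; apply/negP => ll.
  apply: (Wset_between P_disj P_cover wz' (i := l' - l)); first by lia.
  have -> : iter (l' - l) T (iter l' Ti (iter l T z)) = z.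
    by rewrite -{2}(subnK (ltnW ll)) iterD iterTiK iterTK.
  exact: (E_anti E_dec im (Wset_start wz)).
by split=> // x; rewrite -{1}(subnKC ll) iterD iterTK.
Qed.

Let U_tower k w z l : Ws (n + k) w z -> (l < wd w)%N -> U k (iter l T z) <-> dense k w.
Proof.
move=> wz lw; split=> [[w' [dw' [l' lw' wz']]]|dw]; last first.
  by exists w; split=> //; exists l => //; rewrite iterTK.
have [ll e] := floor_base (leqnn _) wz lw lw' wz'.
rewrite e in wz'; have [h|h] := posnP (l - l').
  by rewrite h in wz'; rewrite (Wset_uniq P_disj P_cover wz wz').
case: (Wset_between P_disj P_cover wz (i := l - l')); first by lia.
exact: Wset_start wz'.
Qed.

(* The towers of levels between [n] and [n + k] are nested or disjoint, so the
   maximal dense ones among them tile [A k]. *)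
Let A_dense k w z : Ws (n + k) w z ->
  r * (\sum_(0 <= l < wd w) `[< A k (iter l T z) >])%N%:R <= (cnt k w)%:R.
Proof.
elim: k w z => [|k IH] w z wz.
  have [dw|ndw] := boolP (dense 0 w).
    apply: le_trans dw; rewrite ler_wpM2l ?(ltW r_gt0) // ler_nat.
    rewrite (leq_trans (n := \sum_(0 <= l < wd w) 1)) //; first by apply: leq_sum => l _; exact: leq_b1.
    by rewrite sum_nat_const_nat muln1 subn0.
  rewrite big_nat big1 ?mulr0 // => l lw; rewrite asboolF // => -[i].
  by rewrite leqn0 => /eqP -> /(U_tower wz lw) dw; rewrite dw in ndw.
have [dw|ndw] := boolP (dense k.+1 w).
  apply: le_trans dw; rewrite ler_wpM2l ?(ltW r_gt0) // ler_nat.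
  rewrite (leq_trans (n := \sum_(0 <= l < wd w) 1)) //; first by apply: leq_sum => l _; exact: leq_b1.
  by rewrite sum_nat_const_nat muln1 subn0.
have AE l : (l < wd w)%N -> A k.+1 (iter l T z) -> A k (iter l T z).
  move=> lw [i]; rewrite leq_eqVlt => /orP[/eqP ->|ik Ui]; last by exists i.
  by move=> /(U_tower wz lw) dw; rewrite dw in ndw.
apply: (@le_trans _ _ (r * (\sum_(0 <= l < wd w) `[< A k (iter l T z) >])%N%:R)).
  rewrite ler_wpM2l ?(ltW r_gt0) // ler_nat !big_mkord; apply: leq_sum => l _.
  case: (asboolP (A k.+1 _)) => // /AE h.
  by rewrite asboolT //; exact: h.
rewrite /cnt /= count_flatten sumnE !big_map [leRHS]natr_sum.
rewrite addnS in wz.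
pose Q j L := r * (\sum_(j <= l < wd w) `[< A k (iter l T z) >])%N%:R <=
  \sum_(u <- L) (cnt k u)%:R.
suff : Q 0%N (parents T E P (n + k) w) by [].
apply: (parents_ind E_dec P_disj P_cover P_refine (Q := Q) wz); rewrite /Q.
  by rewrite big_nil big_geq // mulr0.
move=> j u L ju uj _ _ IHL; rewrite big_cons.
rewrite (@big_cat_nat _ _ _ (j + wd u)) ?leq_addr //= natrD mulrDr lerD //.
rewrite (_ : \sum_(j <= l < j + wd u) _ =
  \sum_(0 <= l < wd u) `[< A k (iter l T (iter j T z)) >])%N; first exact: IH.
by rewrite -{1}[j]add0n big_addn addKn; apply: eq_bigr => l _; rewrite iterD.
Qed.

(** Towers of levels up to [n + k] are unions of floors of level [n + k], so [mu_saturated] applies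
    to [A k]. *)
Let A_sat k w z z' l : Ws (n + k) w z -> Ws (n + k) w z' -> (l < wd w)%N ->
  A k (iter l T z) -> A k (iter l T z').
Proof.
move=> wz wz' lw [i ik [w' [dw' [l' lw' wx]]]].
exists i => //; exists w'; split=> //; exists l' => //.
have nik : (n + i <= n + k)%N by rewrite leq_add2l.
have [ll e] := floor_base nik wz lw lw' wx.
rewrite !e in wx *.
apply: (Wset_shift P_disj P_cover P_refine nik wz wz' _ wx).
by apply: (tower_bound E_dec P_disj P_cover nik wz _ wx); lia.
Qed.

(** [A_dense] is summed over the towers of level [n + k]; the weighted sum of the counts is
    [muv]. *)
Let mu_A k : (mu (A k) <= (muv / r)%:E)%E.
Proof.
pose F w := (\sum_(0 <= l < wd w) `[< exists2 z, Ws (n + k) w z & A k (iter l T z) >])%N.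
have FE w z : Ws (n + k) w z -> (\sum_(0 <= l < wd w) `[< A k (iter l T z) >])%N = F w.
  move=> wz; rewrite /F !big_nat; apply: eq_bigr => l lw; congr nat_of_bool.
  apply/asboolP/asboolP; first by exists z.
  by move=> [z' wz' Az']; exact: A_sat wz' wz lw Az'.
rewrite (@mu_saturated (n + k) (A k) F) //; last first.
  by move=> w z z' l wz wz' lw; exact: A_sat wz wz' lw.
  exact: bigU_meas.
apply: (@le_trans _ _ (Sn (n + k) (fun w => r^-1 * (cnt k w)%:R))).
  apply: Sn_le => w [_ [z wz]]; rewrite ler_pdivlMl // -(FE _ _ wz).
  exact: A_dense.
rewrite SnZ ?invr_ge0 ?(ltW r_gt0) // -mu_ancestors muvE -EFinM lee_fin.
by rewrite mulrC.
Qed.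

Let Aoo : (mu (\bigcup_k A k) <= (muv / r)%:E)%E.
Proof.
apply: nondecreasing_mu_le => [k|k x [i ik Ui]|]; first exact: bigU_meas.
  by exists i => //; exact: leq_trans ik _.
exact: mu_A.
Qed.

Let NO := [set x | forall k, iter k T x <> y /\ iter k Ti x <> y].

Let NO_meas : meas NO /\ mu NO = 1%E.
Proof.
have y0 : mu [set y] = 0%E.
  exact: (mu_point X_haus mu1 y T_cont mu_T mu_erg mu_full (can_inj TK)).
have my := meas_set1 X_haus y.
have mk f k : continuous f -> meas (iter k f @^-1` [set y]).
  by move=> cf; exact: meas_iter.
have -> : NO = ~` (\bigcup_k (iter k T @^-1` [set y] `|` iter k Ti @^-1` [set y])).
  apply/seteqP; split=> x /=; first by move=> h [k _ [|]]; have [] := h k.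
  by move=> h k; split=> e; apply: h; exists k => //; [left|right].
have mO : meas (\bigcup_k (iter k T @^-1` [set y] `|` iter k Ti @^-1` [set y])).
  by apply: meas_bigcup => k; apply: measU; exact: mk.
split; first exact: measC.
have O0 : mu (\bigcup_k (iter k T @^-1` [set y] `|` iter k Ti @^-1` [set y])) = 0%E.
  apply: (measure_negligible mO); apply: negligible_bigcup => k.
  apply: negligibleU.
    exists (iter k T @^-1` [set y]); split; [exact: mk| |exact: subset_refl].
    exact: etrans (mu_iter k T_cont mu_T my) y0.
  exists (iter k Ti @^-1` [set y]); split; [exact: mk| |exact: subset_refl].
  exact: etrans (mu_iter k Ti_cont mu_Ti my) y0.
rewrite -mu1 -(setUCr (\bigcup_k (iter k T @^-1` [set y] `|` iter k Ti @^-1` [set y]))).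
by rewrite mu_setU ?setICr ?O0 ?add0e //; exact: measC.
Qed.

Let B N := [set x | exists2 i, (N <= i)%N & U i x].

(** If [T x] is outside [E (n + i)], it is not at the bottom of a tower of that level, so [x] and
    [T x] share their tower and belong to [U i] together. Off the orbit of [y] this holds for all
    large [i], whence invariance; full measure would contradict [Aoo], as [muv / r < 1]. *)
Let B_lim0 : mu (\bigcap_N B N) = 0%E.
Proof.
have [mNO NO1] := NO_meas.
have mB : meas (\bigcap_N B N) by apply: meas_bigcap => N; exact: bigU_meas.
rewrite -(mu_setI_full mu1 mB mNO NO1).
have inv : T @^-1` ((\bigcap_N B N) `&` NO) = (\bigcap_N B N) `&` NO.
  have UT i x : ~ E (n + i) (T x) -> U i (T x) <-> U i x.
    move=> nE; split=> -[w [dw [l lw wx]]]; exists w; split=> //.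
      case: l lw wx => [|l] lw wx; first by case: nE; exact: Wset_start wx.
      by exists l; [exact: ltnW|move: wx; rewrite iterSr TK].
    exists l.+1; last by rewrite iterSr TK.
    rewrite ltn_neqAle lw andbT; apply/eqP => e.
    by apply: nE; have := Wset_end wx; rewrite -e iterS iterTiK.
  have Ebig x : x <> y -> exists N, forall i, (N <= i)%N -> ~ E (n + i) x.
    move=> xy; apply: contrapT => h; apply: xy.
    have [+ _] : [/\ (\bigcap_n E n) x -> x = y & True] by rewrite E_cap.
    apply=> m _; apply: contrapT => nE; apply: h; exists m => i mi Ex.
    by apply: nE; apply: (E_anti E_dec _ Ex); lia.
  have NOT x : NO x <-> NO (T x).
    split=> h k; split.
    - by rewrite -iterSr; have [] := h k.+1.
    - case: k => [|k]; first by have [] := h 1%N.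
      by rewrite iterSr TK; have [] := h k.
    - case: k => [|k]; last by rewrite iterSr; have [] := h k.
      by have [_] := h 1%N; rewrite /= TK.
    - have [_] := h k.+1; by rewrite iterSr TK.
  apply/seteqP; split=> x /= [Bx NOx].
    have {}NOx := (NOT x).2 NOx; split=> // N _.
    have [|M hM] := Ebig (T x); first by have [] := NOx 1%N.
    have [i Mi Ui] := Bx (maxn N M) I.
    by exists i; [lia|apply/(UT i x) => //; apply: hM; lia].
  have NOx' := (NOT x).1 NOx; split=> // N _.
  have [|M hM] := Ebig (T x); first by have [] := NOx 1%N.
  have [i Mi Ui] := Bx (maxn N M) I.
  by exists i; [lia|apply/(UT i x) => //; apply: hM; lia].
have [//|e] := mu_erg (measI mB mNO) inv.
have : (mu ((\bigcap_N B N) `&` NO) <= (muv / r)%:E)%E.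
  apply: le_trans Aoo; apply: mu_mono; first exact: measI.
    by apply: meas_bigcup => k; exact: bigU_meas.
  by move=> x [/(_ 0%N I) [i _ Ui] _]; exists i => //; exists i.
by rewrite e lee_fin ler_pdivlMr // mul1r leNgt r_gt.
Qed.

(** The dense towers of level [n + k] make up [U k], which is contained in the sets [B N] shrinking
    to a null set. *)
Let dense_small (e : R) : 0 < e -> exists N, forall k, (N <= k)%N ->
  (Sn (n + k) (fun w => (dense k w * wd w)%:R) < e%:E)%E.
Proof.
move=> e0.
have mB N : meas (B N) by exact: bigU_meas.
have [|N hN] := nonincreasing_mu_small mu1 mB _ B_lim0 e0.
  by move=> N x [i Ni Ui]; exists i => //; exact: ltnW.
exists N => k kN; rewrite -(@mu_saturated (n + k) (U k)).
- apply: le_lt_trans (hN k kN); apply: mu_mono => // x Ux.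
  by exists k.
- exact: U_meas.
- by move=> w z z' l wz wz' lw /(U_tower wz lw) h; apply/(U_tower wz' lw).
- move=> w z wz; rewrite big_nat (eq_bigr (fun=> nat_of_bool (dense k w))).
    by rewrite -big_nat sum_nat_const_nat subn0 mulnC.
  move=> l /andP[_ lw]; congr nat_of_bool.
  by apply/asboolP/idP => /(U_tower wz lw).
Qed.

(** Dense towers contribute at most their total measure, all others at most [r - muv] per floor. *)
Lemma excess_small_aux (e : R) : 0 < e -> exists N, forall k, (N <= k)%N ->
  (Sn (n + k) (fun w => Num.max 0 ((cnt k w)%:R - muv * (wd w)%:R))%R <= (r - muv + e)%:E)%E.
Proof.
move=> /dense_small [N hN]; exists N => k /hN h.
apply: (@le_trans _ _ (Sn (n + k) (fun w => (r - muv) * (wd w)%:R + (dense k w * wd w)%:R)%R)).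
  apply: Sn_le => w wV; rewrite ge_max; apply/andP; split.
    by rewrite addr_ge0 // mulr_ge0 // subr_ge0 ltW.
  have := cnt_le wV; rewrite -(ler_nat R) => c.
  case: (boolP (dense k w)) => dw; rewrite ?mul1n ?mul0n.
    have : 0 <= r * (wd w)%:R by rewrite mulr_ge0 ?(ltW r_gt0).
    by rewrite mulrBl; lra.
  by move: dw; rewrite /dense -ltNge mulrBl; lra.
rewrite SnD => //; last by move=> w; rewrite mulr_ge0 // subr_ge0 ltW.
rewrite SnZ ?subr_ge0 ?(ltW r_gt) // Sn_size mule1 [leRHS]EFinD leeD2l //.
exact: ltW.
Qed.

End Ergodicity.

Lemma excess_small n v (e : R) : 0 < e -> exists N, forall k, (N <= k)%N ->
  (Sn (n + k) (fun w => Num.max 0 ((count_mem v (ancestors T E P n k w))%:R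
     - fine (mu (Ws n v)) * (wd w)%:R))%R < e%:E)%E.
Proof.
move=> e0.
have e3 : 0 < e / 3 by rewrite divr_gt0.
(* The threshold exceeds the mean by [e / 3], and the dense towers cost another [e / 3]. *)
have [|N hN] := @excess_small_aux n v (fine (mu (Ws n v)) + e / 3) _ _ e3.
  by rewrite ltrDl.
exists N => k /hN /le_lt_trans; apply; rewrite lte_fin; lra.
Qed.

(* Since the mean of the counts is exactly [mu (Ws n v)], the deficiency has the
   same weighted sum as the excess. *)
Lemma deficiency_small n v (e : R) : 0 < e -> exists N, forall k, (N <= k)%N ->
  (Sn (n + k) (fun w => Num.max 0 (fine (mu (Ws n v)) * (wd w)%:R -
     (count_mem v (ancestors T E P n k w))%:R))%R < e%:E)%E.
Proof.
move=> /(excess_small n v) [N hN]; exists N => k /hN.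
set m := fine _.
have mE : mu (Ws n v) = m%:E by rewrite fineK //; apply: (mu_fin mu1); exact: Wset_meas.
have m0 : 0 <= m by rewrite -lee_fin -mE measure_ge0.
pose cn w : R := (count_mem v (ancestors T E P n k w))%:R.
pose f w := Num.max 0 (cn w - m * (wd w)%:R).
pose g w := Num.max 0 (m * (wd w)%:R - cn w).
have f0 w : 0 <= f w by rewrite le_max lexx.
have g0 w : 0 <= g w by rewrite le_max lexx.
have eq : (Sn (n + k) f + m%:E = Sn (n + k) g + m%:E)%E.
  have <- : Sn (n + k) (fun w => m * (wd w)%:R) = m%:E.
    by rewrite SnZ // Sn_size mule1.
  rewrite -SnD //; last by move=> w; rewrite mulr_ge0.
  have -> : Sn (n + k) (fun w => m * (wd w)%:R) = Sn (n + k) cn.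
    by rewrite SnZ // Sn_size mule1 -mE (mu_ancestors n k).
  rewrite -SnD //; apply: Sn_eq => w _; rewrite /f /g /Num.max.
  by case: ltP => h1; case: ltP => h2; lra.
move=> h; suff -> : Sn (n + k) g = Sn (n + k) f by exact: h.
by move/eqP: eq; rewrite eq_sym => /eqP /(congr1 (fun t => t - m%:E)%E); rewrite !addeK.
Qed.

(** The interface between dynamics and algebra: the isomorphism and the regularity use topology,
    fullness and ergodicity only through these facts. *)
Record tower_theory : Prop := TowerTheory {
  tt_fin : forall n v, mu (Ws n v) \is a fin_num;
  tt_size : forall n, Sn n (fun w => (wd w)%:R) = 1%E;
  tt_base_small : forall e : R, 0 < e ->
    exists N, forall n, (N <= n)%N -> (Sn n (fun=> 1%R) < e%:E)%E;
  tt_parents : forall n (f : seq nat -> R), (forall w, 0 <= f w) ->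
    Sn n.+1 (fun w => \sum_(u <- parents T E P n w) f u) = Sn n f;
  tt_count : forall n k v,
    mu (Ws n v) = Sn (n + k) (fun w => (count_mem v (ancestors T E P n k w))%:R);
  tt_deficiency : forall n v (e : R), 0 < e -> exists N, forall k, (N <= k)%N ->
    (Sn (n + k) (fun w => Num.max 0 (fine (mu (Ws n v)) * (wd w)%:R -
     (count_mem v (ancestors T E P n k w))%:R))%R < e%:E)%E;
  tt_parents_size : forall n w, V n.+1 w -> dsz wd (parents T E P n w) = wd w;
  tt_parents_inV : forall n w v, V n.+1 w -> v \in parents T E P n w -> V n v;
  tt_jblk : forall (K : fieldType) n (x : blk K) w a b, V n.+1 w ->
    jblk T E P n x w a b = dg wd x (parents T E P n w) a b;
  tt_ancestors_size : forall n k w, V (n + k) w -> dsz wd (ancestors T E P n k w) = wd w;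
  tt_ancestors_inV : forall n k w v, V (n + k) w -> v \in ancestors T E P n k w -> V n v
}.

Lemma towers : tower_theory.
Proof.
split.
- by move=> n v; apply: (mu_fin mu1); exact: Wset_meas.
- exact: Sn_size.
- by move=> e /mu_E_small [N hN]; exists N => n /hN; rewrite Sn_one.
- exact: Sn_parents.
- exact: mu_ancestors.
- exact: deficiency_small.
- exact: (parents_size E_dec P_disj P_cover P_refine).
- exact: (parents_inV E_dec P_disj P_cover P_refine).
- by move=> K n x w a b; exact: (jblkE E_dec P_disj P_cover P_refine).
- exact: (ancestors_size E_dec P_disj P_cover P_refine).
- exact: (ancestors_inV E_dec P_disj P_cover P_refine).
Qed.

End TowerMeasure.

(** * The two directed systems *)

Section RankDistance.
Variables (K : fieldType) (c : K -> K).
Hypothesis c_inv : field_involution c.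
Implicit Types (f g h : mel K) (D : nat).

Lemma involution0 : c 0 = 0.
Proof. by have [cD _ _] := c_inv; apply: (addrI (c 0)); rewrite -cD !addr0. Qed.

Lemma involution1 : c 1 = 1.
Proof.
have [_ cM cK] := c_inv.
have c1 : c 1 != 0.
  by apply/eqP => e; have := cK 1; rewrite e involution0 => /eqP; rewrite eq_sym oner_eq0.
by apply: (mulfI c1); rewrite -cM !mulr1.
Qed.

Definition dm D f g := rkf D (msub f g).

Lemma dm0 D f g : meq D f g -> dm D f g = 0%N.
Proof. by move=> fg; apply: rkf0 => a b aD bD; rewrite /msub /madd /mopp fg // subrr. Qed.

Lemma dm_sym D f g : dm D f g = dm D g f.
Proof. by rewrite /dm -rkfN /rkf mxsqN !mxsqB opprB. Qed.

Lemma dm_tri D f g h : (dm D f h <= dm D f g + dm D g h)%N.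
Proof.
rewrite /dm /rkf (_ : mxsq D (msub f h) = mxsq D (msub f g) + mxsq D (msub g h)).
  exact: mxrank_add.
by rewrite !mxsqB subrKA.
Qed.

Lemma dm_D D f g f' g' : (dm D (madd f f') (madd g g') <= dm D f g + dm D f' g')%N.
Proof.
rewrite /dm /rkf (_ : mxsq D (msub _ _) = mxsq D (msub f g) + mxsq D (msub f' g')).
  exact: mxrank_add.
by rewrite !mxsqB !mxsqD opprD addrACA.
Qed.

Lemma dm_M D f g f' g' :
  (dm D (mmul D f f') (mmul D g g') <= dm D f g + dm D f' g')%N.
Proof.
rewrite /dm /rkf (_ : mxsq D (msub _ _) =
  mxsq D (msub f g) *m mxsq D f' + mxsq D g *m mxsq D (msub f' g')).
  by rewrite (leq_trans (mxrank_add _ _)) // leq_add ?mxrankM_maxl ?mxrankM_maxr.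
by rewrite !mxsqB !mxsqM mulmxBl mulmxBr subrKA.
Qed.

Lemma dm_Z D a f g : (dm D (mscale a f) (mscale a g) <= dm D f g)%N.
Proof.
by rewrite /dm /rkf mxsqB !mxsqZ -scalerBr -mxsqB mxrank_scale.
Qed.

Lemma dm_star D f g : dm D (mstar c f) (mstar c g) = dm D f g.
Proof.
have [cD _ _] := c_inv.
have cN u : c (- u) = - c u by apply: (addrI (c u)); rewrite -cD !subrr involution0.
rewrite /dm -(rkf_star _ (msub f g) c_inv); congr (rkf _ _).
by apply/funext => a; apply/funext => b; rewrite /msub /madd /mopp /mstar cD cN.
Qed.

Lemma mmulA D f g h : meq D (mmul D f (mmul D g h)) (mmul D (mmul D f g) h).
Proof. by apply/mxsqE; rewrite !mxsqM mulmxA. Qed.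

Lemma mmul1 D f : meq D (mmul D (@mone K) f) f.
Proof. by apply/mxsqE; rewrite mxsqM mxsq1 mul1mx. Qed.

Lemma mmulx1 D f : meq D (mmul D f (@mone K)) f.
Proof. by apply/mxsqE; rewrite mxsqM mxsq1 mulmx1. Qed.

Lemma mstarK f : mstar c (mstar c f) = f.
Proof. by have [_ _ cK] := c_inv; apply/funext => a; apply/funext => b; rewrite /mstar cK. Qed.

Lemma mstarD f g : mstar c (madd f g) = madd (mstar c f) (mstar c g).
Proof. by have [cD _ _] := c_inv; apply/funext => a; apply/funext => b; rewrite /mstar /madd cD. Qed.

Lemma mstarM D f g : mstar c (mmul D f g) = mmul D (mstar c g) (mstar c f).
Proof.
have [cD cM _] := c_inv; apply/funext => a; apply/funext => b.
rewrite /mstar /mmul (big_morph c cD involution0).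
by apply: eq_bigr => l _; rewrite cM mulrC.
Qed.

Lemma mstarZ a f : mstar c (mscale a f) = mscale (c a) (mstar c f).
Proof. by have [_ cM _] := c_inv; apply/funext => i; apply/funext => j; rewrite /mstar /mscale cM. Qed.

Lemma mstar1 : mstar c (@mone K) = @mone K.
Proof.
apply/funext => a; apply/funext => b; rewrite /mstar /mone [a == b]eq_sym.
by case: (b == a); [exact: involution1|exact: involution0].
Qed.

Lemma dg_one (B : Type) (d : B -> nat) (L : seq B) :
  meq (dsz d L) (dg d (fun=> @mone K) L) (@mone K).
Proof.
elim: L => [|v L IH] /=; first by move=> a b; rewrite /dsz big_nil.
rewrite dsz_cons; apply/mxsqE; rewrite mxsq_bl !mxsq1 scalar_mx_block.
by move/mxsqE: IH; rewrite mxsq1 => ->.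
Qed.

End RankDistance.

(** * The dyadic matrix system *)

Section MatrixSystem.
Variables (K : fieldType) (R : realType) (c : K -> K).
Hypothesis c_inv : field_involution c.

Definition rM n (x : mel K) : R := (rkf (2 ^ n) x)%:R / (2 ^ n)%:R.

Lemma mliftE n (x : mel K) : meq (2 ^ n.+1) (mlift n x) (bl (2 ^ n) x x).
Proof.
move=> a b aD bD; rewrite blE /mlift aD bD /=.
by case: (ltnP a _) => ha; case: (ltnP b _) => hb //=.
Qed.

Lemma rM_le n x y z : (rkf (2 ^ n) x <= rkf (2 ^ n) y + rkf (2 ^ n) z)%N ->
  rM n x <= rM n y + rM n z.
Proof.
move=> h; rewrite /rM -mulrDl ler_pM2r ?invr_gt0 ?ltr0n ?expn_gt0 //.
by rewrite -natrD ler_nat.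
Qed.

Lemma rM_eq n x y : rkf (2 ^ n) x = rkf (2 ^ n) y -> rM n x = rM n y.
Proof. by rewrite /rM => ->. Qed.

Lemma rM_0 n x y : meq (2 ^ n) x y -> rM n (msub x y) = 0.
Proof. by move=> /dm0; rewrite /rM /dm => ->; rewrite mul0r. Qed.

Lemma rank_system_MK : rank_system c (S := MK_sys R c) rM.
Proof.
have c0 := involution0 c_inv.
have e2 n : (2 ^ n.+1 = 2 ^ n + 2 ^ n)%N by rewrite expnS mul2n addnn.
split=> //.
- by move=> n x; apply: rM_0.
- by move=> n x y; apply: rM_eq; exact: dm_sym.
- by move=> n x y z; apply: rM_le; exact: dm_tri.
- move=> n x y; rewrite -[LHS]/(rM n.+1 (msub (mlift n x) (mlift n y))).
  rewrite (@rM_eq _ _ (bl (2 ^ n) (msub x y) (msub x y))); last first.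
    apply: rkf_eq => a b aD bD; rewrite /msub /madd /mopp !mliftE // !blE.
    by case: (ltnP a _); case: (ltnP b _) => //; rewrite subrr.
  rewrite -[RHS]/(rM n (msub x y)) /rM e2 rkf_bl !natrD.
  have : (2 ^ n)%:R != 0 :> R by rewrite pnatr_eq0 -lt0n expn_gt0.
  by move=> h; field; rewrite h /= -mulr2n mulrn_eq0 negb_or h.
- by move=> n x y x' y'; apply: rM_le; exact: dm_D.
- by move=> n x y x' y'; apply: rM_le; exact: dm_M.
- move=> n a x y; rewrite -[leRHS]addr0 -[X in _ + X](@rM_0 n x x) //.
  by apply: rM_le; apply: leq_trans (leq_addr _ _); exact: dm_Z.
- move=> n x y; rewrite le_eqVlt; apply/orP; left; apply/eqP.
  by apply: rM_eq; exact: dm_star.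
- move=> n x y; apply: rM_0 => a b aD bD; rewrite /= !mliftE // !blE.
  by case: (ltnP a _); case: (ltnP b _) => //; rewrite addr0.
- move=> n x y; apply: rM_0.
  suff : meq (2 ^ n.+1) (mlift n (mmul (2 ^ n) x y))
    (mmul (2 ^ n.+1) (mlift n x) (mlift n y)) by [].
  have E (z : mel K) : mxsq (2 ^ n + 2 ^ n) (mlift n z) = mxsq (2 ^ n + 2 ^ n) (bl (2 ^ n) z z).
    by apply/mxsqE; rewrite -e2; exact: (@mliftE n z).
  rewrite e2; apply/mxsqE; rewrite mxsqM !E !mxsq_bl mulmx_block.
  by rewrite !mulmx0 !mul0mx !addr0 !add0r -mxsqM.
- move=> n k x; apply: rM_0 => a b aD bD; rewrite /= !mliftE // !blE.
  by case: (ltnP a _); case: (ltnP b _) => //; rewrite mulr0.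
- move=> n x; apply: rM_0 => a b aD bD; rewrite /= !mliftE // !blE.
  by case: (ltnP a _); case: (ltnP b _) => //; rewrite c0.
- move=> n; apply: rM_0 => a b aD bD; rewrite /= !mliftE // !blE.
  case: (ltnP a _) => ha; case: (ltnP b _) => hb //.
  + by case: eqP => // e; lia.
  + by case: eqP => // e; lia.
  + by rewrite eqn_sub2rE.
- by move=> n x y z; apply: rM_0; exact: mmulA.
- by move=> n x; apply: rM_0; exact: mmul1.
- by move=> n x; apply: rM_0; exact: mmulx1.
- by move=> n x; apply: rM_0 => a b _ _; exact: (congr1 (fun f => f a b) (mstarK c_inv x)).
- by move=> n x y; apply: rM_0 => a b _ _; exact: (congr1 (fun f => f a b) (mstarD c_inv x y)).
- by move=> n x y; apply: rM_0 => a b _ _; exact: (congr1 (fun f => f a b) (mstarM c_inv _ x y)).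
- by move=> n k x; apply: rM_0 => a b _ _; exact: (congr1 (fun f => f a b) (mstarZ c_inv k x)).
- by move=> n; apply: rM_0 => a b _ _; exact: (congr1 (fun f => f a b) (mstar1 c_inv)).
Qed.

(** The iterated connecting map repeats a single block; hence the label type [unit]. *)
Lemma dup_MK n k :
  hform (fun=> 2 ^ n)%N (2 ^ (n + k)) (nseq (2 ^ k) tt)
    (fun x : unit -> mel K => dup (S := MK_sys R c) n k (x tt)).
Proof.
split; first by rewrite dsz_nseq expnD mulnC.
exists id; first exact: pbij_id.
move=> x; elim: k => [|k IH] /=.
  rewrite addn0 => a b aD bD.
  by rewrite /conjf blE aD bD.
move=> a b; rewrite addnS => aD bD; rewrite mliftE //.
have -> : (2 ^ k.+1 = 2 ^ k + 2 ^ k)%N by rewrite expnS mul2n addnn.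
rewrite nseqD /conjf dg_cat /=.
have -> : dsz (fun=> 2 ^ n)%N (nseq (2 ^ k) tt) = (2 ^ (n + k))%N.
  by rewrite dsz_nseq expnD mulnC.
move: a b aD bD; apply: meq_bl => //; first by rewrite leq_exp2l.
by rewrite expnS mul2n -addnn addnK.
Qed.

End MatrixSystem.

(** * The system of tower blocks *)

Section TowerSystem.
Variables (K : fieldType) (R : realType) (c : K -> K).
Hypothesis c_inv : field_involution c.
Variables (X : pseudoPMetricType R) (T : X -> X).
Variables (E : nat -> set X) (P : nat -> seq (set X)).
Variable mu : {measure set (g_sigma_algebraType (@open X)) -> \bar R}.
Hypothesis H : tower_theory T mu E P.

Local Notation V := (inV T E P).
Local Notation Rs := (R_sys c T E P mu).
Local Notation S_ := (Sn T mu E P).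
Implicit Types (n k : nat) (w v : seq nat) (x y z : blk K).

(** [fine] loses nothing: each rank is at most [wd w], and these have weighted sum 1. *)
Definition rR n x : R := fine (S_ n (fun w => (rkf (wd w) (x w))%:R)).

Lemma Sn_fin n f (a : R) : (forall w, 0 <= f w) -> 0 <= a ->
  (forall w, V n w -> f w <= a * (wd w)%:R) -> S_ n f \is a fin_num.
Proof.
move=> f0 a0 fa; rewrite ge0_fin_numE; last exact: Sn_ge0.
apply: (@le_lt_trans _ _ (S_ n (fun w => a * (wd w)%:R))); first exact: Sn_le.
by rewrite SnZ // (tt_size H) mule1 ltry.
Qed.

Lemma rRE n x : (rR n x)%:E = S_ n (fun w => (rkf (wd w) (x w))%:R).
Proof.
rewrite fineK //; apply: (@Sn_fin _ _ 1) => // w _.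
by rewrite mul1r ler_nat rkf_le.
Qed.

Lemma rR_le n x y z :
  (forall w, V n w -> (rkf (wd w) (x w) <= rkf (wd w) (y w) + rkf (wd w) (z w))%N) ->
  rR n x <= rR n y + rR n z.
Proof.
move=> h; rewrite -lee_fin EFinD !rRE -SnD //.
by apply: Sn_le => w wV; rewrite -natrD ler_nat h.
Qed.

Lemma rR_eq n x y : (forall w, V n w -> rkf (wd w) (x w) = rkf (wd w) (y w)) ->
  rR n x = rR n y.
Proof. by move=> h; congr fine; apply: Sn_eq => w /h ->. Qed.

Definition bsub x y : blk K := fun w => msub (x w) (y w).

Lemma rR_0 n x y : (forall w, V n w -> meq (wd w) (x w) (y w)) -> rR n (bsub x y) = 0.
Proof.
move=> h; apply: EFin_inj; rewrite rRE; transitivity (S_ n (fun=> 0 * 0)).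
  by apply: Sn_eq => w /h /dm0; rewrite /dm /bsub mulr0 => ->.
by rewrite SnZ // mul0e.
Qed.

Lemma jblk_meq n x w : V n.+1 w ->
  meq (wd w) (jblk T E P n x w) (dg wd x (parents T E P n w)).
Proof. by move=> wV a b _ _; exact: (tt_jblk H). Qed.

Lemma rank_system_R : rank_system c (S := Rs) rR.
Proof.
have c0 := involution0 c_inv.
split.
- by move=> n x; rewrite rRE.
- by move=> n x; apply: rR_0.
- by move=> n x y; apply: rR_eq => w _; exact: dm_sym.
- by move=> n x y z; apply: rR_le => w _; exact: dm_tri.
- move=> n x y; rewrite -[LHS]/(rR n.+1 (bsub (jblk T E P n x) (jblk T E P n y))).
  rewrite -[RHS]/(rR n (bsub x y)); apply: EFin_inj; rewrite !rRE.
  rewrite -[RHS](tt_parents H) //; apply: Sn_eq => w wV.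
  rewrite -natr_sum -(rkf_dg wd (bsub x y)) (tt_parents_size H wV); congr (_%:R).
  apply: rkf_eq => a b aD bD.
  rewrite /bsub /msub /madd /mopp !jblk_meq // -[RHS]/(dg wd (bsub x y) _ a b).
  by rewrite /bsub /msub dgD dgN.
- by move=> n x y x' y'; apply: rR_le => w _; exact: dm_D.
- by move=> n x y x' y'; apply: rR_le => w _; exact: dm_M.
- move=> n a x y; rewrite -[leRHS]addr0 -[X in _ + X](@rR_0 n x x) //.
  by apply: rR_le => w _; apply: leq_trans (leq_addr _ _); exact: dm_Z.
- move=> n x y; rewrite le_eqVlt; apply/orP; left; apply/eqP.
  by apply: rR_eq => w _; exact: dm_star.
- move=> n x y; apply: rR_0 => w wV a b aD bD.
  rewrite [LHS]jblk_meq // -[LHS]/(dg wd (fun w => madd (x w) (y w)) _ a b) dgD.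
  by rewrite /madd /= !jblk_meq.
- move=> n x y; apply: rR_0 => w wV a b aD bD.
  rewrite [LHS]jblk_meq // -[LHS]/(dg wd (fun w => mmul (wd w) (x w) (y w)) _ a b).
  rewrite dgM (tt_parents_size H wV) //=.
  by apply: eq_bigr => l _; rewrite !jblk_meq.
- move=> n k x; apply: rR_0 => w wV a b aD bD.
  rewrite [LHS]jblk_meq // -[LHS]/(dg wd (fun w => mscale k (x w)) _ a b) dgZ.
  by rewrite /mscale /= !jblk_meq.
- move=> n x; apply: rR_0 => w wV a b aD bD.
  rewrite [LHS]jblk_meq // -[LHS]/(dg wd (fun w => mstar c (x w)) _ a b) dg_star //.
  by rewrite /mstar /= !jblk_meq.
- move=> n; apply: rR_0 => w wV a b aD bD.
  rewrite [LHS]jblk_meq // -[LHS]/(dg wd (fun=> @mone K) _ a b) dg_one //;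
    by rewrite (tt_parents_size H wV).
- by move=> n x y z; apply: rR_0 => w _; exact: mmulA.
- by move=> n x; apply: rR_0 => w _; exact: mmul1.
- by move=> n x; apply: rR_0 => w _; exact: mmulx1.
- move=> n x; apply: rR_0 => w _ a b _ _.
  exact: (congr1 (fun f => f a b) (mstarK c_inv (x w))).
- move=> n x y; apply: rR_0 => w _ a b _ _.
  exact: (congr1 (fun f => f a b) (mstarD c_inv (x w) (y w))).
- move=> n x y; apply: rR_0 => w _ a b _ _.
  exact: (congr1 (fun f => f a b) (mstarM c_inv (wd w) (x w) (y w))).
- move=> n k x; apply: rR_0 => w _ a b _ _.
  exact: (congr1 (fun f => f a b) (mstarZ c_inv k (x w))).
- move=> n; apply: rR_0 => w _ a b _ _.
  exact: (congr1 (fun f => f a b) (mstar1 c_inv)).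
Qed.

(** Composing the placements along [parents] gives the placement along [ancestors]. *)
Lemma dup_R n k w : V (n + k) w ->
  hform wd (wd w) (ancestors T E P n k w) (fun x => dup (S := Rs) n k x w).
Proof.
elim: k w => [|k IH] w wV /=.
  split; first by rewrite dsz_cons [dsz _ _]big_nil addn0.
  exists id; first exact: pbij_id.
  by move=> x a b aD bD; rewrite /conjf /= blE aD bD.
rewrite addnS in wV.
rewrite -(tt_parents_size H wV).
apply: (@hform_meq _ _ _ _ _ (fun x => dg wd (dup (S := Rs) n k x) (parents T E P (n + k) w))).
  by move=> x; rewrite (tt_parents_size H wV); exact: jblk_meq.
apply: hform_flatten => v vw; apply: IH.
exact: (tt_parents_inV H wV (In_mem vw)).
Qed.

End TowerSystem.

(** * The approximate intertwining *)

(* Block lists that do not fill the whole diagonal are completed by the label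
   [None], which stands for a zero block of size 1. *)
Section OptionLabels.
Variables (K : fieldType) (B : Type) (d : B -> nat).
Implicit Types (x y : B -> mel K).

Definition od (o : option B) : nat := if o is Some v then d v else 1%N.
Definition ox x (o : option B) : mel K := if o is Some v then x v else @mzero K.

Lemma oxD x y : ox (fun v => madd (x v) (y v)) = fun o => madd (ox x o) (ox y o).
Proof.
apply/funext => -[v|] //; apply/funext => a; apply/funext => b.
by rewrite /madd /= /mzero addr0.
Qed.

Lemma oxZ k x : ox (fun v => mscale k (x v)) = fun o => mscale k (ox x o).
Proof.
apply/funext => -[v|] //; apply/funext => a; apply/funext => b.
by rewrite /mscale /= /mzero mulr0.
Qed.

Lemma oxM x y : ox (fun v => mmul (d v) (x v) (y v)) = fun o => mmul (od o) (ox x o) (ox y o).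
Proof.
apply/funext => -[v|] //; apply/funext => a; apply/funext => b.
by rewrite /mmul /= big1 // => l _; rewrite /mzero mulr0.
Qed.

Lemma ox_star (c : K -> K) x : c 0 = 0 ->
  ox (fun v => mstar c (x v)) = fun o => mstar c (ox x o).
Proof.
by move=> c0; apply/funext => -[v|] //; apply/funext => a; apply/funext => b;
  rewrite /mstar /= /mzero c0.
Qed.

Lemma dsz_map_Some L : dsz od (map Some L) = dsz d L.
Proof. by rewrite /dsz big_map. Qed.

Lemma hform_Some D L h : hform d D L h ->
  hform od D (map Some L) (fun x : option B -> mel K => h (fun v => x (Some v))).
Proof.
move=> [e [s sP hs]]; split; first by rewrite dsz_map_Some.
exists s => // x; suff -> : dg od x (map Some L) = dg d (fun v => x (Some v)) L by exact: hs.
by elim: L {e hs} => //= v L ->.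
Qed.

End OptionLabels.

Lemma sum_count (B : eqType) (F : B -> nat) (L s : seq B) : uniq s -> {subset L <= s} ->
  (\sum_(v <- L) F v = \sum_(v <- s) count_mem v L * F v)%N.
Proof.
move=> us; elim: L => [|u L IH] Ls /=; first by rewrite big_nil big1.
rewrite big_cons IH; last by move=> v vL; apply: Ls; rewrite inE vL orbT.
under [RHS]eq_bigr do rewrite mulnDl.
rewrite big_split /=; congr (_ + _)%N.
rewrite (bigD1_seq u) ?Ls ?mem_head //= eqxx mul1n big1 ?addn0 // => v.
by rewrite eq_sym => /negbTE ->.
Qed.

Section Counting.
Variables (B : eqType).

Definition somes (L : seq (option B)) := undup (pmap id L).

Lemma mem_somes (L : seq (option B)) v : (v \in somes L) = (Some v \in L).
Proof. by rewrite mem_undup mem_pmap map_id. Qed.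

Lemma sum_somes (F : option B -> nat) (L L' : seq (option B)) : {subset L' <= L} ->
  (\sum_(o <- L') F o = count_mem None L' * F None +
     \sum_(v <- somes L) count_mem (Some v) L' * F (Some v))%N.
Proof.
move=> LL; have u : uniq (None :: map Some (somes L)).
  rewrite /= map_inj_uniq ?undup_uniq ?andbT; last by move=> ? ? [].
  by apply/mapP => -[].
rewrite (sum_count F u) ?big_cons ?big_map // => -[v|] vL; rewrite inE //=.
by apply/map_f; rewrite mem_somes LL.
Qed.

Lemma count_flatten_map (B' : eqType) (F : B' -> seq B) (L' : seq B') v :
  count_mem v (flatten (map F L')) = (\sum_(u <- L') count_mem v (F u))%N.
Proof. by rewrite count_flatten sumnE !big_map. Qed.

End Counting.

(** * Construction of the intertwining maps *)

Section Intertwiners.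
Variables (K : fieldType) (R : realType) (c : K -> K).
Hypothesis c_inv : field_involution c.
Variables (X : pseudoPMetricType R) (T : X -> X).
Variables (E : nat -> set X) (P : nat -> seq (set X)).
Variable mu : {measure set (g_sigma_algebraType (@open X)) -> \bar R}.
Hypothesis H : tower_theory T mu E P.

Local Notation V := (inV T E P).
Local Notation Rs := (R_sys c T E P mu).
Local Notation Ms := (MK_sys R c).
Local Notation S_ := (Sn T mu E P).
Local Notation rR := (rR T E P mu).
Local Notation rM := (rM R).
Implicit Types (n k m : nat) (w v : seq nat) (e : R).

Definition mass n v : R := fine (mu (Wset T E P n v)).

Lemma massE n v : mu (Wset T E P n v) = (mass n v)%:E.
Proof. by rewrite fineK // (tt_fin H). Qed.

Lemma mass_ge0 n v : 0 <= mass n v.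
Proof. by rewrite -lee_fin -massE measure_ge0. Qed.

Lemma mass_sum_le n (s : seq (seq nat)) (f : seq nat -> R) : uniq s ->
  {in s, forall v, V n v} -> (forall v, 0 <= f v) ->
  ((\sum_(v <- s) mass n v * f v)%:E <= S_ n f)%E.
Proof.
move=> us sV f0; apply: esum_ge; exists [set` s].
  by split; [exact: finite_seq|move=> v vs; exact: sV].
rewrite -fsbig_seq // -sumEFin le_eqVlt; apply/orP; left; apply/eqP.
by rewrite big_seq [RHS]big_seq; apply: eq_bigr => v _; rewrite massE EFinM.
Qed.

(** [V n] may be infinite; finitely many words already carry all but [e] of the measure. *)
Lemma mass_sum_approx n e : 0 < e -> exists s : seq (seq nat),
  [/\ uniq s, {in s, forall v, V n v} & 1 - e <= \sum_(v <- s) mass n v * (wd v)%:R].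
Proof.
move=> e0.
have : ((1 - e)%:E < S_ n (fun w => (wd w)%:R))%E.
  by rewrite (tt_size H) lte_fin ltrBlDr ltrDl.
move=> /ereal_sup_gt [_ [F [fF FV] <-]] h.
have [s eF] := (finite_seqP _).1 fF.
have eF' : F = [set` undup s].
  by rewrite eF; apply/seteqP; split=> v /=; rewrite mem_undup.
have sV : {in undup s, forall v, V n v}.
  by move=> v vs; apply: FV; rewrite eF'.
exists (undup s); split=> //; first exact: undup_uniq.
rewrite -lee_fin ltW // (lt_le_trans h) // eF' -fsbig_seq ?undup_uniq // -sumEFin.
rewrite le_eqVlt; apply/orP; left; apply/eqP.
by rewrite big_seq [RHS]big_seq; apply: eq_bigr => v _; rewrite massE EFinM.
Qed.

(** A choice of blocks filling a matrix of size [2 ^ m]. The bound on multiplicities makes the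
    placement rank contracting; the labels [None] are the zero padding. *)
Definition good_list e n m (L : seq (option (seq nat))) :=
  [/\ dsz (od wd) L = (2 ^ m)%N, (forall v, Some v \in L -> V n v),
    (forall v, (count_mem (Some v) L)%:R <= (2 ^ m)%:R * mass n v)
  & (count_mem None L)%:R <= e * (2 ^ m)%:R].

(** Omitted words cost at most a proportion [e / 2] of the diagonal. Rounding down loses at most one
    copy of each chosen word, [W] coordinates in all, which is below [e / 2 * 2 ^ m] for large
    [m]. *)
Lemma good_list_ex e n : 0 < e -> exists m0, forall m, (m0 <= m)%N ->
  exists L, good_list e n m L.
Proof.
move=> e0; have e2 : 0 < e / 2 by rewrite divr_gt0.
have [s [us sV hs]] := mass_sum_approx n e2.
pose W : R := \sum_(v <- s) (wd v)%:R.
have W0 : 0 <= W by apply: sumr_ge0.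
exists (Num.bound (W / (e / 2))) => m mM.
pose a v := Num.truncn ((2 ^ m)%:R * mass n v).
have m0 v : 0 <= (2 ^ m)%:R * mass n v by rewrite mulr_ge0 ?mass_ge0.
have a_le v : (a v)%:R <= (2 ^ m)%:R * mass n v by have /andP[] := truncn_itv (m0 v).
have a_gt v : (2 ^ m)%:R * mass n v - 1 <= (a v)%:R.
  have /andP[_ /ltW] := truncn_itv (m0 v); rewrite -natr1 -/(a v); lra.
pose N := (\sum_(v <- s) a v * wd v)%N.
have NE : N%:R = \sum_(v <- s) (a v)%:R * (wd v)%:R :> R.
  by rewrite natr_sum; apply: eq_bigr => v _; rewrite natrM.
have mass1 : \sum_(v <- s) mass n v * (wd v)%:R <= 1.
  by rewrite -lee_fin -(tt_size H n); apply: mass_sum_le.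
have N_le : (N <= 2 ^ m)%N.
  rewrite -(ler_nat R) NE -[leRHS]mulr1; apply: le_trans (ler_wpM2l (ler0n _ _) mass1).
  rewrite mulr_sumr; apply: ler_sum => v _; rewrite mulrA ler_wpM2r //.
pose L := flatten [seq nseq (a v) (Some v) | v <- s] ++ nseq (2 ^ m - N)%N None.
have cS v : count_mem (Some v) L = if v \in s then a v else 0%N.
  rewrite count_cat count_flatten_map count_nseq mul0n addn0.
  case: ifPn => vs.
    rewrite (bigD1_seq v) //= count_nseq /= eqxx mul1n big1 ?addn0 // => u uv.
    by rewrite count_nseq /= -[Some u == _]/(u == v) (negbTE uv).
  rewrite big_seq big1 // => u us'; rewrite count_nseq /= -[Some u == _]/(u == v).
  by case: eqP vs => // <-; rewrite us'.
have cN : count_mem None L = (2 ^ m - N)%N.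
  rewrite count_cat count_flatten_map count_nseq mul1n big1 // => u _.
  by rewrite count_nseq.
exists L; split.
- rewrite dsz_cat dsz_nseq muln1 /dsz big_flatten big_map.
  under eq_bigr => v _ do rewrite -/(dsz _ _) dsz_nseq.
  by rewrite -/N subnKC.
- move=> v vL; apply: sV; apply: contraLR vL => vs.
  by rewrite -has_pred1 has_count cS (negbTE vs).
- by move=> v; rewrite cS; case: ifP.
- rewrite cN natrB // NE.
  have h1 : \sum_(v <- s) ((2 ^ m)%:R * mass n v - 1) * (wd v)%:R <=
      \sum_(v <- s) (a v)%:R * (wd v)%:R.
    by apply: ler_sum => v _; rewrite ler_wpM2r.
  have h2 : \sum_(v <- s) ((2 ^ m)%:R * mass n v - 1) * (wd v)%:R =
      (2 ^ m)%:R * (\sum_(v <- s) mass n v * (wd v)%:R) - W.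
    by rewrite mulr_sumr -sumrB; apply: eq_bigr => v _; rewrite mulrBl mul1r mulrA.
  have h3 : (2 ^ m)%:R * (1 - e / 2) <= (2 ^ m)%:R * (\sum_(v <- s) mass n v * (wd v)%:R).
    exact: ler_wpM2l.
  have h4 : W <= e / 2 * (2 ^ m)%:R.
    rewrite mulrC -ler_pdivrMr //.
    apply: le_trans (ltW (archi_boundP _)) _; first by rewrite divr_ge0 // ltW.
    by rewrite ler_nat (leq_trans mM) // ltnW // ltn_expl.
  by rewrite h2 in h1; lra.
Qed.

Definition d2 m : option unit -> nat := od (fun=> 2 ^ m)%N.
Definition fill m D : seq (option unit) :=
  nseq (D %/ 2 ^ m) (Some tt) ++ nseq (D %% 2 ^ m) None.

Lemma fill_size m D : dsz (d2 m) (fill m D) = D.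
Proof. by rewrite dsz_cat !dsz_nseq muln1 -divn_eq. Qed.

Definition spread (g : seq nat -> (option unit -> mel K) -> mel K) (x : mel K) : blk K :=
  fun w => g w (ox (fun=> x)).

(** The rank of the difference is at most the sum over the labels, which the multiplicity bound
    turns into [2 ^ m] times a partial sum of the rank over [V n]. *)
Lemma phi_contract e n m L h (x y : blk K) : good_list e n m L ->
  hform (od wd) (2 ^ m) L h ->
  rM m (msub (h (ox x)) (h (ox y))) <= rR n (bsub x y).
Proof.
move=> [_ LV Lm _] hh; rewrite /rM ler_pdivrMr ?ltr0n ?expn_gt0 //.
pose F o := rkf (od wd o) (msub (ox x o) (ox y o)).
apply: (@le_trans _ _ (\sum_(o <- L) F o)%N%:R); first by rewrite ler_nat; exact: hform_sub.
rewrite (sum_somes F (L := L)) //.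
have -> : F None = 0%N.
  by apply: rkf0 => a b _ _; rewrite /msub /madd /mopp /= subrr.
rewrite muln0 add0n natr_sum mulrC.
apply: (@le_trans _ _ ((2 ^ m)%:R * \sum_(v <- somes L) mass n v * (F (Some v))%:R)).
  rewrite mulr_sumr; apply: ler_sum => v _.
  by rewrite natrM mulrA ler_wpM2r.
apply: ler_wpM2l => //; rewrite -lee_fin (rRE H).
apply: (@mass_sum_le n _ (fun v => (F (Some v))%:R)) => //; first exact: undup_uniq.
by move=> v; rewrite mem_somes => /LV.
Qed.

(** Block [w] receives at most [wd w / 2 ^ m] copies, and the sizes [wd w] have weighted sum 1. *)
Lemma psi_contract n m g (x y : mel K) :
  (forall w, V n w -> hform (d2 m) (wd w) (fill m (wd w)) (g w)) ->
  rR n (bsub (spread g x) (spread g y)) <= rM m (msub x y).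
Proof.
move=> hg; rewrite -lee_fin (rRE H).
apply: (@le_trans _ _ (S_ n (fun w => rM m (msub x y) * (wd w)%:R))); last first.
  by rewrite SnZ ?(tt_size H) ?mule1 // /rM divr_ge0.
apply: Sn_le => w wV.
apply: (@le_trans _ _ ((wd w %/ 2 ^ m) * rkf (2 ^ m) (msub x y))%N%:R).
  rewrite ler_nat; apply: leq_trans (hform_sub _ _ (hg w wV)) _.
  rewrite -[X in (X <= _)%N]/(dsz (fun o => rkf (d2 m o)
    (msub (ox (fun=> x) o) (ox (fun=> y) o))) (fill m (wd w))) dsz_cat !dsz_nseq.
  rewrite [X in (_ + _ * X)%N]rkf0 ?muln0 ?addn0 // => a b _ _.
  by rewrite /msub /madd /mopp /= subrr.
rewrite /rM mulrAC natrM mulrC -mulrA ler_wpM2l //.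
rewrite ler_pdivlMr ?ltr0n ?expn_gt0 // -natrM ler_nat; exact: leq_trunc_div.
Qed.

Lemma step_lift e1 e2 n m g M : 0 < e2 ->
  (forall w, V n w -> hform (d2 m) (wd w) (fill m (wd w)) (g w)) ->
  (S_ n (fun w => (wd w %% 2 ^ m)%:R) <= e1%:E)%E ->
  exists m' L h, [/\ (M <= m')%N /\ (m < m')%N, good_list e2 n m' L,
    hform (od wd) (2 ^ m') L h
    & forall x, rM m' (msub (h (ox (spread g x))) (dup (S := Ms) m (m' - m) x)) <= e1 + e2].
Proof.
move=> e20 hg hr; have [m0 hm0] := good_list_ex n e20.
pose m' := maxn m.+1 (maxn m0 M); have mm' : (m < m')%N by rewrite leq_maxl.
have [|L hL] := hm0 m'; first by rewrite /m'; lia.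
have [Lsz LV Lm LN] := hL.
pose Lb (b : option (seq nat)) := if b is Some w then fill m (wd w) else [:: None].
pose hb (xo : option unit -> mel K) (b : option (seq nat)) :=
  if b is Some w then g w xo else xo None.
have F1 : hform (d2 m) (2 ^ m') (flatten (map Lb L)) (fun xo => dg (od wd) (hb xo) L).
  rewrite -Lsz; apply: hform_flatten => -[w|] /In_mem bL; first exact: hg (LV _ bL).
  split; first by rewrite dsz_cons [dsz _ _]big_nil.
  exists id; first exact: pbij_id.
  by move=> xo a b aD bD; rewrite /conjf /= blE aD bD.
have F2 : hform (d2 m) (2 ^ m') (map Some (nseq (2 ^ (m' - m)) tt))
    (fun xo => dup (S := Ms) m (m' - m) (xo (Some tt))).
  by have := hform_Some (dup_MK R c m (m' - m)); rewrite subnKC // ltnW.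
have [C [D1 [D2 [p1 p2 hC]]]] :=
  common_sublist (flatten (map Lb L)) (map Some (nseq (2 ^ (m' - m)) tt)).
have [s sP hs] := hform_match F1 F2 p1 p2.
(* The permutation aligning the composite with the connecting map becomes part of the new map. *)
exists m', L, (fun xo => conjf s (dg (od wd) xo L)); split=> //.
- by split=> //; rewrite /m'; lia.
- by apply: hform_conj => //; rewrite -Lsz; exact: hform_dg.
move=> x; rewrite /rM ler_pdivrMr ?ltr0n ?expn_gt0 //.
have -> : dg (od wd) (ox (spread g x)) L = dg (od wd) (hb (ox (fun=> x))) L.
  by congr dg; apply/funext => -[].
apply: (@le_trans _ _ (dsz (d2 m) D1)%:R); first by rewrite ler_nat; exact: hs.
have cSome : count_mem (Some tt) D1 = 0%N.
  have : (count_mem (Some tt) (flatten (map Lb L)) <= 2 ^ (m' - m))%N.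
    have p2m : (0 < 2 ^ m)%N by rewrite expn_gt0.
    suff : (count_mem (Some tt) (flatten (map Lb L)) * 2 ^ m <= 2 ^ (m' - m) * 2 ^ m)%N.
      by rewrite leq_pmul2r.
    rewrite -expnD subnK; last exact: ltnW.
    rewrite -[leqRHS]F1.1 /dsz (sum_somes _ (L := flatten (map Lb L))) //.
    have [tL|tL] := boolP (Some tt \in flatten (map Lb L)); last first.
      by rewrite (count_memPn tL) mul0n.
    rewrite (bigD1_seq tt) ?undup_uniq ?mem_somes //=; exact: leq_trans (leq_addr _ _) (leq_addl _ _).
  have := permP p1 (pred1 (Some tt)); rewrite count_cat hC.
  rewrite [X in minn _ X](_ : _ = 2 ^ (m' - m))%N.
    by move=> h hle; move: h; rewrite (minn_idPl hle); lia.
  by rewrite map_nseq count_nseq /= mul1n.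
have -> : dsz (d2 m) D1 = count_mem None D1.
  rewrite /dsz (sum_somes _ (L := D1)) // muln1 big1 ?addn0 // => -[] _.
  by rewrite cSome.
apply: (@le_trans _ _ (count_mem None (flatten (map Lb L)))%:R).
  by rewrite ler_nat (permP p1 (pred1 None)) count_cat leq_addl.
rewrite count_flatten_map (sum_somes _ (L := L)) //= muln1 natrD addrC mulrDl lerD //.
apply: (@le_trans _ _ (\sum_(v <- somes L) (2 ^ m')%:R * (mass n v * (wd v %% 2 ^ m)%:R))).
  rewrite natr_sum; apply: ler_sum => v _.
  rewrite /fill count_cat !count_nseq /= mul0n add0n mul1n natrM mulrA.
  exact: ler_wpM2r.
rewrite -mulr_sumr mulrC ler_wpM2r // -lee_fin; apply: le_trans hr.
apply: (@mass_sum_le n _ (fun v => (wd v %% 2 ^ m)%:R)) => //; first exact: undup_uniq.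
by move=> v; rewrite mem_somes => /LV.
Qed.

Lemma deficiency_sum n (s : seq (seq nat)) e : 0 < e -> exists N, forall k, (N <= k)%N ->
  (S_ (n + k) (fun w => \sum_(v <- s) (wd v)%:R * Num.max 0 (mass n v * (wd w)%:R -
     (count_mem v (ancestors T E P n k w))%:R))%R < e%:E)%E.
Proof.
elim: s e => [|v s IH] e e0.
  exists 0%N => k _; rewrite (_ : S_ _ _ = 0%E) ?lte_fin //.
  transitivity (S_ (n + k) (fun=> 0 * 0)); last by rewrite SnZ // mul0e.
  by apply: Sn_eq => w _; rewrite big_nil mulr0.
have e2 : 0 < e / 2 by rewrite divr_gt0.
have [N1 h1] := IH _ e2.
have e3 : 0 < e / 2 / (wd v)%:R by rewrite divr_gt0.
have [N2 h2] := tt_deficiency H n v e3.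
exists (maxn N1 N2) => k; rewrite geq_max => /andP[/h1 {}h1 /h2 {}h2].
pose f w : R := Num.max 0 (mass n v * (wd w)%:R - (count_mem v (ancestors T E P n k w))%:R).
have f0 w : 0 <= f w by rewrite le_max lexx.
have -> : S_ (n + k) (fun w => \sum_(u <- v :: s) (wd u)%:R * Num.max 0 (mass n u * (wd w)%:R -
     (count_mem u (ancestors T E P n k w))%:R))%R =
  S_ (n + k) (fun w => (wd v)%:R * f w + \sum_(u <- s) (wd u)%:R * Num.max 0 (mass n u * (wd w)%:R -
     (count_mem u (ancestors T E P n k w))%:R))%R.
  by apply: Sn_eq => w _; rewrite big_cons.
rewrite SnD; last 2 first.
- by move=> w; rewrite mulr_ge0.
- by move=> w; apply: sumr_ge0 => u _; rewrite mulr_ge0 // le_max lexx.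
rewrite SnZ // (splitr e) EFinD lteD //.
by rewrite -lte_pdivlMl // -EFinM mulrC.
Qed.

Lemma sum_fill (F : option unit -> nat) m D :
  (\sum_(o <- fill m D) F o = D %/ 2 ^ m * F (Some tt) + D %% 2 ^ m * F None)%N.
Proof. by rewrite -[LHS]/(dsz F _) dsz_cat !dsz_nseq. Qed.

(** In block [w] the composite holds at most [mass n v * wd w] copies of [v], so those not matched
    by an ancestor are bounded by the deficiency of [v] in [w], small in mean for the finitely many
    [v] in [L]. Zeros come from the padding of [L], a proportion [e], and from fewer than [2 ^ m]
    left-over coordinates per block, small in mean because [mu (E n')] tends to 0. *)
Lemma step_ancestors e e' n m L h M : 0 <= e -> 0 < e' -> good_list e n m L ->
  hform (od wd) (2 ^ m) L h ->
  exists n' g, [/\ (M <= n')%N /\ (n < n')%N,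
    forall w, V n' w -> hform (d2 m) (wd w) (fill m (wd w)) (g w),
    (S_ n' (fun w => (wd w %% 2 ^ m)%:R) <= e'%:E)%E
    & forall x, rR n' (bsub (spread g (h (ox x))) (dup (S := Rs) n (n' - n) x)) <= e + e'].
Proof.
move=> e0 e'0 [Lsz LV Lm LN] hh.
have e2 : 0 < e' / 2 by rewrite divr_gt0.
have p2 : 0 < (2 ^ m)%:R :> R by rewrite ltr0n expn_gt0.
have e3 : 0 < e' / 2 / (2 ^ m)%:R by rewrite divr_gt0.
have [N1 hN1] := tt_base_small H e3.
have [N2 hN2] := deficiency_sum n (somes L) e2.
have [k [kN1 kN2 kM k0]] : exists k,
    [/\ (N1 <= n + k)%N, (N2 <= k)%N, (M <= n + k)%N & (0 < k)%N].
  by exists (maxn (maxn N1 N2) M).+1; split; lia.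
pose n' := (n + k)%N.
have base : (S_ n' (fun=> ((2 ^ m)%:R * 1)%R) <= (e' / 2)%:E)%E.
  rewrite SnZ // -lee_pdivlMl // -EFinM mulrC; exact/ltW/hN1.
pose cnt v w := count_mem v (ancestors T E P n k w).
pose bound w : R := e * (wd w)%:R + ((2 ^ m)%:R * 1 +
  \sum_(v <- somes L) (wd v)%:R * Num.max 0 (mass n v * (wd w)%:R - (cnt v w)%:R)).
have q_le w : (wd w %/ 2 ^ m)%:R * (2 ^ m)%:R <= (wd w)%:R :> R.
  by rewrite -natrM ler_nat leq_trunc_div.
have /choice [t ht] : forall w, exists t, V n' w -> pbij (wd w) t /\ forall x,
    (rkf (wd w) (msub (conjf t (dg (d2 m) (ox (fun=> h (ox x))) (fill m (wd w))))
       (dup (S := Rs) n k x w)))%:R <= bound w.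
  move=> w; have [wV|nwV] := pselect (V n' w); last by exists id.
  pose Lb (b : option unit) := if b is Some _ then L else [:: None].
  pose hb (xo : option (seq nat) -> mel K) (b : option unit) :=
    if b is Some _ then h xo else xo None.
  have F1 : hform (od wd) (wd w) (flatten (map Lb (fill m (wd w))))
      (fun xo => dg (d2 m) (hb xo) (fill m (wd w))).
    rewrite -{1}(fill_size m (wd w)); apply: hform_flatten => -[u|] _ //.
    split; first by rewrite dsz_cons [dsz _ _]big_nil.
    exists id; first exact: pbij_id.
    by move=> xo a b aD bD; rewrite /conjf /= blE aD bD.
  have F2 := hform_Some (dup_R c H wV).
  have [C [D1 [D2 [p1 p2' hC]]]] := common_sublist (flatten (map Lb (fill m (wd w))))
    (map Some (ancestors T E P n k w)).
  have [s sP hs] := hform_match F1 F2 p1 p2'.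
  exists s => _; split=> // x.
  have -> : dg (d2 m) (ox (fun=> h (ox x))) (fill m (wd w)) =
            dg (d2 m) (hb (ox x)) (fill m (wd w)).
    by congr dg; apply/funext => -[].
  apply: (@le_trans _ _ (dsz (od wd) D1)%:R); first by rewrite ler_nat; exact: hs.
  have cL1 o : count_mem o (flatten (map Lb (fill m (wd w)))) =
      (wd w %/ 2 ^ m * count_mem o L + wd w %% 2 ^ m * (None == o))%N.
    by rewrite count_flatten_map sum_fill /= addn0.
  have D1L : {subset D1 <= None :: L}.
    move=> [v|] vD //; rewrite inE /= -has_pred1 has_count.
    have h0 : (0 < count_mem (Some v) D1)%N by rewrite -has_count has_pred1.
    have := cL1 (Some v); rewrite (permP p1) count_cat /= muln0 addn0 => h1.
    rewrite lt0n; apply/eqP => z; move: h1; rewrite z muln0 => /eqP.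
    by rewrite addn_eq0 => /andP[_ /eqP z']; rewrite z' in h0.
  rewrite /dsz (sum_somes _ D1L) /= muln1.
  have cNone : (count_mem None D1)%:R <= e * (wd w)%:R + (2 ^ m)%:R :> R.
    apply: (@le_trans _ _ (wd w %/ 2 ^ m * count_mem None L + wd w %% 2 ^ m)%N%:R).
      rewrite ler_nat; have := cL1 None; rewrite (permP p1) count_cat /= muln1; lia.
    rewrite natrD lerD //; last by rewrite ler_nat ltnW // ltn_pmod // expn_gt0.
    rewrite natrM; apply: (@le_trans _ _ ((wd w %/ 2 ^ m)%:R * (e * (2 ^ m)%:R))).
      exact: ler_wpM2l.
    by rewrite mulrCA ler_wpM2l.
  rewrite natrD /bound addrA mulr1 lerD // natr_sum.
  apply: ler_sum => v _; rewrite natrM mulrC ler_wpM2l //.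
  have cD1 : (count_mem (Some v) D1 + minn (wd w %/ 2 ^ m * count_mem (Some v) L) (cnt v w) =
      wd w %/ 2 ^ m * count_mem (Some v) L)%N.
    have := cL1 (Some v); rewrite (permP p1) count_cat hC cL1 /= muln0 !addn0.
    rewrite [X in minn _ X](_ : _ = cnt v w) 1?addnC //.
    by rewrite count_map /cnt; apply: eq_count => u.
  have qc : (wd w %/ 2 ^ m * count_mem (Some v) L)%:R <= mass n v * (wd w)%:R :> R.
    rewrite natrM; apply: (@le_trans _ _ ((wd w %/ 2 ^ m)%:R * ((2 ^ m)%:R * mass n v))).
      exact: ler_wpM2l.
    by rewrite mulrA mulrC ler_wpM2l // mass_ge0.
  rewrite le_max; case: (leqP (wd w %/ 2 ^ m * count_mem (Some v) L) (cnt v w)) => hq.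
    have -> : count_mem (Some v) D1 = 0%N by move: cD1; rewrite (minn_idPl hq); lia.
    by rewrite lexx.
  apply/orP; right; apply: le_trans (lerB qc (lexx _)).
  by rewrite -(natrB _ (ltnW hq)) ler_nat -cD1 (minn_idPr (ltnW hq)) addnK.
exists n', (fun w xo => conjf (t w) (dg (d2 m) xo (fill m (wd w)))); split.
- by rewrite /n'; lia.
- move=> w wV; have [tP _] := ht w wV; apply: hform_conj => //.
  by rewrite -{1}(fill_size m (wd w)); exact: hform_dg.
- apply: (le_trans _ (le_trans base _)); last by rewrite lee_fin; lra.
  by apply: Sn_le => w _; rewrite mulr1 ler_nat ltnW // ltn_pmod // expn_gt0.
move=> x; rewrite /n' addKn -/n' -lee_fin (rRE H).
apply: (@le_trans _ _ (S_ n' bound)).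
  by apply: Sn_le => w wV; have [_] := ht w wV; apply.
have f0 w : 0 <= \sum_(v <- somes L) (wd v)%:R * Num.max 0 (mass n v * (wd w)%:R - (cnt v w)%:R).
  by apply: sumr_ge0 => v _; rewrite mulr_ge0 // le_max lexx.
rewrite /bound SnD; last 2 first.
- by move=> w; rewrite mulr_ge0.
- by move=> w; rewrite addr_ge0 // mulr1.
rewrite SnZ // (tt_size H) mule1 EFinD leeD2l // SnD // (splitr e') EFinD leeD //.
exact/ltW/hN2.
Qed.

(** A tower level, a matrix level and a map from the first to the second. *)
Let stage := (nat * nat * ((option (seq nat) -> mel K) -> mel K))%type.

Let good k (st : stage) := exists2 L, good_list (1 / 2 ^+ k) st.1.1 st.1.2 L &
  hform (od wd) (2 ^ st.1.2) L st.2.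

(** One turn of the zigzag: [r.2] leads from the matrix level of [st] back to the tower level of the
    new stage [r.1], and the map of [r.1] is adapted to [r.2]. *)
Let next k (st : stage) (r : stage * (seq nat -> (option unit -> mel K) -> mel K)) :=
  [/\ (st.1.1 < r.1.1.1)%N /\ (st.1.2 < r.1.1.2)%N, good k.+1 r.1,
    forall w, V r.1.1.1 w -> hform (d2 st.1.2) (wd w) (fill st.1.2 (wd w)) (r.2 w),
    forall x, rR r.1.1.1 (bsub (spread r.2 (st.2 (ox x)))
      (dup (S := Rs) st.1.1 (r.1.1.1 - st.1.1) x)) <= 2 / 2 ^+ k
    & forall x, rM r.1.1.2 (msub (r.1.2 (ox (spread r.2 x)))
      (dup (S := Ms) st.1.2 (r.1.1.2 - st.1.2) x)) <= 2 / 2 ^+ k].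

Let next_ex k st : exists r, good k st -> next k st r.
Proof.
have [[L gL hL]|ng] := pselect (good k st); last by exists (st, fun _ _ => @mzero K).
have e0 j : 0 < 1 / 2 ^+ j :> R by rewrite divr_gt0 // exprn_gt0.
have [n' [g [[_ nn] hg hS hx]]] := step_ancestors 0 (ltW (e0 k)) (e0 k) gL hL.
have [m' [L' [h' [[_ mm] gL' hh' hx']]]] := step_lift 0 (e0 k.+1) hg hS.
exists ((n', m', h'), g) => _; split; [by []|by exists L'|exact: hg| |].
  move=> x; apply: le_trans (hx x) _.
  by rewrite -mulrDl.
move=> x; apply: le_trans (hx' x) _.
have -> : 2 / 2 ^+ k = 1 / 2 ^+ k + 1 / 2 ^+ k :> R by rewrite -mulrDl.
by rewrite lerD2l ler_pM2l // lef_pV2 ?posrE ?exprn_gt0 // ler_eXn2l // ltr1n.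
Qed.

Theorem tower_limit_iso : exists f, star_alg_iso (S1 := Rs) (S2 := Ms) f.
Proof.
have c0 := involution0 c_inv.
have /choice [nxt hnxt] : forall a : nat * stage, exists r, good a.1 a.2 -> next a.1 a.2 r.
  by move=> a; exact: next_ex.
have [m0 hm0] := good_list_ex 0 (ltr01 : 0 < 1 :> R).
have [L0 gL0] := hm0 _ (leqnn _).
pose fix st k : stage := if k is j.+1 then (nxt (j, st j)).1
  else (0%N, m0, fun xo => dg (od wd) xo L0).
pose g k := (nxt (k, st k)).2.
have stG k : good k (st k).
  elim: k => [|k IH]; last by have [] := hnxt (k, st k) IH.
  exists L0; first by rewrite expr0 divr1.
  by have [<- _ _ _] := gL0; exact: hform_dg.
pose n_ k := (st k).1.1; pose m_ k := (st k).1.2.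
have nS k : (n_ k < n_ k.+1)%N by have [[] ] := hnxt (k, st k) (stG k).
have mS k : (m_ k < m_ k.+1)%N by have [[] ] := hnxt (k, st k) (stG k).
have hg k w : V (n_ k.+1) w -> hform (d2 (m_ k)) (wd w) (fill (m_ k) (wd w)) (g k w).
  by have [_ _ h _ _] := hnxt (k, st k) (stG k); exact: h.
(* With [eps k = 2 / 2 ^+ k], the sequence [8 / 2 ^+ k] solves [2 * eps k + tail k.+1 = tail k]. *)
apply: (intertwining (rank_system_R c_inv H) (rank_system_MK R c_inv)
  (n_ := n_) (m_ := m_) (phi := fun k x => (st k).2 (ox x)) (psi := fun k => spread (g k))
  (eps := fun k => 2 / 2 ^+ k) (tail := fun k => 8 / 2 ^+ k)).
- by elim=> // k IH; exact: leq_ltn_trans IH (nS k).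
- by elim=> // k IH; exact: leq_ltn_trans IH (mS k).
- by move=> k; exact: ltnW.
- by move=> k; exact: ltnW.
- by move=> k x y; have [L gL hL] := stG k; exact: phi_contract gL hL.
- by move=> k x y; apply: psi_contract; exact: hg.
- by move=> k x; have [_ _ _ h _] := hnxt (k, st k) (stG k); exact: h.
- by move=> k x; have [_ _ _ _ h] := hnxt (k, st k) (stG k); exact: h.
- move=> k x y; have [L gL hL] := stG k; apply: rM_0.
  rewrite -[ox _]/(ox (fun v => madd (x v) (y v))) oxD; exact: (hformD _ _ hL).
- move=> k x y; have [L gL hL] := stG k; apply: rM_0.
  rewrite -[ox _]/(ox (fun v => mmul (wd v) (x v) (y v))) oxM; exact: (hformM _ _ hL).
- move=> k a x; have [L gL hL] := stG k; apply: rM_0.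
  rewrite -[ox _]/(ox (fun v => mscale a (x v))) oxZ; exact: (hformZ _ _ hL).
- move=> k x; have [L gL hL] := stG k; apply: rM_0.
  rewrite -[ox _]/(ox (fun v => mstar c (x v))) (ox_star _ c0); exact: (hform_star _ c0 hL).
- move=> k; have -> : 8 / 2 ^+ k = 4 / 2 ^+ k + 4 / 2 ^+ k :> R.
    by rewrite -mulrDl; congr (_ / _); ring.
  have -> : 8 / 2 ^+ k.+1 = 4 / 2 ^+ k :> R.
    by rewrite exprS invfM mulrA; congr (_ * _); field.
  by rewrite lerD2r mulrA ler_pM2r ?invr_gt0 ?exprn_gt0 //; lra.
- by move=> k; rewrite divr_ge0 // exprn_ge0.
- exact: small_exp.
Qed.

End Intertwiners.

(** * Regularity *)

Section QuasiInverses.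
Variables (K : fieldType).

(** If [p] is a quasi-inverse of [C], so is [p C p], and its rank is bounded by that of [C], which
    that of [p] need not be. *)
Lemma reflexive_inverse D (C : 'M[K]_D) : exists2 G : 'M[K]_D,
  C *m G *m C = C & (\rank G <= \rank C)%N.
Proof.
have h : C *m pinvmx C *m C = C by apply: mulmxKpV; exact: submx_refl.
move: (pinvmx C) h => p h.
exists (p *m C *m p); first by rewrite !mulmxA !h.
by rewrite (leq_trans (mxrankM_maxl _ _)) // mxrankM_maxr.
Qed.

(* A quasi-inverse of [B] is obtained from [U] by a correction of the size of the
   defect [B - B U B]. *)
Lemma quasi_inverse_near D (A U B : 'M[K]_D) : exists2 W : 'M[K]_D, B *m W *m B = B
  & (\rank (U - W)%R <= 3 * \rank (A - B)%R + \rank (A *m U *m A - A)%R)%N.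
Proof.
pose C := B - B *m U *m B.
have [G hG rG] := reflexive_inverse C.
have e1 : B *m (1%:M - U *m B) = C by rewrite mulmxBr mulmx1 mulmxA.
have e2 : (1%:M - B *m U) *m B = C by rewrite mulmxBl mul1mx.
move: (1%:M - U *m B) (1%:M - B *m U) e1 e2 => Y Z e1 e2.
(* Since [B Y = Z B = C], the product [B W B] equals [B U B + C G C = B U B + C = B]. *)
exists (U + Y *m G *m Z).
  rewrite mulmxDr mulmxDl !mulmxA e1 -[_ *m B in X in _ + X]mulmxA e2 hG.
  by rewrite /C addrC subrK.
rewrite opprD addrA subrr sub0r mxrank_opp.
rewrite (leq_trans (mxrankM_maxl _ _)) // (leq_trans (mxrankM_maxr _ _)) // (leq_trans rG) //.
(* Telescoping through [A]: the defect of [U] at [A] and three terms containing [A - B], whence the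
   constant 3. *)
have -> : C = (B - A) + (A - A *m U *m A) + (A - B) *m (U *m A) + B *m U *m (A - B).
  rewrite /C mulmxBl mulmxBr !mulmxA.
  set a := A *m U *m A; set b := B *m U *m A; set d := B *m U *m B.
  by rewrite !subrKA.
have r1 : \rank (B - A) = \rank (A - B) by rewrite -mxrank_opp opprB.
have r2 : \rank (A - A *m U *m A) = \rank (A *m U *m A - A) by rewrite -mxrank_opp opprB.
have r3 : (\rank ((A - B) *m (U *m A))%R <= \rank (A - B)%R)%N by exact: mxrankM_maxl.
have r4 : (\rank (B *m U *m (A - B))%R <= \rank (A - B)%R)%N by exact: mxrankM_maxr.
have := mxrank_add ((B - A) + (A - A *m U *m A) + (A - B) *m (U *m A)) (B *m U *m (A - B)).
have := mxrank_add ((B - A) + (A - A *m U *m A)) ((A - B) *m (U *m A)).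
have := mxrank_add (B - A) (A - A *m U *m A).
lia.
Qed.

Definition fmx D (M : 'M[K]_D) : mel K := fun a b =>
  if (insub a, insub b) is (Some i, Some j) then M i j else 0.

Lemma mxsq_fmx D (M : 'M[K]_D) : mxsq D (fmx M) = M.
Proof. by apply/matrixP => i j; rewrite !mxE /fmx !valK. Qed.

Lemma quasi_inverse_near_mel D (x u y : mel K) : exists2 v : mel K,
  meq D (mmul D (mmul D y v) y) y
  & (dm D u v <= 3 * dm D x y + dm D (mmul D (mmul D x u) x) x)%N.
Proof.
have [W h1 h2] := quasi_inverse_near (mxsq D x) (mxsq D u) (mxsq D y).
exists (fmx W); first by apply/mxsqE; rewrite !mxsqM mxsq_fmx.
by rewrite /dm /rkf !mxsqB !mxsqM mxsq_fmx.
Qed.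

(** If the columns of [Q] span the kernel of [x^* x], then [(x Q)^* (x Q) = 0], and positive
    definiteness applied to each column gives [x Q = 0]. So the rows of [x] lie in the row space of
    [x^* x]. *)
Lemma rkf_star_mul (c : K -> K) D (x : mel K) : field_involution c -> positive_definite c ->
  (rkf D x <= rkf D (mmul D (mstar c x) x))%N.
Proof.
move=> cI pd; have [cD cM _] := cI; have c0 := involution0 cI.
rewrite /rkf mxsqM; set A := mxsq D x.
have -> : mxsq D (mstar c x) = (map_mx c A)^T by apply/matrixP => i j; rewrite !mxE.
set B := _ *m A; apply: mxrankS; rewrite submxE; set Q := cokermx B.
have BQ : B *m Q = 0 by exact: mulmx_coker.
have cmx k l p (M : 'M[K]_(k, l)) (N : 'M[K]_(l, p)) :
    map_mx c (M *m N) = map_mx c M *m map_mx c N.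
  apply/matrixP => i j; rewrite !mxE (big_morph c cD c0).
  by apply: eq_bigr => a _; rewrite cM !mxE.
have Z : (map_mx c (A *m Q))^T *m (A *m Q) = 0.
  by rewrite cmx trmx_mul -mulmxA (mulmxA _ A) -/B BQ mulmx0.
apply/eqP/matrixP => i j; rewrite [RHS]mxE.
apply: (pd D (fun i => (A *m Q) i j) _ i).
move/matrixP: Z => /(_ j j); rewrite mxE [in X in _ = X]mxE; apply: etrans.
by apply: eq_bigr => a _; rewrite [in RHS]mxE [in RHS]mxE.
Qed.

End QuasiInverses.

(** * Regularity of the tower completion *)

Section TowerRegular.
Variables (K : fieldType) (R : realType) (c : K -> K).
Hypothesis c_inv : field_involution c.
Hypothesis c_pd : positive_definite c.
Variables (X : pseudoPMetricType R) (T : X -> X).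
Variables (E : nat -> set X) (P : nat -> seq (set X)).
Variable mu : {measure set (g_sigma_algebraType (@open X)) -> \bar R}.
Hypothesis H : tower_theory T mu E P.
Local Notation Rs := (R_sys c T E P mu).
Local Notation rR := (rR T E P mu).

(** Quasi-inverses are chosen block by block, and the weighted sum of the block estimates keeps the
    constant 3. With all three arguments equal to [x] it also yields existence. *)
Let near n (x u y : blk K) : exists2 v : blk K,
  forall w, meq (wd w) (mmul (wd w) (mmul (wd w) (y w) (v w)) (y w)) (y w)
  & rR n (bsub u v) <= 3 * rR n (bsub x y) +
      rR n (bsub (fun w => mmul (wd w) (mmul (wd w) (x w) (u w)) (x w)) x).
Proof.
have /choice [v hv] : forall w, exists v : mel K,
    meq (wd w) (mmul (wd w) (mmul (wd w) (y w) v) (y w)) (y w) /\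
    (dm (wd w) (u w) v <= 3 * dm (wd w) (x w) (y w) +
       dm (wd w) (mmul (wd w) (mmul (wd w) (x w) (u w)) (x w)) (x w))%N.
  by move=> w; have [v h1 h2] := quasi_inverse_near_mel (wd w) (x w) (u w) (y w); exists v.
exists v; first by move=> w; have [] := hv w.
rewrite -lee_fin EFinD EFinM !(rRE H) -SnZ // -SnD //.
by apply: Sn_le => w _; rewrite -natrM -natrD ler_nat; have [] := hv w.
Qed.

Theorem tower_star_regular : star_regular Rs c.
Proof.
apply: (rank_system_star_regular (rank_system_R c_inv H)).
- move=> n x; have [v hv _] := near n x x x; exists v.
  by apply: (rR_0 H) => w _; exact: hv.
- move=> n x u y h; have [v hv le] := near n x u y; exists v.
    by apply: (rR_0 H) => w _; exact: hv.
  have h0 : rR n (bsub (fun w => mmul (wd w) (mmul (wd w) (x w) (u w)) (x w)) x) = 0 := h.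
  by move: le; rewrite h0 addr0.
- move=> n x.
  have z y : rR n (bsub y (dscale Rs 0 (done Rs n))) = rR n y.
    apply: rR_eq => w _; apply: rkf_eq => a b _ _.
    by rewrite /bsub /msub /madd /mopp /= mul0r oppr0 addr0.
  rewrite -[leLHS]/(rR n (bsub _ _)) -[leRHS]/(rR n (bsub _ _)) !z.
  rewrite -lee_fin !(rRE H); apply: Sn_le => w _; rewrite ler_nat.
  exact: rkf_star_mul.
Qed.

End TowerRegular.

(** * The crossed product *)

Section CrossedProduct.
Variables (R : realType) (X : pseudoPMetricType R) (K : fieldType) (c : K -> K).
Hypothesis c_inv : field_involution c.
Variables (T Ti : X -> X).
Hypotheses (TK : cancel T Ti) (TiK : cancel Ti T).
Implicit Types (k : int) (x : X).

Lemma chiE (A : set X) x : chi K A x = (`[< A x >])%:R.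
Proof. by rewrite /chi; case: asboolP. Qed.

Lemma chi_mul (A B : set X) x : chi K A x * chi K B x = chi K (A `&` B) x.
Proof.
rewrite !chiE -natrM mulnb; congr (nat_of_bool _)%:R.
by apply/andP/asboolP => [[/asboolP ? /asboolP ?]|[? ?]]; split=> //; exact/asboolP.
Qed.

Lemma c_chi (A : set X) x : c (chi K A x) = chi K A x.
Proof.
by rewrite /chi; case: asboolP; rewrite ?(involution0 c_inv) ?(involution1 c_inv).
Qed.

Lemma coefA_nil k x : coefA ([::] : Aelt X K) k x = 0.
Proof. exact: big_nil. Qed.

Lemma coefA_cons i (f : X -> K) (a : Aelt X K) k x :
  coefA ((i, f) :: a) k x = (if i == k then f x else 0) + coefA a k x.
Proof. by rewrite /coefA big_cons /=; case: ifP => //; rewrite add0r. Qed.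

Lemma coefA_cat (a b : Aelt X K) k x : coefA (a ++ b) k x = coefA a k x + coefA b k x.
Proof. exact: big_cat. Qed.

Lemma coefA_flatten (I : Type) (r : seq I) (F : I -> Aelt X K) k x :
  coefA (flatten [seq F i | i <- r]) k x = \sum_(i <- r) coefA (F i) k x.
Proof.
elim: r => [|i r IH] /=; first by rewrite coefA_nil big_nil.
by rewrite coefA_cat IH big_cons.
Qed.

Lemma coefA_allpairs (I J : Type) (r : seq I) (r' : seq J) (F : I -> J -> Aelt X K) k x :
  coefA (flatten [seq F i j | i <- r, j <- r']) k x =
  \sum_(i <- r) \sum_(j <- r') coefA (F i j) k x.
Proof.
elim: r => [|i r IH]; first by rewrite coefA_nil big_nil.
by rewrite /= flatten_cat coefA_cat coefA_flatten IH big_cons.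
Qed.

Lemma coefA_scale u (a : Aelt X K) k x : coefA (Ascale u a) k x = u * coefA a k x.
Proof. by rewrite /coefA big_map mulr_sumr. Qed.

Lemma coefA1 i (f : X -> K) k x : coefA [:: (i, f)] k x = if i == k then f x else 0.
Proof. by rewrite coefA_cons coefA_nil addr0. Qed.

Lemma Amul_flatten_r (I : Type) (r : seq I) (F : I -> Aelt X K) j (g : X -> K) :
  Amul T Ti (flatten [seq F i | i <- r]) [:: (j, g)] =
  flatten [seq Amul T Ti (F i) [:: (j, g)] | i <- r].
Proof.
elim: r => //= i r IH.
by rewrite -IH /Amul allpairs_cat.
Qed.

Lemma Amul1 i (f : X -> K) j (g : X -> K) :
  Amul T Ti [:: (i, f)] [:: (j, g)] = [:: (i + j, fun x => f x * g (Tz T Ti (- i) x))].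
Proof. by []. Qed.

Variables (E : nat -> set X) (P : nat -> seq (set X)).
Hypothesis P_disj : forall n i j, (i < size (P n))%N -> (j < size (P n))%N -> i <> j ->
  nth set0 (P n) i `&` nth set0 (P n) j = set0.
Hypothesis P_cover : forall n x, ~ E n x <-> exists2 i, (i < size (P n))%N & nth set0 (P n) i x.
Local Notation Ws := (Wset T E P).
Local Notation V := (inV T E P).
Local Notation s_ := (sn K T Ti E).

Let iterTK l x : iter l Ti (iter l T x) = x.
Proof. by elim: l x => // l IH x; rewrite iterSr iterS TK IH. Qed.

Let iterTiK l x : iter l T (iter l Ti x) = x.
Proof. by elim: l x => // l IH x; rewrite iterSr iterS TiK IH. Qed.

Lemma Tz_opp i x : Tz T Ti (- (i%:Z)) x = iter i Ti x.
Proof. by case: i => [|i]; [rewrite oppr0|rewrite -NegzE]. Qed.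

Lemma snE n : s_ n = [:: (1%Z, chi K (~` E n))].
Proof.
rewrite /sn /Achi /At Amul1 add0r; congr [:: (_, _)].
by apply/funext => x; rewrite mulr1.
Qed.

Lemma sn_starE n : Astar c T Ti (s_ n) = [:: (-1%Z, chi K [set x | ~ E n (T x)])].
Proof.
by rewrite snE /Astar /=; congr [:: (_, _)]; apply/funext => x; rewrite c_chi.
Qed.

Lemma sn_powE n i : Apow T Ti (s_ n) i =
  [:: (i%:Z, chi K [set x | forall l, (l < i)%N -> ~ E n (iter l Ti x)])].
Proof.
elim: i => [|i IH].
  rewrite /Apow /= /Aone; congr [:: (_, _)]; apply/funext => x.
  by rewrite chiE asboolT.
rewrite /Apow iterS -/(Apow T Ti (s_ n) i) IH snE Amul1; congr [:: (_, _)].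
apply/funext => x; rewrite (Tz_opp 1) /= !chiE -natrM mulnb; congr (nat_of_bool _)%:R.
apply/andP/asboolP => [[/asboolP h0 /asboolP h] [|l] li //|h].
  by rewrite iterSr; exact: h.
split; apply/asboolP; first exact: (h 0%N).
by move=> l li; rewrite /= -iterSr; exact: h.
Qed.

Lemma sn_star_powE n j : Apow T Ti (Astar c T Ti (s_ n)) j =
  [:: (- (j%:Z), chi K [set x | forall l, (l < j)%N -> ~ E n (iter l.+1 T x)])].
Proof.
elim: j => [|j IH].
  rewrite /Apow /= /Aone; congr [:: (_, _)]; apply/funext => x.
  by rewrite chiE asboolT.
rewrite /Apow iterS -/(Apow _ _ _ j) IH sn_starE Amul1; congr [:: (_, _)].
  by rewrite -opprD.
apply/funext => x; rewrite opprK /= !chiE -natrM mulnb; congr (nat_of_bool _)%:R.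
apply/andP/asboolP => [[/asboolP h0 /asboolP h] [|l] li //|h].
  by rewrite iterSr; exact: h.
split; apply/asboolP; first exact: (h 0%N).
by move=> l li; rewrite -iterSr; exact: h.
Qed.

(** The orbit of [W] avoids [E n] strictly between its ends, so the indicators in the powers of
    [s_n] equal 1 on the support, and [e_ij(W)] is the indicator of [T^i(W)] times [t^(i-j)]. *)
Lemma eijE n w i j : (i < wd w)%N -> (j < wd w)%N ->
  eij c T Ti E P n w i j = [:: (i%:Z - j%:Z, fun x => chi K (Ws n w) (iter i Ti x))].
Proof.
move=> iw jw; rewrite /eij sn_powE sn_star_powE /Achi !Amul1 addr0.
congr [:: (_, _)]; apply/funext => x; rewrite Tz_opp !chiE -!natrM !mulnb.
congr (nat_of_bool _)%:R.
apply/andP/asboolP => [[/andP[_ /asboolP h] _] //|wx]; split.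
  apply/andP; split; apply/asboolP => // l li.
  have -> : iter l Ti x = iter (i - l) T (iter i Ti x).
    by rewrite -{2}(subnK (ltnW li)) iterD iterTiK.
  by apply: (Wset_between P_disj P_cover wx); lia.
apply/asboolP => l lj; apply: (Wset_between P_disj P_cover wx); lia.
Qed.

Lemma image_iter l (A : set X) x : [set iter l T z | z in A] x <-> A (iter l Ti x).
Proof.
by split=> [[z Az <-]|Ax]; [rewrite iterTK|exists (iter l Ti x) => //; rewrite iterTiK].
Qed.

(* [h_W f t^k] is computed floor by floor. *)
Lemma represents_diag n (k : int) (f : X -> K) (x : blk K) :
  (forall w i j, V n w -> (i < wd w)%N -> (j < wd w)%N -> i%:Z - j%:Z != k -> x w i j = 0) ->
  (forall w z i, Ws n w z -> (i < wd w)%N ->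
     \sum_(0 <= j < wd w) x w i j = f (iter i T z)) ->
  represents c T Ti E P n [:: (k, f)] x.
Proof.
move=> off val w wV k' z.
rewrite /hW Amul_flatten_r coefA_flatten coefA_allpairs.
rewrite -/(wd w) -[iota 0 (wd w)]/(index_iota 0 (wd w)) big_nat [RHS]big_nat.
apply: eq_bigr => i iw.
rewrite /Achi Amul1 coefA1 add0r oppr0 [Tz _ _ _ z]/= chiE.
rewrite (eq_big_nat _ _ (F2 := fun j => x w i j *
    (if i%:Z - j%:Z == k' then chi K (Ws n w) (iter i Ti z) else 0))); last first.
  by move=> j jw; rewrite coefA_scale eijE // coefA1.
rewrite chiE; have [wz|nwz] := pselect (Ws n w (iter i Ti z)); last first.
  rewrite asboolF; last by move/image_iter.
  rewrite mul0r if_same big1 // => j _.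
  by rewrite asboolF // if_same mulr0.
rewrite asboolT; last exact/image_iter.
have fz := val _ _ _ wz iw; rewrite iterTiK in fz.
rewrite mul1r -fz asboolT //.
case: eqVneq => [<-|kk'].
  rewrite !big_nat; apply: eq_bigr => j jw; case: eqVneq => [_|/(off w i j wV iw jw) ->].
    by rewrite mulr1.
  by rewrite mul0r.
rewrite big_nat big1 // => j jw; case: eqVneq => [e|_]; last by rewrite mulr0.
by rewrite off ?mul0r // e eq_sym.
Qed.

Let sum_one m i (F : nat -> K) : (i < m)%N -> (forall j, j != i -> F j = 0) ->
  \sum_(0 <= j < m) F j = F i.
Proof.
move=> im h; rewrite big_mkord (bigD1 (Ordinal im)) //= big1 ?addr0 // => j ji.
by apply: h.
Qed.

(** The matrix of [s_n] in every block: floor [b] moves to floor [b + 1]. Row 0 vanishes because the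
    base lies in [E n], where the coefficient of [s_n] is zero. *)
Definition shift_blk : blk K := fun _ a b => (a == b.+1)%:R.

Lemma represents_sn n : represents c T Ti E P n (s_ n) shift_blk.
Proof.
rewrite snE; apply: represents_diag => [w i j _ iw jw|w z i wz iw]; rewrite /shift_blk.
  by case: (i =P j.+1) => // ->; rewrite -addn1 PoszD addrAC subrr.
case: i iw => [|i] iw /=.
  rewrite big1 // chiE asboolF //; apply; exact: Wset_start wz.
rewrite (sum_one (i := i)) ?(ltnW iw) //; last first.
  by move=> j; rewrite eqSS eq_sym => /negbTE ->.
by rewrite eqxx chiE asboolT //; exact: (Wset_between P_disj P_cover wz (i := i.+1) iw).
Qed.

Definition floor_blk n (A : set X) : blk K := fun w a b =>
  ((a == b) && `[< forall z, Ws n w z -> A (iter a T z) >])%:R.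

(** Every floor of level [n] lies in one cell, so a member of [P n] contains it or misses it. *)
Lemma represents_chi n i : (i < size (P n))%N ->
  represents c T Ti E P n (Achi K (nth set0 (P n) i)) (floor_blk n (nth set0 (P n) i)).
Proof.
move=> iP; apply: represents_diag => [w a b _ aw bw|w z a wz aw]; rewrite /floor_blk.
  by case: (a =P b) => // ->; rewrite subrr.
rewrite (sum_one (i := a)) //; last by move=> b; rewrite eq_sym => /negbTE ->.
rewrite eqxx chiE /=; congr (nat_of_bool _)%:R; apply/asboolP/asboolP; first exact.
move=> Pz z' wz'.
have := Wset_cell P_disj P_cover wz wz' (ltnW aw).
rewrite (cell_eq P_disj iP Pz) => e; rewrite e; apply: cell_nth.
by rewrite -e.
Qed.

(** The generator [g = chi_Z t] satisfies [g g^* = chi_Z]. *)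
Lemma inA_chi n i : (i < size (P n))%N -> inA c T Ti P n (Achi K (nth set0 (P n) i)).
Proof.
move=> iP; have g := @inA_gen R X K c T Ti P n i iP.
apply: inA_eq (inA_mul g (inA_star g)) => k x.
rewrite /Achi /At /Amul /= !coefA1 add0r addrN; case: eqP => // _.
by rewrite !mulr1 /= TiK c_chi chi_mul setIid.
Qed.

End CrossedProduct.

(** * Compatibility of [Phi] with adjoints *)

Section PhiStar.
Variables (R : realType) (X : pseudoPMetricType R) (K : fieldType) (c : K -> K).
Hypothesis c_inv : field_involution c.
Variables (T Ti : X -> X).
Hypotheses (TK : cancel T Ti) (TiK : cancel Ti T).
Hypotheses (T_cont : continuous T) (Ti_cont : continuous Ti).
Variables (y : X) (E : nat -> set X) (P : nat -> seq (set X)).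
Variable mu : {measure set (g_sigma_algebraType (@open X)) -> \bar R}.
Hypothesis H : tower_theory T mu E P.
Hypothesis X_comp : compact [set: X].
Hypothesis E_clopen : forall n, clopen (E n).
Hypothesis E_y : forall n, E n y.
Hypothesis P_clopen : forall n i, (i < size (P n))%N ->
  clopen (nth set0 (P n) i) /\ nth set0 (P n) i !=set0.
Hypothesis P_disj : forall n i j, (i < size (P n))%N -> (j < size (P n))%N -> i <> j ->
  nth set0 (P n) i `&` nth set0 (P n) j = set0.
Hypothesis P_cover : forall n x, ~ E n x <-> exists2 i, (i < size (P n))%N & nth set0 (P n) i x.
Hypothesis P_refine : forall n B, memPE E P n.+1 B -> exists2 B', memPE E P n B' & B `<=` B'.
Hypothesis P_base : forall U : set X, open U -> forall x, U x ->
     exists (m : nat) (Bs : nat -> set X),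
       [/\ forall i, (i < m)%N -> exists n, memPE E P n (Bs i),
           forall i, (i < m)%N -> Bs i x
         & forall z, (forall i, (i < m)%N -> Bs i z) -> U z].
Local Notation Rs := (R_sys c T E P mu).

Let cell_open n x : open [set z | cell P n z = cell P n x].
Proof.
have [Ex|nEx] := pselect (E n x).
  have -> : [set z | cell P n z = cell P n x] = E n.
    rewrite (E_cell P_disj P_cover n x).1 //.
    by apply/seteqP; split=> z /= /(E_cell P_disj P_cover).
  by case: (E_clopen n).
have cx := (nE_cell P_disj P_cover n x).1 nEx.
have -> : [set z | cell P n z = cell P n x] = nth set0 (P n) (cell P n x).
  apply/seteqP; split=> z /=; last exact: cell_eq.
  by move=> e; rewrite -e; apply: cell_nth; rewrite e.
by have [[]] := P_clopen cx.
Qed.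

Let memPE_cell n B x z : memPE E P n B -> B x -> cell P n z = cell P n x -> B z.
Proof.
move=> [->|[i iP ->]] Bx e.
  by apply/(E_cell P_disj P_cover); rewrite e; exact/(E_cell P_disj P_cover).
have ex := cell_eq P_disj iP Bx; rewrite ex in e; rewrite -e.
by apply: cell_nth; rewrite e.
Qed.

(** The points on whose level [n] cell [f] is constant form an open set that grows with [n]. These
    sets cover the space because the cells generate the topology, and compactness selects one
    [n]. *)
Lemma locally_constant_cell (f : X -> K) : locally_constant f ->
  exists n, forall x x', cell P n x = cell P n x' -> f x = f x'.
Proof.
move=> lf.
pose O n := [set x | forall z, cell P n z = cell P n x -> f z = f x].
have Oo n : open (O n).
  have -> : O n = \bigcup_(x in O n) [set z | cell P n z = cell P n x].
    apply/seteqP; split=> x; first by exists x.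
    by move=> [x' Ox' /= e] z ez; rewrite (Ox' x e); apply: Ox'; rewrite ez.
  by apply: bigcup_open => x _; exact: cell_open.
have Om n m : (n <= m)%N -> O n `<=` O m.
  by move=> nm x Ox z e; apply: Ox; exact: (cell_coarser P_disj P_cover P_refine nm e).
have Oc : [set: X] `<=` \bigcup_(n in [set: nat]) O n.
  move=> x _; have [U [oU Ux fU]] := lf x.
  have [m [Bs [hB Bx BU]]] := P_base oU Ux.
  have [N hN] : exists N, forall i, (i < m)%N -> exists2 n, (n <= N)%N & memPE E P n (Bs i).
    elim: m {Bx BU} hB => [|m IH] hB; first by exists 0%N.
    have [i im|N hN] := IH; first by apply: hB; exact: ltnW.
    have [n hn] := hB m (ltnSn m).
    exists (maxn N n) => i; rewrite ltnS leq_eqVlt => /orP[/eqP ->|im].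
      by exists n => //; rewrite leq_maxr.
    have [n' n'N hn'] := hN i im; exists n' => //.
    by rewrite (leq_trans n'N) // leq_maxl.
  exists N => // z e; apply: fU; apply: BU => i im.
  have [n nN hn] := hN i im; apply: (memPE_cell hn (Bx i im)).
  exact: (cell_coarser P_disj P_cover P_refine nN e).
have := X_comp; rewrite compact_cover => /(_ nat setT O (fun n _ => Oo n) Oc) [D _ Dc].
have [s es] := (finite_seqP _).1 (finite_fset D); rewrite es in Dc.
exists (\max_(n <- s) n)%N => x x' e.
have [n ns Ox] := Dc x' I.
by apply: (Om n _ _ _ Ox _ e); exact: (leq_bigmax_seq (F := id)).
Qed.

(** Indicators are taken only of members of [P n]: [f] is [f y] times the unit plus multiples of
    these, as [y] lies in [E n]. The map [g] will be the identity and [c]; the common [d] makes the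
    two expansions adjoint term by term. *)
Let cell_sum (f : X -> K) n :
  (forall x x', cell P n x = cell P n x' -> f x = f x') ->
  exists d : nat -> K, forall g : K -> K, g 0 = 0 -> (forall u v, g (u + v) = g u + g v) ->
   Aeq [:: (0%Z, fun x => g (f x))] (Ascale (g (f y)) (Aone X K) ++
    flatten [seq Ascale (g (d i)) (Achi K (nth set0 (P n) i)) | i <- iota 0 (size (P n))]).
Proof.
move=> fc.
have /choice [z hz] : forall i, exists z, (exists x, cell P n x = i) -> cell P n z = i.
  move=> i; have [[x e]|h] := pselect (exists x, cell P n x = i); first by exists x.
  by exists y.
exists (fun i => f (z i) - f y) => g g0 gD k x.
have gN u : g (- u) = - g u by apply: (addrI (g u)); rewrite -gD !subrr.
rewrite coefA_cat coefA_scale coefA_flatten /Aone !coefA1.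
under eq_bigr => i _ do rewrite coefA_scale /Achi coefA1.
case: eqP => _; last by rewrite mulr0 add0r big1 // => i _; rewrite mulr0.
rewrite mulr1; have [Ex|nEx] := pselect (E n x).
  rewrite big_seq big1 ?addr0.
    congr g; apply: fc; rewrite ((E_cell P_disj P_cover n x).1 Ex).
    by rewrite ((E_cell P_disj P_cover n y).1 (E_y n)).
  move=> i; rewrite mem_iota /= => iP; rewrite chiE asboolF ?mulr0 // => xi.
  by have : ~ E n x by apply/P_cover; exists i.
have cx := (nE_cell P_disj P_cover n x).1 nEx.
rewrite (bigD1_seq (cell P n x)) ?iota_uniq ?mem_iota //= big_seq_cond big1 => [|i].
  rewrite chiE asboolT; last exact: cell_nth.
  rewrite mulr1 addr0 gD gN addrC subrK; congr g; apply: fc.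
  by rewrite hz //; exists x.
rewrite mem_iota /= => /andP[iP ic]; rewrite chiE asboolF ?mulr0 // => xi.
by move/eqP: ic; apply; rewrite (cell_eq P_disj iP xi).
Qed.

Lemma Avalid_cons i (f : X -> K) a : Avalid ((i, f) :: a) <-> locally_constant f /\ Avalid a.
Proof.
split=> [h|[lf h] [|j] //=]; last exact: h.
by split; [exact: (h 0%N)|move=> j ja; exact: (h j.+1)].
Qed.

Lemma Avalid1 i (f : X -> K) : locally_constant f -> Avalid [:: (i, f)].
Proof. by move=> lf; apply/Avalid_cons. Qed.

Lemma Avalid_cat (a b : Aelt X K) : Avalid a -> Avalid b -> Avalid (a ++ b).
Proof.
move=> ha hb; elim: a ha => // -[i f] a IH /Avalid_cons [lf /IH h].
by rewrite cat_cons; apply/Avalid_cons.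
Qed.

Lemma locally_constant_cst (u : K) : locally_constant (fun _ : X => u).
Proof. by move=> x; exists setT; split=> //; exact: openT. Qed.

Lemma locally_constant_comp (f : X -> K) (g : K -> K) :
  locally_constant f -> locally_constant (fun x => g (f x)).
Proof.
by move=> lf x; have [U [oU Ux h]] := lf x; exists U; split=> // z /h ->.
Qed.

Lemma locally_constant_pre (f : X -> K) (h : X -> X) : continuous h ->
  locally_constant f -> locally_constant (fun x => f (h x)).
Proof.
move=> ch lf x; have [U [oU Ux hU]] := lf (h x); exists (h @^-1` U); split=> //.
- by move/continuousP: ch; exact.
- by move=> z /hU.
Qed.

Lemma locally_constant_chi (A : set X) : clopen A -> locally_constant (chi K A).
Proof.
move=> [oA cA] x; have [Ax|nAx] := pselect (A x).
  by exists A; split=> // z Az; rewrite !chiE !asboolT.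
exists (~` A); split=> //; first by rewrite openC.
by move=> z nAz; rewrite !chiE !asboolF.
Qed.

Lemma Tz_continuous k : continuous (Tz T Ti k).
Proof. by case: k => k; exact: continuous_iter. Qed.

Lemma Avalid_star (a : Aelt X K) : Avalid a -> Avalid (Astar c T Ti a).
Proof.
elim: a => [|[i f] a IH] // /Avalid_cons [lf /IH h].
rewrite -[Astar _ _ _ _]/((- i, fun x => c (f (Tz T Ti i x))) :: Astar c T Ti a).
apply/Avalid_cons; split=> //; apply: locally_constant_comp.
by apply: (locally_constant_pre _ lf); exact: Tz_continuous.
Qed.

Let HR := rank_system_R c_inv H.
Let tau0 : cseq Rs := fun n => (n, shift_blk K).
Let pS k : nat * del Rs := (k, shift_blk K).

(* On a block, the shift times its adjoint differs from the identity only in the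
   first diagonal entry. *)
Let shift_coisometry : cequiv (cmul tau0 (cstar tau0)) (cone Rs).
Proof.
apply/(cequivE HR) => e e0; have [N hN] := tt_base_small H e0.
exists N => k /hN h.
rewrite (dstE HR (M := k)) //; last by rewrite /= maxnn.
rewrite (dD0l HR _ (dat_pmul HR (p := pS k) (q := pstar (pS k)) _ _)) //.
rewrite (dD0r HR _ (dat_pone HR k)).
rewrite (dat_self (pstar (pS k))) (dat_self (pS k)).
rewrite -lte_fin; apply: le_lt_trans h.
rewrite -[X in (X%:E <= _)%E]/(rR T E P mu k (bsub (fun w => mmul (wd w) (shift_blk K w)
  (mstar c (shift_blk K w))) (fun=> @mone K))) (rRE H).
apply: Sn_le => w _; rewrite -[leRHS]/(1%:R) ler_nat.
rewrite (@rkf_eq _ _ _ (bl 1 (fun _ _ => -1) (@mzero K))).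
  rewrite -[wd w]/(1 + size w)%N rkf_bl [X in (_ + X)%N]rkf0 // addn0; exact: rkf_le.
move=> i j iw jw; rewrite /bsub /msub /madd /mopp /mmul /mstar /mone /shift_blk blE.
case: i iw => [|i] iw.
  rewrite big1 ?add0r; last by move=> l _; rewrite mul0r.
  by case: j jw => [|j] jw //=; rewrite oppr0.
rewrite (bigD1 (Ordinal (ltnW iw))) //= eqxx mul1r big1 ?addr0; last first.
  move=> l /eqP li; case: eqP => [[e1]|_]; last by rewrite mul0r.
  by case: li; apply: val_inj.
rewrite eq_sym; case: j {jw} => [|j] /=; first by rewrite (involution0 c_inv) subrr.
by case: eqP => _; rewrite ?(involution0 c_inv) ?(involution1 c_inv) subrr.
Qed.

Variable Phi : Aelt X K -> cseq Rs.
Hypothesis HPhi : Phi_spec Ti Phi.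

(** A relation compatible with sums, scalars and products, so that it can be propagated from
    generators. *)
Let adj a b := [/\ Avalid a, Avalid b & cequiv (Phi b) (cstar (Phi a))].

Let adj_eq a b a' b' : Avalid a' -> Avalid b' -> Aeq a a' -> Aeq b b' ->
  adj a b -> adj a' b'.
Proof.
move: HPhi => [hC [hE _]] va' vb' ea eb [va vb h]; split=> //.
apply: (cequiv_trans HR (t := Phi b)); first by apply: (cequiv_sym HR); exact: hE.
by apply: (cequiv_trans HR h); apply: (cstar_congr HR); exact: hE.
Qed.

Let adj_cat a b a' b' : adj a b -> adj a' b' -> adj (a ++ a') (b ++ b').
Proof.
move: HPhi => [_ [_ [hD _]]] [va vb h] [va' vb' h'].
split; [exact: Avalid_cat|exact: Avalid_cat|].
apply: (cequiv_trans HR (hD b b' vb vb')).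
apply: (cequiv_trans HR (cadd_congr HR h h')).
apply: (cequiv_sym HR); apply: (cequiv_trans HR _ (cstarD HR _ _)).
by apply: (cstar_congr HR); exact: hD.
Qed.

Let Avalid_scale (u : K) (a : Aelt X K) : Avalid a -> Avalid (Ascale u a).
Proof.
elim: a => [|[i f] a IH] // /Avalid_cons [lf /IH h].
by apply/Avalid_cons; split=> //; exact: (locally_constant_comp (fun v => u * v) lf).
Qed.

Let adj_scale u a b : adj a b -> adj (Ascale u a) (Ascale (c u) b).
Proof.
move: HPhi => [_ [_ [_ [_ [_ [hZ _]]]]]] [va vb h].
split; [exact: Avalid_scale|exact: Avalid_scale|].
apply: (cequiv_trans HR (hZ _ _ vb)).
apply: (cequiv_trans HR (cscale_congr HR _ h)).
apply: (cequiv_sym HR); apply: (cequiv_trans HR _ (cstarZ HR _ _)).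
by apply: (cstar_congr HR); exact: hZ.
Qed.

Let adj_mul a b a' b' : Avalid (Amul T Ti a a') -> Avalid (Amul T Ti b' b) ->
  adj a b -> adj a' b' -> adj (Amul T Ti a a') (Amul T Ti b' b).
Proof.
move: HPhi => [_ [_ [_ [hM _]]]] v1 v2 [va vb h] [va' vb' h']; split=> //.
apply: (cequiv_trans HR (hM b' b vb' vb)).
apply: (cequiv_trans HR (cmul_congr HR h' h)).
apply: (cequiv_sym HR); apply: (cequiv_trans HR _ (cstarM HR _ _)).
by apply: (cstar_congr HR); exact: hM.
Qed.

Let adj_sym a b : adj a b -> adj b a.
Proof.
move=> [va vb h]; split=> //.
by apply: (cequiv_sym HR); apply: (cequiv_trans HR (cstar_congr HR h)); exact: (cstarK HR).
Qed.

Let valid1 i : Avalid [:: (i, fun _ : X => (1 : K))].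
Proof. exact/Avalid1/locally_constant_cst. Qed.

Let adj_one : adj (Aone X K) (Aone X K).
Proof.
move: HPhi => [_ [_ [_ [_ [h1 _]]]]]; split; [exact: valid1|exact: valid1|].
apply: (cequiv_trans HR h1); apply: (cequiv_sym HR).
by apply: (cequiv_trans HR (cstar_congr HR h1)); exact: (cstar1 HR).
Qed.

(** With [I] the image of [t^-1] and [tau] that of [t], [I tau = 1] because [Phi] is a homomorphism,
    and [tau tau^* = 1] by [shift_coisometry]; so [I = I tau tau^* = tau^*]. *)
Let adj_t : adj (At X K) [:: (-1%Z, fun=> 1)].
Proof.
move: HPhi => [_ [hE [_ [hM [h1 [_ [_ hT]]]]]]]; split; [exact: valid1|exact: valid1|].
set I := Phi [:: _].
have ht : cequiv (Phi (At X K)) tau0.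
  by apply: hT => n; exact: (represents_sn c_inv TK TiK P_disj P_cover).
have It : cequiv (cmul I tau0) (cone Rs).
  apply: (cequiv_trans HR (t := cmul I (Phi (At X K)))).
    by apply: (cmul_congr HR (cequiv_refl HR _)); exact: (cequiv_sym HR).
  apply: (cequiv_trans HR (t := Phi (Amul T Ti [:: (-1%Z, fun=> 1)] (At X K)))).
    by apply: (cequiv_sym HR); apply: hM; exact: valid1.
  apply: (cequiv_trans HR _ h1); apply: hE; [|exact: valid1|].
    by apply: Avalid1; apply: (locally_constant_comp (fun=> 1 * 1)); exact: (locally_constant_cst 1).
  by move=> k x; rewrite /At /Aone Amul1 !coefA1 addNr mulr1.
apply: (cequiv_trans HR (t := cmul I (cone Rs))).
  by apply: (cequiv_sym HR); exact: (cmulx1 HR).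
apply: (cequiv_trans HR (t := cmul I (cmul tau0 (cstar tau0)))).
  by apply: (cmul_congr HR (cequiv_refl HR _)); apply: (cequiv_sym HR).
apply: (cequiv_trans HR (cmulA HR _ _ _)).
apply: (cequiv_trans HR (cmul_congr HR It (cequiv_refl HR _))).
apply: (cequiv_trans HR (cmul1 HR _)).
by apply: (cstar_congr HR); exact: (cequiv_sym HR).
Qed.

Let adj_chi n i : (i < size (P n))%N ->
  adj (Achi K (nth set0 (P n) i)) (Achi K (nth set0 (P n) i)).
Proof.
move: HPhi => [_ [_ [_ [_ [_ [_ [hA _]]]]]]] iP.
have v : Avalid (Achi K (nth set0 (P n) i)).
  by apply/Avalid1/locally_constant_chi; have [] := P_clopen iP.
split=> //.
have h := hA n _ _ (inA_chi c_inv TiK iP) (represents_chi c_inv TK TiK P_disj P_cover iP).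
apply: (cequiv_trans HR h); apply: (cequiv_sym HR).
apply: (cequiv_trans HR (cstar_congr HR h)); apply: (cequiv_dst0 HR) => k.
pose D := floor_blk K T E P n (nth set0 (P n) i).
rewrite -[cstar _ k]/((n, dstar Rs n D) : nat * del Rs).
suff -> : dstar Rs n D = D by exact: (dst_refl HR).
apply/funext => w; apply/funext => a; apply/funext => b.
rewrite /= /D /floor_blk [b == a]eq_sym; case: eqP => [->|_] /=.
  by case: asboolP => _; rewrite ?(involution0 c_inv) ?(involution1 c_inv).
exact: involution0.
Qed.

Let adj_power_nat (i : nat) : adj [:: (i%:Z, fun=> 1)] [:: (- i%:Z, fun=> 1)].
Proof.
elim: i => [|i IH]; first by rewrite oppr0; exact: adj_one.
have e : (fun _ : X => (1 : K) * 1) = fun=> 1 by apply/funext => x; rewrite mulr1.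
have e1 : Amul T Ti (At X K) [:: (i%:Z, fun=> 1)] = [:: (i.+1%:Z, fun=> 1)].
  by rewrite /At Amul1 e.
have e2 : Amul T Ti [:: (- i%:Z, fun=> (1 : K))] [:: (-1%Z, fun=> 1)] =
    [:: (- i.+1%:Z, fun=> 1)].
  by rewrite Amul1 e // -opprD -PoszD addn1.
by rewrite -e1 -e2; apply: adj_mul; rewrite ?e1 ?e2; [exact: valid1|exact: valid1|exact: adj_t|].
Qed.

Let adj_power (k : int) : adj [:: (k, fun=> 1)] [:: (- k, fun=> 1)].
Proof.
case: k => i; first exact: adj_power_nat.
by rewrite NegzE opprK; apply: adj_sym; exact: adj_power_nat.
Qed.

Let adj_sum (d : nat -> K) n (s : seq nat) : {in s, forall i, (i < size (P n))%N} ->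
  adj (flatten [seq Ascale (d i) (Achi K (nth set0 (P n) i)) | i <- s])
      (flatten [seq Ascale (c (d i)) (Achi K (nth set0 (P n) i)) | i <- s]).
Proof.
elim: s => [|i s IH] hs.
  (* The empty sum is treated as 0 times the unit. *)
  apply: (adj_eq _ _ _ _ (adj_scale 0 adj_one)) => // k x.
    by rewrite coefA_scale mul0r coefA_nil.
  by rewrite coefA_scale (involution0 c_inv) mul0r coefA_nil.
apply: (@adj_cat (Ascale (d i) (Achi K (nth set0 (P n) i)))
  (Ascale (c (d i)) (Achi K (nth set0 (P n) i)))); last first.
  by apply: IH => j js; apply: hs; rewrite inE js orbT.
by apply: adj_scale; apply: adj_chi; apply: hs; exact: mem_head.
Qed.

Let adj_fun (f : X -> K) : locally_constant f ->
  adj [:: (0%Z, f)] [:: (0%Z, fun x => c (f x))].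
Proof.
move=> lf; have [n fc] := locally_constant_cell lf; have [d hd] := cell_sum fc.
have [cD _ _] := c_inv.
have Aeq_sym (a b : Aelt X K) : Aeq a b -> Aeq b a by move=> h k x; rewrite h.
apply: (adj_eq _ _ (Aeq_sym _ _ (hd id erefl (fun _ _ => erefl)))
  (Aeq_sym _ _ (hd c (involution0 c_inv) cD))).
- exact: Avalid1.
- by apply: Avalid1; exact: locally_constant_comp.
- apply: adj_cat; first by apply: adj_scale; exact: adj_one.
  by apply: adj_sum => i; rewrite mem_iota.
Qed.

(** Each term [f t^i] is the product of [f] and [t^i], whose adjoints are known; the reversed
    product of these is the corresponding term of [Astar]. *)
Let adj_all a : Avalid a -> adj a (Astar c T Ti a).
Proof.
elim: a => [|[i f] a IH].
  move=> _; apply: (adj_eq _ _ _ _ (adj_scale 0 adj_one)) => // k x.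
    by rewrite coefA_scale mul0r coefA_nil.
  by rewrite coefA_scale (involution0 c_inv) mul0r coefA_nil.
move=> /Avalid_cons [lf va].
rewrite -[Astar _ _ _ _]/([:: (- i, fun x => c (f (Tz T Ti i x)))] ++ Astar c T Ti a).
rewrite -cat1s; apply: adj_cat; last exact: IH.
have e1 : Amul T Ti [:: (0%Z, f)] [:: (i, fun=> 1)] = [:: (i, f)].
  by rewrite Amul1 add0r; congr [:: (_, _)]; apply/funext => x; rewrite mulr1.
have e2 : Amul T Ti [:: (- i, fun=> (1 : K))] [:: (0%Z, fun x => c (f x))] =
    [:: (- i, fun x => c (f (Tz T Ti i x)))].
  by rewrite Amul1 addr0 opprK; congr [:: (_, _)]; apply/funext => x; rewrite mul1r.
have v1 : Avalid [:: (i, f)] by exact: Avalid1.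
have v2 := Avalid_star v1.
by rewrite -{1}e1 -e2; apply: adj_mul; rewrite ?e1 ?e2 //; exact: adj_fun.
Qed.

Theorem Phi_star a : Avalid a -> cequiv (Phi (Astar c T Ti a)) (cstar (Phi a)).
Proof. by move=> /adj_all []. Qed.

End PhiStar.

Theorem theorem4p9 (R : realType) (X : pseudoPMetricType R) (K : fieldType)
  (c : K -> K) (T Ti : X -> X)
  (mu : {measure set (g_sigma_algebraType (@open X)) -> \bar R})
  (y : X) (E : nat -> set X) (P : nat -> seq (set X)) :
  (* X infinite, totally disconnected, compact, metric (Hausdorff) *)
  hausdorff_space X -> compact [set: X] -> totally_disconnected [set: X] ->
  infinite_set [set: X] ->
  (* T homeomorphism with inverse Ti *)
  cancel T Ti -> cancel Ti T -> continuous T -> continuous Ti ->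
  (* involution on K *)
  field_involution c ->
  (* mu: full, ergodic, T-invariant Borel probability measure *)
  mu [set: X] = 1%E ->
  (forall B : set (g_sigma_algebraType (@open X)),
      measurable B -> mu (T @^-1` B) = mu B) ->
  (forall B : set (g_sigma_algebraType (@open X)),
      measurable B -> T @^-1` B = B -> mu B = 0%E \/ mu B = 1%E) ->
  (forall U : set X, open U -> U !=set0 -> (0 < mu U)%E) ->
  (* the clopen sets E_n *)
  (forall n, clopen (E n)) -> (forall n, E n.+1 `<=` E n) ->
  \bigcap_n E n = [set y] ->
  (* the partitions P_n of X \ E_n *)
  (forall n i, (i < size (P n))%N ->
      clopen (nth set0 (P n) i) /\ nth set0 (P n) i !=set0) ->
  (forall n i j, (i < size (P n))%N -> (j < size (P n))%N -> i <> j ->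
      nth set0 (P n) i `&` nth set0 (P n) j = set0) ->
  (forall n x, ~ E n x <-> exists2 i, (i < size (P n))%N & nth set0 (P n) i x) ->
  (forall n B, memPE E P n.+1 B -> exists2 B', memPE E P n B' & B `<=` B') ->
  (* the union of the P_n and {E_n} generates the topology (as a subbase) *)
  (forall U : set X, open U -> forall x, U x ->
     exists (m : nat) (Bs : nat -> set X),
       [/\ forall i, (i < m)%N -> exists n, memPE E P n (Bs i),
           forall i, (i < m)%N -> Bs i x
         & forall z, (forall i, (i < m)%N -> Bs i z) -> U z]) ->
  (* conclusion *)
  (exists f, alg_iso f (S1 := R_sys c T E P mu) (S2 := MK_sys R c)) /\
  (positive_definite c ->
     star_regular (R_sys c T E P mu) c /\
     (forall Phi, @Phi_spec R X K c T Ti E P mu Phi ->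
        forall a, Avalid a -> cequiv (Phi (Astar c T Ti a)) (cstar (Phi a))) /\
     (exists f, star_alg_iso f (S1 := R_sys c T E P mu) (S2 := MK_sys R c))).
Proof.
move=> X_haus X_comp _ X_inf TK TiK T_cont Ti_cont c_inv mu1 mu_T mu_erg mu_full
  E_clopen E_dec E_cap P_clopen P_disj P_cover P_refine P_base.
have H : tower_theory T mu E P by exact: (@towers _ _ T Ti mu y).
have [f hf] := tower_limit_iso c_inv H.
split; first by exists f; case: hf.
move=> c_pd; split; first exact: tower_star_regular.
split; last by exists f.
move=> Phi hPhi a va; apply: (Phi_star c_inv TK TiK T_cont Ti_cont (y := y) H) => //.
exact: E_y E_cap.
Qed.
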